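(* Let $\rho_0,u_0\in C^1(\mathbb{R})$ with $\rho_0(x)>0$ for all $x\in\mathbb{R}$, and suppose there exists $\delta>0$ such that $u_{0x}$ and $(1+x^2)^{(2+\delta)/2}\rho_0(x)$ are bounded continuous functions on $\mathbb{R}$. Set $M_0=\int_{\mathbb{R}}\rho_0(x)\,dx$. Consider the one-dimensional pressureless damped Euler system $$\rho_t+(\rho u)_x=0,\qquad u_t+uu_x+u=-\partial W\star\rho,\qquad W(x)=-|x|+\frac{|x|^2}{2},$$ with $\rho(x,0)=\rho_0(x)$, $u(x,0)=u_0(x)$. There exists a unique global solution $\rho,u\in C^1(\mathbb{R}\times(0,\infty))$ if and only if for all $x\in\mathbb{R}$ the following holds. (1) (Subcritical mass) In the case $M_0<1/4$: $$(\rho_0(x),u_0'(x))\in\{(\rho,d):\ d>-\rho R_a(1/\rho),\ \rho>0\},$$ where $R_a:[0,\infty)\to[0,\infty)$ is a continuous function satisfying $$\frac{dR_a}{ds}=1+\frac{1}{R_a}(2-M_0s),\qquad R_a(0)=0.$$ (2) (Critical mass) In the case $M_0=1/4$: $$(\rho_0(x),u_0'(x))\in\{(\rho,d):\ d>-\rho R_b(1/\rho),\ \rho>0\},$$ where $R_b:[0,\infty)\to[0,\infty)$ is a continuous function satisfying $$\frac{dR_b}{ds}=1+\frac{1}{R_b}(2-s/4),\qquad R_b(0)=0.$$ (3) (Supercritical mass) In the case $M_0>1/4$: $$(\rho_0(x),u_0'(x))\in\{(\rho,d):\ -\rho R_1(1/\rho)<d<-\rho R_2(\gamma-1/\rho),\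 \rho\in(1/\gamma,\infty)\},$$ where $$\gamma=\frac{2}{M_0}\left(1+e^{\frac{\pi}{\sqrt{4M_0-1}}}\right),$$ $R_1:[0,\gamma]\to\mathbb{R}^+\cup\{0\}$ is a continuous function satisfying $$\frac{dR_1}{ds}=1+\frac{1}{R_1}(2-M_0s),\qquad R_1(0)=0,$$ and $R_2:[0,\gamma]\to\mathbb{R}^-\cup\{0\}$ is a continuous function satisfying $$\frac{dR_2}{ds}=-1+\frac{1}{R_2}(M_0(\gamma-s)-2),\qquad R_2(0)=0.$$
   Context: The solution is sought for $x\in\mathbb{R}$, $t>0$; $u_0'$ is the derivative of $u_0$. The nonlocal term is $(\partial W\star\rho)(x,t)=\int_{\mathbb{R}}[-\mathrm{sgn}(x-y)+(x-y)]\rho(y,t)\,dy$. Solutions are $C^1$ (classical) solutions satisfying, at each time $t$ of existence, $\rho|u|^i\to0$ as $|x|\to\infty$ for $i=1,2$ and $\rho(x,t)\le C/|x|^{2+\delta}$ for a constant $C$. The differential equations for $R_a,R_b$ are understood for $s>0$, and those for $R_1,R_2$ for $0<s<\gamma$ (where the respective function is nonzero).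
   Formalization: The formal theorem additionally assumes that u_0' is C^1 (u_0 of class C^2); with u_0 only C^1 the claim fails, since a global solution with rho in C^1 forces u_0' to be C^1 (e.g. u_0'=|x|/(1+|x|) with small M_0). *)

(* Defs.v *)
From HB Require Import structures.
From mathcomp Require Import all_boot all_order all_algebra.
From mathcomp Require Import all_classical all_reals all_analysis.

Set Implicit Arguments.
Unset Strict Implicit.
Unset Printing Implicit Defensive.

Import Order.TTheory GRing.Theory Num.Theory.
Import numFieldNormedType.Exports.

Local Open Scope classical_set_scope.
Local Open Scope ring_scope.

Section Regularity.
Variable R : realType.

Definition C1 (f : R -> R) : Prop :=
  (forall x : R, derivable f x 1) /\ continuous (derive1 f).

Definition dx (f : R -> R -> R) (x t : R) : R := derive1 (fun y => f y t) x.
Definition dt (f : R -> R -> R) (x t : R) : R := derive1 (f x) t.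

(* f is of class C^1 on R x (0, oo): both partial derivatives exist there and
   are jointly continuous. *)
Definition C1_halfplane (f : R -> R -> R) : Prop :=
  forall x t : R, 0 < t ->
    [/\ derivable (fun y => f y t) x 1,
        derivable (f x) t 1,
        {for (x, t), continuous (fun p : R * R => dx f p.1 p.2)}
      & {for (x, t), continuous (fun p : R * R => dt f p.1 p.2)}].

(* Gives a meaning to the initial condition of a function which is C^1 only for
   positive times. *)
Definition continuous_closed_halfplane (f : R -> R -> R) : Prop :=
  {within [set p : R * R | 0 <= p.2], continuous (fun p : R * R => f p.1 p.2)}.

End Regularity.

Section DampedEuler.
Variable R : realType.
Local Notation mu := (@lebesgue_measure R).

Definition W (x : R) : R := - `|x| + `|x| ^+ 2 / 2.

(* The derivative of W away from 0 (see derive1_W). *)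
Definition dW (x : R) : R := - Num.sg x + x.

Lemma derive1_W (x : R) : x != 0 -> derive1 W x = dW x.
Proof.
move=> x0; rewrite /W /dW derive1E.
have -> : (fun z : R => - `|z| + `|z| ^+ 2 / 2) =
          (fun z : R => - `|z| + z ^+ 2 / 2).
  by apply/funext => z; rewrite real_normK ?num_real.
have dsq : is_derive x 1 (fun z : R => z ^+ 2 / 2) x.
  have -> : (fun z : R => z ^+ 2 / 2) = 2^-1 \*: (fun z : R => z * z).
    by apply/funext => z; rewrite expr2 mulrC.
  apply: is_derive_eq; rewrite [_%:A]mulr1 -mulr2n -[x *+ 2]mulr_natl.
  by rewrite [_ *: _]mulrA mulVf ?mul1r ?pnatr_eq0.
suff dabs : is_derive x 1 (fun z : R => - `|z|) (- Num.sg x) by apply: derive_val.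
case: (ltrgt0P x) x0 => // [xp|xn] _.
- rewrite (gtr0_sg xp).
  apply: (@near_eq_is_derive _ _ _ (fun z => - z)).
  by near=> z; rewrite gtr0_norm //; near: z; exact: lt_nbhsr.
- rewrite (ltr0_sg xn) opprK.
  apply: (@near_eq_is_derive _ _ _ (fun z => z)).
  by near=> z; rewrite ltr0_norm ?opprK //; near: z; exact: lt_nbhsl.
Unshelve. all: by end_near.
Qed.

Definition mass (rho0 : R -> R) : R := (\int[mu]_x rho0 x)%R.

Definition dW_kernel (rho : R -> R -> R) (x t y : R) : R :=
  dW (x - y) * rho y t.

Definition dW_conv (rho : R -> R -> R) (x t : R) : R :=
  (\int[mu]_y dW_kernel rho x t y)%R.

(* [Rintegral] is total, so the existence of the convolution is required
   separately. *)
Definition euler_system (rho u : R -> R -> R) : Prop :=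
  forall x t : R, 0 < t ->
    [/\ mu.-integrable setT (EFin \o dW_kernel rho x t),
        dt rho x t + dx (fun y s => rho y s * u y s) x t = 0
      & dt u x t + u x t * dx u x t + u x t = - dW_conv rho x t].

(* C may depend on t: the bound is a condition at each time. *)
Definition decay (delta : R) (rho u : R -> R -> R) (t : R) : Prop :=
  (forall i : nat, (1 <= i <= 2)%N ->
     ((fun x => rho x t * `|u x t| ^+ i) @ +oo --> (0 : R)) /\
     ((fun x => rho x t * `|u x t| ^+ i) @ -oo --> (0 : R))) /\
  (exists C : R, forall x : R, x != 0 -> rho x t <= C / `|x| `^ (2 + delta)).

Definition global_solution (delta : R) (rho0 u0 : R -> R)
    (rho u : R -> R -> R) : Prop :=
  [/\ C1_halfplane rho /\ C1_halfplane u,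
      continuous_closed_halfplane rho /\ continuous_closed_halfplane u,
      euler_system rho u,
      forall x, rho x 0 = rho0 x /\ u x 0 = u0 x
    & forall t : R, 0 <= t -> decay delta rho u t].

(* Functions on R x [0, oo) are represented by total functions, whose values at
   negative times are irrelevant. *)
Definition unique_global_solution (delta : R) (rho0 u0 : R -> R) : Prop :=
  exists rho u, global_solution delta rho0 u0 rho u /\
    forall rho' u', global_solution delta rho0 u0 rho' u' ->
      forall x t : R, 0 <= t -> rho' x t = rho x t /\ u' x t = u x t.

End DampedEuler.

Section Thresholds.
Variable R : realType.

(* Functions defined on an interval are represented by total functions; nothing
   is said about their values elsewhere. The conditions [_ != 0] are needed
   because x / 0 = 0. *)

Definition is_Ra (M0 : R) (Ra : R -> R) : Prop :=
  [/\ {within `[0, +oo[, continuous Ra},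
      forall s : R, 0 <= s -> 0 <= Ra s,
      Ra 0 = 0
    & forall s : R, 0 < s ->
        Ra s != 0 /\ is_derive s 1 Ra (1 + 1 / Ra s * (2 - M0 * s))].

Definition is_Rb (Rb : R -> R) : Prop :=
  [/\ {within `[0, +oo[, continuous Rb},
      forall s : R, 0 <= s -> 0 <= Rb s,
      Rb 0 = 0
    & forall s : R, 0 < s ->
        Rb s != 0 /\ is_derive s 1 Rb (1 + 1 / Rb s * (2 - s / 4))].

Definition gamma (M0 : R) : R :=
  2 / M0 * (1 + expR (pi / Num.sqrt (4 * M0 - 1))).

Definition is_R1 (M0 : R) (R1 : R -> R) : Prop :=
  [/\ {within `[0, gamma M0], continuous R1},
      forall s : R, 0 <= s <= gamma M0 -> 0 <= R1 s,
      R1 0 = 0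
    & forall s : R, 0 < s < gamma M0 ->
        R1 s != 0 /\ is_derive s 1 R1 (1 + 1 / R1 s * (2 - M0 * s))].

Definition is_R2 (M0 : R) (R2 : R -> R) : Prop :=
  [/\ {within `[0, gamma M0], continuous R2},
      forall s : R, 0 <= s <= gamma M0 -> R2 s <= 0,
      R2 0 = 0
    & forall s : R, 0 < s < gamma M0 ->
        R2 s != 0 /\
        is_derive s 1 R2 (- 1 + 1 / R2 s * (M0 * (gamma M0 - s) - 2))].

(* Elements are pairs (rho, d). The same region, with Ra or Rb, serves the
   subcritical and the critical case. *)
Definition region_above (Q : R -> R) : set (R * R) :=
  [set p | p.2 > - p.1 * Q (1 / p.1) /\ p.1 > 0].

Definition region_between (M0 : R) (R1 R2 : R -> R) : set (R * R) :=
  [set p | - p.1 * R1 (1 / p.1) < p.2 < - p.1 * R2 (gamma M0 - 1 / p.1)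
           /\ p.1 > 1 / gamma M0].

End Thresholds.

(* Main.v *)
Require Import Defs.
From HB Require Import structures.
From mathcomp Require Import all_boot all_order all_algebra.
From mathcomp Require Import all_classical all_reals all_analysis.
From mathcomp Require Import measurable_realfun ring lra.
Import Order.TTheory GRing.Theory Num.Theory.
Import numFieldNormedType.Exports.
Local Open Scope classical_set_scope.
Local Open Scope ring_scope.

(** Along a characteristic [X' = u(X, t)] the velocity equation reads
    [X'' + X' = 2 m - M - M X + P], where [M] is the total mass, [P] the first
    moment of [rho] and [m] the mass to the left of [X]: the singular part of the
    kernel only sees on which side of the point the mass lies ([has_int_dW],
    [force_at]). The mass to the left is transported, so [m] does not depend on
    time and the difference of two characteristics solves the damped oscillator
    [y'' + y' + M y = const]. Differentiating in the initial position, the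
    Jacobian of the flow is
      [y(t) = a(t) + b(t) u0'(x) + 2 h(t) rho0(x)],
    with [a], [b], [h] the elementary solutions gathered in [fund], and
    [rho (X, t) y = rho0]. Hence a solution can be global only if all these
    functions [y] stay positive ([jac_gt0]); conversely positivity lets one invert
    the explicit flow and read off the solution ([solution_exists]). It remains
    to decide when [y > 0] for all times.

    Subcritical and critical mass. The oscillator is not underdamped, so [b > 0] at
    positive times. In the plane of [w = y / rho0] and [w'] the boundary of the
    admissible data is the trajectory of [w'' + w' + M w = 2] which arrives at
    the origin; run backwards it is the curve [crit], whose graph over its first
    coordinate is the only solution of the threshold equation ([Ra_crit]).
    Comparing [y] with the time translate of [crit] that has the same initial
    value leaves a multiple of [b], and the sign of the multiple decides
    ([region_aboveP]).

    Supercritical mass. After half a period of the oscillation [b = 0] and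
    [a < 0]. As [rho0] tends to [0] at infinity, [y] is negative there at that time
    for some label, so no global solution exists ([no_solution_underdamped]). On
    the other side the region asks for [rho0 > 1 / gamma] everywhere, which is
    impossible for the same reason ([region_between_empty]): both sides of the
    equivalence are false. The curves [R1] and [R2] are the two arcs of [crit]
    before and after the half period.

    The delicate point is that an arbitrary solution is controlled at infinity
    only at each time separately, with no uniformity in time, and its velocity is
    not known to be bounded or Lipschitz. Global characteristics are therefore
    not given by the Cauchy-Lipschitz theorem on a strip. They are obtained by
    freezing the transported mass, which turns the equation of characteristics
    into a linear one, and by checking afterwards that the solution is a
    characteristic ([char_exists]). Since characteristics cover the line and keep
    their order, comparing the limits of the mass at both ends shows that the
    total mass is constant at positive times ([mass_constant]). Characteristics
    are then followed down to the initial time: as [rho0 > 0], mass cannot escape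
    at once, which keeps them in a bounded set ([bounded_labels]); the flow is
    thus defined from the initial time on ([flow_from_zero]). It is explicit up to
    a translation depending on time only, and the translation between the flows
    of two solutions obeys [c'' + c' = 0], hence vanishes ([flow_unique]).

    For existence, besides positivity of the Jacobian one needs a positive lower
    bound at each time ([jac_lower]), so that the flow is onto and the density is
    bounded by that of the label; as positions grow at most like labels, the
    decay of [rho0] is inherited ([sol_decay]). One also needs the value of
    the centre of mass ([sol_moments]), which makes the explicit flow feel exactly
    the force generated by its own density. *)

(** * Derivatives of real functions *)

Section DerivativeRules.
Context {R : realType}.
Implicit Types (f g : R -> R) (x l m c : R).

Lemma der_eq {f x l m} : is_derive x 1 f l -> l = m -> is_derive x 1 f m.
Proof. by move=> h <-. Qed.

Lemma der_near {f} g x l : (\forall y \near x, f y = g y) ->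
  is_derive x 1 f l -> is_derive x 1 g l.
Proof.
move=> fg h; apply: (@near_eq_is_derive _ _ _ f) => //.
Qed.

Lemma der_pos {f g x l} : 0 < x -> (forall y, 0 < y -> f y = g y) ->
  is_derive x 1 f l -> is_derive x 1 g l.
Proof.
move=> x0 fg; apply: der_near.
have : \forall y \near x, 0 < y by apply: lt_nbhsr.
by apply: filterS => y; exact: fg.
Qed.

Lemma derC c x : is_derive x 1 (fun=> c) 0.
Proof. exact: is_derive_cst. Qed.

Lemma derI x : is_derive x 1 (fun y : R => y) 1.
Proof. exact: is_derive_id. Qed.

Lemma derD {f g x l m} : is_derive x 1 f l -> is_derive x 1 g m ->
  is_derive x 1 (fun y => f y + g y) (l + m).
Proof. exact: is_deriveD. Qed.

Lemma derN {f x l} : is_derive x 1 f l -> is_derive x 1 (fun y => - f y) (- l).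
Proof. exact: is_deriveN. Qed.

Lemma derB {f g x l m} : is_derive x 1 f l -> is_derive x 1 g m ->
  is_derive x 1 (fun y => f y - g y) (l - m).
Proof. exact: is_deriveB. Qed.

Lemma derM {f g x l m} : is_derive x 1 f l -> is_derive x 1 g m ->
  is_derive x 1 (fun y => f y * g y) (f x * m + g x * l).
Proof. exact: is_deriveM. Qed.

Lemma derZ c {f x l} : is_derive x 1 f l ->
  is_derive x 1 (fun y => c * f y) (c * l).
Proof. by move=> h; apply: (der_eq (derM (derC c x) h)); ring. Qed.

Lemma derZr c {f x l} : is_derive x 1 f l ->
  is_derive x 1 (fun y => f y * c) (l * c).
Proof. by move=> h; apply: (der_eq (derM h (derC c x))); ring. Qed.

Lemma derZI c x : is_derive x 1 (fun y => c * y) c.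
Proof. by apply: (der_eq (derZ c (derI x))); rewrite mulr1. Qed.

Lemma derX2 {f x l} : is_derive x 1 f l ->
  is_derive x 1 (fun y => f y ^+ 2) (2 * f x * l).
Proof. by move=> h; apply: (der_eq (derM h h)); ring. Qed.

Lemma der_comp f g {x l m} : is_derive x 1 f l -> is_derive (f x) 1 g m ->
  is_derive x 1 (fun y => g (f y)) (m * l).
Proof. by move=> h k; have := @is_derive1_comp _ g f x _ _ k h; apply. Qed.

Lemma derV {f x l} : f x != 0 -> is_derive x 1 f l ->
  is_derive x 1 (fun y => (f y)^-1) (- l / f x ^+ 2).
Proof.
move=> f0 h; have := @is_deriveV R f x l 1 f0 h => h'.
by apply: (der_eq h'); rewrite /GRing.scale /= !mulNr mulrC.
Qed.

Lemma der_expM c x : is_derive x 1 (fun y => expR (c * y)) (c * expR (c * x)).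
Proof.
by apply: (der_eq (der_comp _ expR (derZI c x) (is_derive_expR _))); rewrite mulrC.
Qed.

Lemma der_derivable f x l : is_derive x 1 f l -> derivable f x 1.
Proof. by case. Qed.

Lemma der_derive1 {f x l} : is_derive x 1 f l -> derive1 f x = l.
Proof. by move=> h; rewrite derive1E; exact: derive_val. Qed.

Lemma derivable_der {f x} : derivable f x 1 -> is_derive x 1 f (derive1 f x).
Proof. by move=> h; rewrite derive1E; exact/derivableP. Qed.

Lemma der_cont {f x l} : is_derive x 1 f l -> {for x, continuous f}.
Proof.
by move=> h; apply: differentiable_continuous; apply/derivable1_diffP; case: h.
Qed.

Lemma der_within {f} {df : R -> R} {a b : R} :
  (forall x, a <= x <= b -> is_derive x 1 f (df x)) ->
  {within `[a, b], continuous f}.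
Proof.
move=> h; apply: continuous_in_subspaceT => x /set_mem /=.
by rewrite in_itv /= => xab; exact: der_cont (h x xab).
Qed.

Lemma withinD A f g : {within A, continuous f} -> {within A, continuous g} ->
  {within A, continuous (fun x => f x + g x)}.
Proof. by move=> fc gc x; apply: cvgD; [exact: fc|exact: gc]. Qed.

Lemma withinN A f : {within A, continuous f} ->
  {within A, continuous (fun x => - f x)}.
Proof. by move=> fc x; apply: cvgN; exact: fc. Qed.

Lemma withinB A f g : {within A, continuous f} -> {within A, continuous g} ->
  {within A, continuous (fun x => f x - g x)}.
Proof. by move=> fc gc x; apply: cvgB; [exact: fc|exact: gc]. Qed.

Lemma withinM A f g : {within A, continuous f} -> {within A, continuous g} ->
  {within A, continuous (fun x => f x * g x)}.
Proof. by move=> fc gc x; apply: cvgM; [exact: fc|exact: gc]. Qed.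

Lemma within_cst (A : set R) c : {within A, continuous (fun=> c)}.
Proof. by move=> x; exact: cvg_cst. Qed.

(** The mean value theorem in the form of a comparison of two functions, one of
    which controls the derivative of the other. *)
Lemma der_le {f g df dg : R -> R} {a b : R} : a <= b ->
  {within `[a, b], continuous f} -> {within `[a, b], continuous g} ->
  (forall x, a < x < b -> is_derive x 1 f (df x)) ->
  (forall x, a < x < b -> is_derive x 1 g (dg x)) ->
  (forall x, a < x < b -> df x <= dg x) ->
  f b - f a <= g b - g a.
Proof.
rewrite le_eqVlt => /predU1P[->|ab] fc gc fd gd le; first by rewrite !subrr.
have [||c] := @MVT _ (fun x => g x - f x) (fun x => dg x - df x) a b ab.
- by move=> x; rewrite in_itv /= => xab; apply: derB; [exact: gd|exact: fd].
- exact: withinB.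
rewrite in_itv /= => cab e.
have : 0 <= (dg c - df c) * (b - a).
  by apply: mulr_ge0; rewrite subr_ge0; [exact: le|exact: ltW].
lra.
Qed.

Lemma der_le_closed {f g df dg : R -> R} {a b : R} : a <= b ->
  (forall x, a <= x <= b -> is_derive x 1 f (df x)) ->
  (forall x, a <= x <= b -> is_derive x 1 g (dg x)) ->
  (forall x, a <= x <= b -> df x <= dg x) ->
  f b - f a <= g b - g a.
Proof.
move=> ab fd gd le.
have W x : a < x < b -> a <= x <= b by move=> /andP[/ltW -> /ltW ->].
apply: (der_le ab (der_within fd) (der_within gd)) => x /W.
- exact: fd.
- exact: gd.
- exact: le.
Qed.

Lemma der_diff_eq {f g} {df : R -> R} {a b : R} : a <= b ->
  (forall x, a <= x <= b -> is_derive x 1 f (df x)) ->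
  (forall x, a <= x <= b -> is_derive x 1 g (df x)) ->
  f b - f a = g b - g a.
Proof.
move=> ab fd gd; apply/eqP; rewrite eq_le; apply/andP.
by split; [apply: (der_le_closed ab fd gd)|apply: (der_le_closed ab gd fd)].
Qed.

Lemma der_diff_eqT {f g} {df : R -> R} (a b : R) :
  (forall x, is_derive x 1 f (df x)) -> (forall x, is_derive x 1 g (df x)) ->
  f b - f a = g b - g a.
Proof.
move=> fd gd; have [ab|/ltW ab] := leP a b; first exact: (der_diff_eq ab).
rewrite -opprB -[RHS]opprB; congr (- _).
exact: (der_diff_eq ab (fun x _ => fd x) (fun x _ => gd x)).
Qed.

(** The derivative of [w] times the exponential is nonpositive, whatever the sign
    of [K]. *)
Lemma gronwall_weighted {w dw : R -> R} (K : R) {a b : R} : a <= b ->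
  {within `[a, b], continuous w} ->
  (forall x, a < x < b -> is_derive x 1 w (dw x)) ->
  (forall x, a < x < b -> dw x <= K * w x) ->
  w b * expR (- K * b) <= w a * expR (- K * a).
Proof.
move=> ab wc wd le.
have eder x : is_derive x 1 (fun y => expR (- K * y)) (- K * expR (- K * x)).
  exact: der_expM.
have ec : {within `[a, b], continuous (fun y => expR (- K * y))}.
  exact: (der_within (fun x _ => eder x)).
pose g y := w y * expR (- K * y).
have gc : {within `[a, b], continuous g}.
  exact: withinM.
have cc : {within `[a, b], continuous (fun=> 0 : R)} by exact: within_cst.
have := der_le ab gc cc (fun x xab => derM (wd x xab) (eder x))
   (fun x _ => derC 0 x) _.
rewrite subrr subr_le0; apply => x xab; have h := le x xab.
have := mulr_ge0 (expR_ge0 (- K * x)) (_ : 0 <= K * w x - dw x).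
by rewrite subr_ge0 => /(_ h); lra.
Qed.

(** The exponential weight is positive, so only the sign of [w] is propagated. *)
Lemma gronwall_fwd {w dw : R -> R} (K : R) {a b : R} : a <= b ->
  {within `[a, b], continuous w} ->
  (forall x, a < x < b -> is_derive x 1 w (dw x)) ->
  (forall x, a < x < b -> dw x <= K * w x) ->
  w a <= 0 -> w b <= 0.
Proof.
move=> ab wc wd le w0; have := gronwall_weighted K ab wc wd le.
have : w a * expR (- K * a) <= 0 by rewrite pmulr_lle0 ?expR_gt0.
by move=> h1 h2; have := le_trans h2 h1; rewrite pmulr_lle0 ?expR_gt0.
Qed.

Lemma gronwall_bwd {w dw : R -> R} (K : R) {a b : R} : a <= b ->
  {within `[a, b], continuous w} ->
  (forall x, a < x < b -> is_derive x 1 w (dw x)) ->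
  (forall x, a < x < b -> - dw x <= K * w x) ->
  w b <= 0 -> w a <= 0.
Proof.
move=> ab wc wd le w0.
have nc : {within `[a, b], continuous (fun x => - w x)}.
  exact: withinN.
have := gronwall_weighted (- K) ab nc (fun x xab => derN (wd x xab)) _.
rewrite opprK !mulNr lerN2 => H.
have h2 : w a * expR (K * a) <= w b * expR (K * b).
  by apply: H => x xab; have := le x xab; lra.
have : w b * expR (K * b) <= 0 by rewrite pmulr_lle0 ?expR_gt0.
by move=> h1; have := le_trans h2 h1; rewrite pmulr_lle0 ?expR_gt0.
Qed.

(** Gronwall for [e ^+ 2 + g ^+ 2], whose derivative is bounded by a multiple of
    itself, in both directions of time. *)
Lemma linear_system_zero {e g de dg : R -> R} (K : R) {a b : R} c : 0 <= K -> a <= c <= b ->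
  {within `[a, b], continuous e} -> {within `[a, b], continuous g} ->
  (forall x, a < x < b -> is_derive x 1 e (de x)) ->
  (forall x, a < x < b -> is_derive x 1 g (dg x)) ->
  (forall x, a < x < b -> `|de x| <= K * (`|e x| + `|g x|)) ->
  (forall x, a < x < b -> `|dg x| <= K * (`|e x| + `|g x|)) ->
  e c = 0 -> g c = 0 ->
  forall x, a <= x <= b -> e x = 0 /\ g x = 0.
Proof.
move=> K0 /andP[ac cb] ec gc ed gd le lg e0 g0 x /andP[ax xb].
pose w x := e x ^+ 2 + g x ^+ 2.
pose dw x := 2 * e x * de x + 2 * g x * dg x.
have wc : {within `[a, b], continuous w}.
  by rewrite /w; apply: withinD; apply: withinM.
have wd y : a < y < b -> is_derive y 1 w (dw y).
  by move=> yab; apply: derD; apply: derX2; [exact: ed|exact: gd].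
have wle y : a < y < b -> `|dw y| <= (4 * K) * w y.
  move=> yab; have h1 := le y yab; have h2 := lg y yab.
  apply: (le_trans (ler_normD _ _)); rewrite !normrM (ger0_norm (ler0n _ 2)).
  rewrite /w -(real_normK (num_real (e y))) -(real_normK (num_real (g y))).
  move: h1 h2 (normr_ge0 (e y)) (normr_ge0 (g y)).
  move: `|e y| `|g y| `|de y| `|dg y| => p q dp dq h1 h2 p0 q0.
  have s1 : p * dp <= p * (K * (p + q)) by exact: ler_wpM2l.
  have s2 : q * dq <= q * (K * (p + q)) by exact: ler_wpM2l.
  have s3 : 0 <= K * (p - q) ^+ 2 by rewrite mulr_ge0 ?sqr_ge0.
  lra.
have w0 : w c <= 0 by rewrite /w e0 g0 expr0n addr0.
suff wx : w x <= 0.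
  have : w x == 0 by rewrite eq_le wx addr_ge0 ?sqr_ge0.
  by rewrite paddr_eq0 ?sqr_ge0 // !sqrf_eq0 => /andP[/eqP -> /eqP ->].
have [xc|cx] := leP x c.
- apply: (gronwall_bwd (dw := dw) (4 * K) xc _ _ _ w0).
  + apply: continuous_subspaceW wc => y /=; rewrite !in_itv /= => /andP[]; lra.
  + by move=> y /andP[? ?]; apply: wd; lra.
  + move=> y /andP[? ?]; have /ler_normlP[+ _] : `|dw y| <= (4 * K) * w y.
      by apply: wle; lra.
    by [].
- apply: (gronwall_fwd (dw := dw) (4 * K) (ltW cx) _ _ _ w0).
  + apply: continuous_subspaceW wc => y /=; rewrite !in_itv /= => /andP[]; lra.
  + by move=> y /andP[? ?]; apply: wd; lra.
  + move=> y /andP[? ?]; have /ler_normlP[_ +] : `|dw y| <= (4 * K) * w y.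
      by apply: wle; lra.
    by [].
Qed.

(** * Primitives *)

(** Integrals from a fixed lower end only make sense to its right; the lower end
    is moved with the point, which does not change differences of values. *)
Lemma primitive_exists f : continuous f ->
  exists G : R -> R, G 0 = 0 /\ forall x, is_derive x 1 G (f x).
Proof.
move=> fc.
have cint a b : (@lebesgue_measure R).-integrable `[a, b] (EFin \o f).
  by apply: continuous_compact_integrable; [exact: segment_compact|
     exact: continuous_subspaceT].
pose H (N x : R) := (\int[lebesgue_measure]_(t in `[- N, x]) f t)%R.
have Hd N x : `|x| < N -> is_derive x 1 (H N) (f x).
  move=> /ltr_normlP[x1 x2].
  have xN : x < N + 1 by lra.
  have Nx : - N < x by lra.
  have [d1 d2] := @continuous_FTC1_closed R f (- N) x (N + 1) xN (cint _ _) Nx (fc x).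
  by rewrite -d2; exact: derivable_der.
pose G x := H (`|x| + 1) x - H (`|x| + 1) 0.
exists G; split=> [|x]; first by rewrite /G subrr.
have key N y : `|y| < N -> G y = H N y - H N 0.
  move=> yN; have hN (z : R) : `|z| <= `|y| -> is_derive z 1 (H N) (f z).
    by move=> zy; apply: Hd; lra.
  have hy (z : R) : `|z| <= `|y| -> is_derive z 1 (H (`|y| + 1)) (f z).
    by move=> zy; apply: Hd; lra.
  have [y0|/ltW y0] := leP 0 y.
    by apply: (der_diff_eq y0) => z /andP[? ?]; [apply: hy|apply: hN];
      rewrite !ger0_norm //; lra.
  rewrite /G -opprB -[RHS]opprB; congr (- _).
  by apply: (der_diff_eq y0) => z /andP[? ?]; [apply: hy|apply: hN];
      rewrite !ler0_norm //; lra.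
apply: (@der_near (fun y => H (`|x| + 1) y - H (`|x| + 1) 0)).
  have : \forall y \near x, `|y| < `|x| + 1.
    by apply: (@cvgr_norm_lt _ _ _ _ _ id x cvg_id); lra.
  by apply: filterS => y yx; rewrite (key (`|x| + 1)).
by apply: (der_eq (derB (Hd _ _ _) (derC _ x))); [lra|rewrite subr0].
Qed.

(** [prim f] is the primitive of [f] which vanishes at [0]; it stands for the
    oriented integral of [f] from [0] to its argument. *)
Definition prim f : R -> R :=
  xget (fun=> 0) [set G | G 0 = 0 /\ forall x, is_derive x 1 G (f x)].

Lemma primP f : continuous f ->
  prim f 0 = 0 /\ forall x, is_derive x 1 (prim f) (f x).
Proof. by move=> /primitive_exists; exact: xgetPex. Qed.

Lemma prim0 f : continuous f -> prim f 0 = 0.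
Proof. by case/primP. Qed.

Lemma der_prim f x : continuous f -> is_derive x 1 (prim f) (f x).
Proof. by case/primP. Qed.

Lemma prim_cont f : continuous f -> continuous (prim f).
Proof. by move=> fc x; exact: der_cont (der_prim f x fc). Qed.
End DerivativeRules.

(** * Linear differential equations *)

Section Picard.
Context {R : realType}.

Lemma halves_lt (A e : R) : 0 < e -> exists n, A / 2 ^+ n < e.
Proof.
move=> e0; have := @cvg_geometric R A 2^-1.
rewrite ger0_norm ?invr_ge0 // => /(_ _)/cvgrPdist_lt.
have l1 : (2^-1 : R) < 1 by lra.
move=> /(_ l1 e e0) [n _ /(_ n (leqnn n))] /=.
rewrite /geometric /= sub0r normrN exprVn => /ltr_normlP[_ h].
by exists n.
Qed.

(** The intervals of centre [a n] and radius [2 * c n] are nested, so the supremum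
    of their left ends lies in all of them. *)
Lemma halves_limit (a c : nat -> R) :
  (forall n, `|a n.+1 - a n| <= c n) -> (forall n, c n.+1 = c n / 2) ->
  exists l, forall n, `|l - a n| <= 2 * c n.
Proof.
move=> ac cc; have c0 n : 0 <= c n by apply: le_trans (ac n).
have lo n m : (n <= m)%N -> a n - 2 * c n <= a m - 2 * c m /\
                            a m + 2 * c m <= a n + 2 * c n.
  elim: m => [|m IH]; first by rewrite leqn0 => /eqP ->.
  rewrite leq_eqVlt => /predU1P[->//|]; rewrite ltnS => /IH [h1 h2].
  have /ler_normlP[h3 h4] := ac m; have := cc m; have := c0 m; split; lra.
have lu n m : a n - 2 * c n <= a m + 2 * c m.
  have := c0 n; have := c0 m.
  by have [/lo[? ?]|/ltnW/lo[? ?]] := leqP n m; lra.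
pose S := [set a n - 2 * c n | n in [set: nat]].
have Sne : S !=set0 by exists (a 0%N - 2 * c 0%N), 0%N.
have Sub m : ubound S (a m + 2 * c m) by move=> _ [n _ <-]; exact: lu.
exists (sup S) => n.
have h1 : sup S <= a n + 2 * c n by apply: sup_le_ub.
have h2 : a n - 2 * c n <= sup S.
  by apply: ub_le_sup; [exists (a 0%N + 2 * c 0%N); exact: Sub|exists n].
by apply/ler_normlP; split; lra.
Qed.

Lemma approx_continuous (a : nat -> R -> R) (y E : R -> R) (A : R) : 0 <= A ->
  (forall n, continuous (a n)) -> continuous E ->
  (forall n t, `|y t - a n t| <= A / 2 ^+ n * E t) -> continuous y.
Proof.
move=> A0 ac Ec yE t0; apply/cvgrPdist_lt => e e0.
have [n] := halves_lt (A * (`|E t0| + 1)) (e / 3) ltac:(lra).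
rewrite mulrAC => hn.
have /cvgrPdist_lt/(_ (e / 3) ltac:(lra)) h1 := ac n t0.
have /cvgrPdist_lt/(_ 1 ltac:(lra)) h2 := Ec t0.
apply: filterS2 h1 h2 => t {}h1 {}h2.
have c0 : 0 <= A / 2 ^+ n by rewrite divr_ge0 // exprn_ge0.
have k1 : `|y t - a n t| < e / 3.
  apply: le_lt_trans (yE n t) (le_lt_trans _ hn).
  apply: ler_wpM2l => //.
  have := ler_norm (E t0); move: h2 => /ltr_normlP[? ?]; lra.
have k0 : `|y t0 - a n t0| < e / 3.
  apply: le_lt_trans (yE n t0) (le_lt_trans _ hn).
  apply: ler_wpM2l => //.
  have := ler_norm (E t0); lra.
move: h1 k0 k1 => /ltr_normlP[? ?] /ltr_normlP[? ?] /ltr_normlP[? ?].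
by apply/ltr_normlP; split; lra.
Qed.

Section LinearODE.
Variables (p1 q1 q2 q3 : R -> R).
Hypotheses (p1c : continuous p1) (q1c : continuous q1) (q2c : continuous q2)
  (q3c : continuous q3).
Variables (s y0 v0 : R).

Let L t := 1 + `|p1 t| + `|q1 t| + `|q2 t| + `|q3 t|.
Let Lc : continuous L.
Proof.
move=> t; rewrite /L.
apply: cvgD; last by apply: cvg_norm; exact: q3c.
apply: cvgD; last by apply: cvg_norm; exact: q2c.
apply: cvgD; last by apply: cvg_norm; exact: q1c.
by apply: cvgD; [exact: cvg_cst|apply: cvg_norm; exact: p1c].
Qed.
Let La t := prim L t - prim L s.
Let dLa (t : R) : is_derive t 1 La (L t).
Proof. by apply: (der_eq (derB (der_prim _ t Lc) (derC _ t))); ring. Qed.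
Let E t := expR (2 * `|La t|).

(* The weight [E] grows twice as fast as the coefficients, so that integrating
   against them gains a factor 2. *)
Let gain (f df : R -> R) (c : R) : 0 <= c -> f s = 0 ->
  (forall t : R, is_derive t 1 f (df t)) ->
  (forall t, `|df t| <= c * (L t * E t)) ->
  forall t, `|f t| <= c / 2 * E t.
Proof.
move=> c0 f0 fd fle t.
have Las : La s = 0 by rewrite /La subrr.
have L0 x : 0 <= L x by rewrite /L !addr_ge0.
have edP (x : R) : is_derive x 1 (fun y => c / 2 * expR (2 * La y))
     (c * (L x * expR (2 * La x))).
  have h := der_comp _ expR (derZ 2 (dLa x)) (is_derive_expR _).
  by apply: (der_eq (derZ (c / 2) h)); field.
have edN (x : R) : is_derive x 1 (fun y => - (c / 2) * expR (- (2 * La y)))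
     (c * (L x * expR (- (2 * La x)))).
  have h := der_comp _ expR (derN (derZ 2 (dLa x))) (is_derive_expR _).
  by apply: (der_eq (derZ (- (c / 2)) h)); field.
have Lamono x y : x <= y -> La x <= La y.
  move=> xy; have := der_le_closed xy (fun z _ => derC 0 z) (fun z _ => dLa z).
  by move=> /(_ (fun z _ => L0 z)); lra.
have f0N : - f s = 0 by rewrite f0 oppr0.
have fdN (x : R) : is_derive x 1 (fun t => - f t) (- df x) by exact: derN (fd x).
have [st|/ltW ts] := leP s t.
- have Lx x : s <= x -> 0 <= La x by move=> /Lamono; rewrite Las.
  have bnd (g dg : R -> R) : g s = 0 -> (forall t : R, is_derive t 1 g (dg t)) ->
    (forall t, dg t <= c * (L t * E t)) -> g t <= c / 2 * E t.
    move=> g0 gd gle.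
    have := der_le_closed st (fun z _ => gd z) (fun z _ => edP z) _.
    rewrite g0 Las mulr0 expR0 /E ger0_norm ?Lx // => H.
    have : g t - 0 <= c / 2 * expR (2 * La t) - c / 2 * 1.
      apply: H => x /andP[sx _]; apply: le_trans (gle x) _.
      by rewrite /E ger0_norm ?Lx.
    by lra.
  apply/ler_normlP; split.
    apply: (bnd (fun t => - f t) (fun t => - df t) f0N fdN).
    by move=> x; have /ler_normlP[] := fle x.
  by apply: (bnd f df f0 fd) => x; have /ler_normlP[] := fle x.
- have Lx x : x <= s -> La x <= 0 by move=> /Lamono; rewrite Las.
  have bnd (g dg : R -> R) : g s = 0 -> (forall t : R, is_derive t 1 g (dg t)) ->
    (forall t, dg t <= c * (L t * E t)) -> - g t <= c / 2 * E t.
    move=> g0 gd gle.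
    have := der_le_closed ts (fun z _ => gd z) (fun z _ => edN z) _.
    rewrite g0 Las mulr0 oppr0 expR0 /E ler0_norm ?Lx // mulrN => H.
    have : 0 - g t <= - (c / 2) * 1 - - (c / 2) * expR (- (2 * La t)).
      apply: H => x /andP[_ sx]; apply: le_trans (gle x) _.
      by rewrite /E ler0_norm ?Lx // mulrN.
    by lra.
  apply/ler_normlP; split.
    by apply: (bnd f df f0 fd) => x; have /ler_normlP[] := fle x.
  rewrite -[f t]opprK.
  apply: (bnd (fun t => - f t) (fun t => - df t) f0N fdN).
  by move=> x; have /ler_normlP[] := fle x.
Qed.

(* The Picard iteration for the system of [linear_ode]. *)
Let step (z : (R -> R) * (R -> R)) : (R -> R) * (R -> R) :=
  let f := prim (fun t => p1 t * z.2 t) in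
  let g := prim (fun t => q1 t * z.2 t + q2 t * z.1 t + q3 t) in
  (fun t => y0 + (f t - f s), fun t => v0 + (g t - g s)).
Let z n := iter n step (fun=> y0, fun=> v0).

Let rhs_cont (u : (R -> R) * (R -> R)) : continuous u.1 -> continuous u.2 ->
  continuous (fun t => p1 t * u.2 t) /\
  continuous (fun t => q1 t * u.2 t + q2 t * u.1 t + q3 t).
Proof.
move=> c1 c2; split=> t; first by apply: cvgM; [exact: p1c|exact: c2].
apply: cvgD; last exact: q3c.
by apply: cvgD; apply: cvgM; [exact: q1c|exact: c2|exact: q2c|exact: c1].
Qed.

Let step_der (u : (R -> R) * (R -> R)) : continuous u.1 -> continuous u.2 ->
  (forall t : R, is_derive t 1 (step u).1 (p1 t * u.2 t)) /\
  (forall t : R, is_derive t 1 (step u).2 (q1 t * u.2 t + q2 t * u.1 t + q3 t)).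
Proof.
move=> c1 c2; have [k1 k2] := rhs_cont u c1 c2; split=> t.
  apply: (der_eq (derD (derC _ t)
    (derB (der_prim _ t k1) (derC _ t)))); ring.
apply: (der_eq (derD (derC _ t)
    (derB (der_prim _ t k2) (derC _ t)))); ring.
Qed.

Let step_s u : (step u).1 s = y0 /\ (step u).2 s = v0.
Proof. by rewrite /step /= !subrr !addr0. Qed.

Let z_cont n : continuous (z n).1 /\ continuous (z n).2.
Proof.
elim: n => [|n [c1 c2]]; first by split=> t; exact: cvg_cst.
have [d1 d2] := step_der (z n) c1 c2.
by split=> t; [exact: der_cont (d1 t)|exact: der_cont (d2 t)].
Qed.

Let contraction (u w : (R -> R) * (R -> R)) (c : R) : 0 <= c ->
  continuous u.1 -> continuous u.2 -> continuous w.1 -> continuous w.2 ->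
  (forall t, `|u.1 t - w.1 t| <= c * E t) ->
  (forall t, `|u.2 t - w.2 t| <= c * E t) ->
  (forall t, `|(step u).1 t - (step w).1 t| <= c / 2 * E t) /\
  (forall t, `|(step u).2 t - (step w).2 t| <= c / 2 * E t).
Proof.
move=> c0 u1 u2 w1 w2 h1 h2.
have [du1 du2] := step_der u u1 u2; have [dw1 dw2] := step_der w w1 w2.
have [su1 su2] := step_s u; have [sw1 sw2] := step_s w.
have E0 t : 0 <= E t by exact: expR_ge0.
have LE (x y : R) t : `|x| <= c * E t -> `|y| <= c * E t ->
    `|p1 t * x| <= c * (L t * E t) /\
    `|q1 t * x + q2 t * y| <= c * (L t * E t).
  move=> hx hy; have e0 : 0 <= c * E t by rewrite mulr_ge0.
  have m (a b : R) : `|b| <= c * E t -> `|a * b| <= `|a| * (c * E t).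
    by move=> hb; rewrite normrM ler_wpM2l.
  have := m (p1 t) x hx; have := m (q1 t) x hx; have := m (q2 t) y hy.
  have := ler_normD (q1 t * x) (q2 t * y).
  have n0 := mulr_ge0 (normr_ge0 (p1 t)) e0.
  have n1 := mulr_ge0 (normr_ge0 (q1 t)) e0.
  have n2 := mulr_ge0 (normr_ge0 (q2 t)) e0.
  have n3 := mulr_ge0 (normr_ge0 (q3 t)) e0.
  rewrite /L; split; lra.
split=> t.
- apply: (gain (fun t => (step u).1 t - (step w).1 t) _ c c0 _
    (fun x => derB (du1 x) (dw1 x))).
  + by rewrite su1 sw1 subrr.
  + move=> x; have [+ _] := LE _ 0 x (h2 x) ltac:(by rewrite normr0 mulr_ge0).
    by rewrite mulrBr.
- apply: (gain (fun t => (step u).2 t - (step w).2 t) _ c c0 _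
    (fun x => derB (du2 x) (dw2 x))).
  + by rewrite su2 sw2 subrr.
  + move=> x; have [_ h] := LE _ _ x (h2 x) (h1 x).
    by apply: le_trans h; rewrite le_eqVlt; apply/orP; left; apply/eqP; congr `|_|; ring.
Qed.

(** Global solvability of linear systems: in the weighted norm attached to [E]
    the Picard iteration is a contraction on the whole line, although the
    coefficients need not be bounded. *)
Lemma linear_ode : exists y v : R -> R, [/\ y s = y0, v s = v0,
  forall t : R, is_derive t 1 y (p1 t * v t) &
  forall t : R, is_derive t 1 v (q1 t * v t + q2 t * y t + q3 t)].
Proof.
pose A := `|v0| + `|y0| + 1.
have A0 : 0 <= A by rewrite /A !addr_ge0.
have E1 t : 1 <= E t by rewrite /E -expR0 ler_expR mulr_ge0.
have E0 t : 0 <= E t by exact: expR_ge0.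
have Ec : continuous E.
  move=> t; apply: continuous_comp; last exact: continuous_expR.
  apply: cvgM; first exact: cvg_cst.
  by apply: cvg_norm; exact: der_cont (dLa t).
have pow0 n : 0 <= A / 2 ^+ n by rewrite divr_ge0 // exprn_ge0.
have powS n : A / 2 ^+ n.+1 = A / 2 ^+ n / 2.
  by rewrite exprS invfM [2^-1 * _]mulrC mulrA.
have base : (forall t, `|(z 1).1 t - (z 0).1 t| <= A * E t) /\
            (forall t, `|(z 1).2 t - (z 0).2 t| <= A * E t).
  have [c01 c02] := z_cont 0.
  have [d1 d2] := step_der (z 0%N) c01 c02.
  have [s1 s2] := step_s (z 0%N).
  have half t : A / 2 * E t <= A * E t by apply: ler_wpM2r => //; lra.
  have pr t : L t * 1 <= L t * E t by rewrite ler_wpM2l // /L !addr_ge0.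
  split=> t; apply: le_trans (half t).
  - apply: (gain (fun t => (z 1).1 t - y0) _ A A0 _
      (fun x => derB (d1 x) (derC y0 x))).
      by apply/eqP; rewrite subr_eq0; apply/eqP; exact: s1.
    move=> x /=; rewrite subr0 normrM.
    apply: (@le_trans _ _ (A * (L x * 1))); last exact: ler_wpM2l.
    rewrite mulr1 mulrC; apply: ler_pM => //; rewrite /A /L.
      by have := normr_ge0 y0; lra.
    by have := normr_ge0 (q1 x); have := normr_ge0 (q2 x);
       have := normr_ge0 (q3 x); lra.
  - apply: (gain (fun t => (z 1).2 t - v0) _ A A0 _
      (fun x => derB (d2 x) (derC v0 x))).
      by apply/eqP; rewrite subr_eq0; apply/eqP; exact: s2.
    move=> x /=; rewrite subr0.
    apply: (@le_trans _ _ (A * (L x * 1))); last exact: ler_wpM2l.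
    have k1 := ler_normD (q1 x * v0 + q2 x * y0) (q3 x).
    have k2 := ler_normD (q1 x * v0) (q2 x * y0).
    have a1 : `|q1 x * v0| <= `|q1 x| * A.
      by rewrite normrM ler_wpM2l // /A; have := normr_ge0 y0; lra.
    have a2 : `|q2 x * y0| <= `|q2 x| * A.
      by rewrite normrM ler_wpM2l // /A; have := normr_ge0 v0; lra.
    have a3 : `|q3 x| * 1 <= `|q3 x| * A.
      by rewrite ler_wpM2l // /A; have := normr_ge0 v0; have := normr_ge0 y0; lra.
    have a4 := mulr_ge0 (normr_ge0 (p1 x)) A0.
    by rewrite /L; lra.
have zz n : (forall t, `|(z n.+1).1 t - (z n).1 t| <= A / 2 ^+ n * E t) /\
            (forall t, `|(z n.+1).2 t - (z n).2 t| <= A / 2 ^+ n * E t).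
  elim: n => [|n [h1 h2]]; first by rewrite expr0 divr1.
  have [c1 c2] := z_cont n; have [c3 c4] := z_cont n.+1.
  by rewrite powS; exact: (contraction (z n.+1) (z n)).
have lim (w : nat -> R -> R) : (forall n, continuous (w n)) ->
    (forall n t, `|w n.+1 t - w n t| <= A / 2 ^+ n * E t) ->
    exists2 f, continuous f & forall n t, `|f t - w n t| <= 2 * A / 2 ^+ n * E t.
  move=> wc hw; have /choice[f hf] t :
      exists l, forall n, `|l - w n t| <= 2 * A / 2 ^+ n * E t.
    have [l hl] := halves_limit (w^~ t) (fun n => A / 2 ^+ n * E t)
      (hw^~ t) (fun n => ltac:(by rewrite /= powS; ring)).
    by exists l => n; have := hl n; rewrite !mulrA.
  exists f => [|n t]; last exact: hf.
  by apply: (approx_continuous w f E (2 * A)) => //; exact: mulr_ge0.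
have [y yc hy] := lim (fun n => (z n).1) (fun n => (z_cont n).1) (fun n => (zz n).1).
have [v vc hv] := lim (fun n => (z n).2) (fun n => (z_cont n).2) (fun n => (zz n).2).
have [d1 d2] := step_der (y, v) yc vc.
have fixp n : (forall t, `|(step (y, v)).1 t - (z n.+1).1 t| <= 2 * A / 2 ^+ n / 2 * E t)
   /\ (forall t, `|(step (y, v)).2 t - (z n.+1).2 t| <= 2 * A / 2 ^+ n / 2 * E t).
  have [c1 c2] := z_cont n.
  apply: (contraction (y, v) (z n)) => //=.
  by rewrite divr_ge0 ?exprn_ge0 // mulr_ge0.
have small (x c : R) : 0 <= c -> (forall n, `|x| <= c / 2 ^+ n) -> x = 0.
  move=> c0 h; apply/eqP; rewrite -normr_eq0 eq_le normr_ge0 andbT leNgt.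
  by apply/negP => /(halves_lt c)[n] /(le_lt_trans (h n)); rewrite ltxx.
have same (w : nat -> R -> R) (f g : R -> R) :
    (forall n t, `|f t - w n t| <= 2 * A / 2 ^+ n * E t) ->
    (forall n t, `|g t - w n.+1 t| <= 2 * A / 2 ^+ n / 2 * E t) -> g = f.
  move=> hf hg; apply/funext => t; apply/eqP; rewrite -subr_eq0; apply/eqP.
  apply: (small _ (4 * A * E t)) => [|n]; first by rewrite !mulr_ge0.
  have k1 := hg n t; have k2 := hf n.+1 t.
  have -> : g t - f t = (g t - w n.+1 t) - (f t - w n.+1 t) by ring.
  apply: le_trans (ler_normB _ _) _.
  have e1 : 2 * A / 2 ^+ n.+1 = A / 2 ^+ n by rewrite -mulrA powS; lra.
  have := mulr_ge0 (pow0 n) (E0 t).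
  move: k1 k2; rewrite e1; have -> : 4 * A * E t / 2 ^+ n = 4 * (A / 2 ^+ n * E t) by ring.
  have -> : 2 * A / 2 ^+ n / 2 * E t = A / 2 ^+ n * E t by field.
  lra.
have ye := same _ _ _ hy (fun n => (fixp n).1).
have ve := same _ _ _ hv (fun n => (fixp n).2).
exists y, v; split.
- by rewrite -ye; case: (step_s (y, v)).
- by rewrite -ve; case: (step_s (y, v)).
- by move=> t; rewrite -{1}ye.
- by move=> t; rewrite -{1}ve.
Qed.
End LinearODE.
End Picard.

(** * Calculus in two variables *)

Section TwoVariables.
Context {R : realType}.
Implicit Types (f g X A : R -> R) (x t l e d : R).

Lemma contP f x : {for x, continuous f} <->
  forall e, 0 < e -> exists2 d, 0 < d & forall y, `|y - x| < d -> `|f y - f x| < e.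
Proof.
split=> [/cvgrPdist_lt h e e0|h].
  have /nbhs_ballP[d d0 hd] := h e e0; exists d => // y yx.
  by rewrite distrC; apply: hd; rewrite /ball /= distrC.
apply/cvgrPdist_lt => e e0; have [d d0 hd] := h e e0.
apply: filterS (nbhsx_ballx x d d0) => y; rewrite /ball /= distrC => yx.
by rewrite distrC; exact: hd.
Qed.

Definition cont2 (F : R -> R -> R) x t :=
  {for (x, t), continuous (fun p : R * R => F p.1 p.2)}.

Lemma cont2P (F : R -> R -> R) x t : cont2 F x t <->
  forall e, 0 < e -> exists2 d, 0 < d &
    forall y s, `|y - x| < d -> `|s - t| < d -> `|F y s - F x t| < e.
Proof.
split=> [/cvgrPdist_lt h e e0|h].
  have /nbhs_ballP[d d0 hd] := h e e0; exists d => // y s yx st.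
  by rewrite distrC; apply: (hd (y, s)); split; rewrite /ball /= distrC.
apply/cvgrPdist_lt => e e0; have [d d0 hd] := h e e0.
apply: filterS (nbhsx_ballx (x, t) d d0) => -[y s] []; rewrite /ball /= => yx st.
by rewrite distrC; apply: hd; rewrite distrC.
Qed.

Lemma cont2_curve (F : R -> R -> R) X T s :
  cont2 F (X s) (T s) -> {for s, continuous X} -> {for s, continuous T} ->
  {for s, continuous (fun r => F (X r) (T r))}.
Proof.
move=> /cont2P Fc /contP Xc /contP Tc; apply/contP => e /Fc[d d0 hd].
have [d1 d10 h1] := Xc d d0; have [d2 d20 h2] := Tc d d0.
exists (Num.min d1 d2) => [|r]; first by rewrite lt_min d10.
by rewrite lt_min => /andP[/h1 ? /h2 ?]; apply: hd.
Qed.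

Lemma cont2_comp (F : R -> R -> R) (X T : R -> R -> R) x t :
  cont2 F (X x t) (T x t) -> cont2 X x t -> cont2 T x t ->
  cont2 (fun y s => F (X y s) (T y s)) x t.
Proof.
move=> /cont2P Fc /cont2P Xc /cont2P Tc; apply/cont2P => e /Fc[d d0 hd].
have [d1 d10 h1] := Xc d d0; have [d2 d20 h2] := Tc d d0.
exists (Num.min d1 d2) => [|y s]; first by rewrite lt_min d10.
rewrite !lt_min => /andP[? ?] /andP[? ?]; apply: hd; [exact: h1|exact: h2].
Qed.

Lemma cont2_1 f x t : {for x, continuous f} -> cont2 (fun y _ => f y) x t.
Proof.
move=> /contP h; apply/cont2P => e /h[d d0 hd]; exists d => // y s yx _.
exact: hd.
Qed.

Lemma cont2_2 f x t : {for t, continuous f} -> cont2 (fun _ s => f s) x t.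
Proof.
move=> /contP h; apply/cont2P => e /h[d d0 hd]; exists d => // y s _ st.
exact: hd.
Qed.

Lemma cont2_slice (F : R -> R -> R) t : (forall x, cont2 F x t) ->
  continuous (fun x => F x t).
Proof.
move=> Fc x; apply: (cont2_curve F (fun y => y) (fun=> t)) => //; exact: cvg_cst.
Qed.

Lemma cont2D (F H : R -> R -> R) x t : cont2 F x t -> cont2 H x t ->
  cont2 (fun y s => F y s + H y s) x t.
Proof. exact: cvgD. Qed.

Lemma cont2N (F : R -> R -> R) x t : cont2 F x t -> cont2 (fun y s => - F y s) x t.
Proof. exact: cvgN. Qed.

Lemma cont2M (F H : R -> R -> R) x t : cont2 F x t -> cont2 H x t ->
  cont2 (fun y s => F y s * H y s) x t.
Proof. exact: cvgM. Qed.

Lemma cont2V (F : R -> R -> R) x t : F x t != 0 -> cont2 F x t ->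
  cont2 (fun y s => (F y s)^-1) x t.
Proof. by move=> h; apply: cvgV. Qed.

Lemma cont2_near (F H : R -> R -> R) x t d : 0 < d ->
  (forall y s, `|y - x| < d -> `|s - t| < d -> F y s = H y s) ->
  cont2 F x t -> cont2 H x t.
Proof.
move=> d0 FH /cont2P Fc; apply/cont2P => e /Fc[d1 d10 h].
exists (Num.min d d1) => [|y s]; first by rewrite lt_min d0.
rewrite !lt_min => /andP[? ?] /andP[? ?].
by rewrite -!FH ?subrr ?normr0 //; exact: h.
Qed.

Lemma derP f x l : is_derive x 1 f l <->
  forall e, 0 < e -> exists2 d, 0 < d &
    forall y, `|y - x| < d -> `|f y - f x - l * (y - x)| <= e * `|y - x|.
Proof.
split=> [/is_derive1_caratheodory[g [hg /contP gc gx]] e /gc[d d0 hd]|h].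
  exists d => // y /hd; rewrite hg gx -mulrBl normrM => /ltW.
  exact: ler_wpM2r.
apply/is_derive1_caratheodory.
exists (fun y => if y == x then l else (f y - f x) / (y - x)); split.
- move=> y; case: eqP => [->|/eqP yx]; first by rewrite !subrr mulr0.
  by rewrite divfK // subr_eq0.
- apply/contP => e e0; have [d d0 hd] := h (e / 2) ltac:(lra).
  exists d => // y /hd; rewrite eqxx; case: (eqVneq y x) => [_ _|yx].
    by rewrite subrr normr0.
  have yx0 : 0 < `|y - x| by rewrite normr_gt0 subr_eq0.
  have yx1 : y - x != 0 by rewrite subr_eq0.
  move=> k; rewrite -(ltr_pM2r yx0) -normrM mulrBl divfK //.
  by apply: (le_lt_trans k); rewrite ltr_pM2r //; lra.
- by rewrite eqxx.
Qed.

(** The segment from [a] to [b] is described by distances to [a], so that the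
    order of [a] and [b] does not matter. *)
Lemma mean_value_lin f (df : R -> R) (a b c e : R) : 0 <= e ->
  (forall x, `|x - a| <= `|b - a| -> is_derive x 1 f (df x)) ->
  (forall x, `|x - a| <= `|b - a| -> `|df x - c| <= e) ->
  `|f b - f a - c * (b - a)| <= e * `|b - a|.
Proof.
move=> e0 fd fe.
have [ab|/ltW ba] := leP a b.
- have seg x : a <= x <= b -> `|x - a| <= `|b - a|.
    by move=> /andP[? ?]; rewrite !ger0_norm; lra.
  have u : f b - f a <= (c + e) * b - (c + e) * a.
    apply: (der_le_closed ab (fun x h => fd x (seg x h)) (fun x _ => derZI _ x)).
    by move=> x /seg/fe/ler_normlP[]; lra.
  have v : (c - e) * b - (c - e) * a <= f b - f a.
    apply: (der_le_closed ab (fun x _ => derZI _ x) (fun x h => fd x (seg x h))).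
    by move=> x /seg/fe/ler_normlP[]; lra.
  rewrite (ger0_norm (x := b - a)) ?subr_ge0 //; apply/ler_normlP; split; lra.
- have seg x : b <= x <= a -> `|x - a| <= `|b - a|.
    by move=> /andP[? ?]; rewrite !ler0_norm; lra.
  have u : f a - f b <= (c + e) * a - (c + e) * b.
    apply: (der_le_closed ba (fun x h => fd x (seg x h)) (fun x _ => derZI _ x)).
    by move=> x /seg/fe/ler_normlP[]; lra.
  have v : (c - e) * a - (c - e) * b <= f a - f b.
    apply: (der_le_closed ba (fun x _ => derZI _ x) (fun x h => fd x (seg x h))).
    by move=> x /seg/fe/ler_normlP[]; lra.
  rewrite (ler0_norm (x := b - a)) ?subr_le0 //; apply/ler_normlP; split; lra.
Qed.

Lemma partial_increment (F Fx : R -> R -> R) x t d : 0 < d ->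
  (forall y s, `|y - x| < d -> `|s - t| < d ->
     is_derive y 1 (fun z => F z s) (Fx y s)) ->
  cont2 Fx x t ->
  forall e, 0 < e -> exists2 d', 0 < d' & forall y s, `|y - x| < d' ->
    `|s - t| < d' -> `|F y s - F x s - Fx x t * (y - x)| <= e * `|y - x|.
Proof.
move=> d0 Fd /cont2P Fc e e0; have [d1 d10 h] := Fc e e0.
exists (Num.min d d1) => [|y s]; first by rewrite lt_min d0.
rewrite !lt_min => /andP[y1 y2] /andP[s1 s2].
apply: (mean_value_lin (fun z => F z s) (fun z => Fx z s)) => [|z zy|z zy].
- exact: ltW.
- by apply: Fd => //; exact: le_lt_trans y1.
- by apply/ltW/h => //; exact: le_lt_trans y2.
Qed.

(** Splitting the increment into a horizontal and a vertical part, the first one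
    is controlled by the mean value theorem and continuity of [Fx], while the
    second one is taken on the fixed line [X t], where the partial derivative in
    the second variable enters at the base point only. *)
Lemma der_along (F Fx : R -> R -> R) X t lx lt d : 0 < d ->
  (forall y s, `|y - X t| < d -> `|s - t| < d ->
     is_derive y 1 (fun z => F z s) (Fx y s)) ->
  cont2 Fx (X t) t ->
  is_derive t 1 X lx -> is_derive t 1 (F (X t)) lt ->
  is_derive t 1 (fun s => F (X s) s) (Fx (X t) t * lx + lt).
Proof.
move=> d0 Fd Fc Xd Ftd; apply/derP => e e0.
set p := Fx (X t) t.
have lx0 : 0 < 3 * (`|lx| + 1) by have := normr_ge0 lx; lra.
have p0 : 0 < 3 * (`|p| + 1) by have := normr_ge0 p; lra.
have [d1 d10 h1] := partial_increment _ _ _ _ _ d0 Fd Fc (e / (3 * (`|lx| + 1)))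
   ltac:(by rewrite divr_gt0).
have e20 : 0 < Num.min 1 (e / (3 * (`|p| + 1))) by rewrite lt_min ltr01 divr_gt0.
have [d2 d20 h2] := (derP _ _ _).1 Xd _ e20.
have [d3 d30 h3] := (derP _ _ _).1 Ftd (e / 3) ltac:(lra).
have [d4 d40 h4] := (contP _ _).1 (der_cont Xd) d1 d10.
exists (Num.min (Num.min d1 d2) (Num.min d3 d4)) => [|s].
  by rewrite !lt_min d10 d20 d30.
rewrite !lt_min => /andP[/andP[s1 s2] /andP[s3 s4]].
have := h1 _ _ (h4 _ s4) s1; have := h2 _ s2; have := h3 _ s3.
set D1 := _ - _ - lt * _; set D2 := _ - _ - lx * _; set D3 := _ - _ - _ * _.
have -> : F (X s) s - F (X t) t - (p * lx + lt) * (s - t) = D3 + p * D2 + D1.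
  by rewrite /D1 /D2 /D3 -/p; ring.
set n := `|s - t|.
move=> b1 b2 b3; have n0 : 0 <= n by exact: normr_ge0.
have m1 : Num.min 1 (e / (3 * (`|p| + 1))) <= 1 by rewrite ge_min lexx.
have m2 : Num.min 1 (e / (3 * (`|p| + 1))) <= e / (3 * (`|p| + 1)).
  by rewrite ge_min lexx orbT.
have bX : `|X s - X t| <= (`|lx| + 1) * n.
  have -> : X s - X t = D2 + lx * (s - t) by rewrite /D2; ring.
  apply: le_trans (ler_normD _ _) _; rewrite normrM -/n.
  have := ler_wpM2r n0 m1; lra.
have c3 : `|D3| <= e / 3 * n.
  apply: le_trans b3 _; have := ler_wpM2l (ltW (divr_gt0 e0 lx0)) bX.
  have -> // : e / (3 * (`|lx| + 1)) * ((`|lx| + 1) * n) = e / 3 * n.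
  by field; have := normr_ge0 lx; lra.
have c2 : `|p * D2| <= e / 3 * n.
  rewrite normrM; have q0 : 0 <= e / (3 * (`|p| + 1)) * n by rewrite mulr_ge0 // ltW // divr_gt0.
  have k : `|D2| <= e / (3 * (`|p| + 1)) * n by apply: le_trans b2 _; exact: ler_wpM2r.
  apply: (@le_trans _ _ ((`|p| + 1) * (e / (3 * (`|p| + 1)) * n))).
    by apply: ler_pM => //; lra.
  have -> // : (`|p| + 1) * (e / (3 * (`|p| + 1)) * n) = e / 3 * n.
  by field; have := normr_ge0 p; lra.
have := ler_normD (D3 + p * D2) D1; have := ler_normD D3 (p * D2); lra.
Qed.

(** The increments of [A] and of time are related by [partial_increment]; as [A] is
    continuous, the error is absorbed by [Fx (A t) t != 0]. *)
Lemma der_implicit (F Fx : R -> R -> R) A t lt d (k : R) : 0 < d ->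
  (forall y s, `|y - A t| < d -> `|s - t| < d ->
     is_derive y 1 (fun z => F z s) (Fx y s)) ->
  cont2 Fx (A t) t -> Fx (A t) t != 0 ->
  (forall s, `|s - t| < d -> F (A s) s = k) ->
  {for t, continuous A} -> is_derive t 1 (F (A t)) lt ->
  is_derive t 1 A (- lt / Fx (A t) t).
Proof.
move=> d0 Fd Fc p0 Fk /contP Ac Ftd; apply/derP => e e0.
set p := Fx (A t) t in p0 *.
have np : 0 < `|p| by rewrite normr_gt0.
pose C := 2 * (`|lt| + 1) / `|p|.
have C0 : 0 <= C by rewrite /C divr_ge0 // mulr_ge0 // addr_ge0.
pose e1 := Num.min (`|p| / 2) (e * `|p| / (2 * (C + 1))).
have e10 : 0 < e1.
  by rewrite /e1 lt_min; apply/andP; split; [lra|rewrite !(divr_gt0, mulr_gt0) //; lra].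
pose e3 := Num.min 1 (e * `|p| / 2).
have ep : 0 < e * `|p| by rewrite mulr_gt0.
have e30 : 0 < e3 by rewrite /e3 lt_min ltr01 /=; lra.
have [d1 d10 h1] := partial_increment _ _ _ _ _ d0 Fd Fc e1 e10.
have [d3 d30 h3] := (derP _ _ _).1 Ftd e3 e30.
have [d4 d40 h4] := Ac d1 d10.
exists (Num.min (Num.min d d1) (Num.min d3 d4)) => [|s].
  by rewrite !lt_min d0 d10 d30.
rewrite !lt_min => /andP[/andP[s0 s1] /andP[s3 s4]].
have b1 := h1 _ _ (h4 _ s4) s1; have b3 := h3 _ s3.
move: b1 b3; rewrite (Fk s s0) -(Fk t); last by rewrite subrr normr0.
rewrite -/p; set q := A s - A t; set n := s - t.
set u := F (A t) s - F (A t) t.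
have -> : F (A t) t - F (A t) s = - u by rewrite /u; ring.
move=> b1 b3.
have n0 := normr_ge0 n; have q0 := normr_ge0 q.
have m1 : e1 <= `|p| / 2 by rewrite /e1 ge_min lexx.
have m2 : e1 <= e * `|p| / (2 * (C + 1)) by rewrite /e1 ge_min lexx orbT.
have m3 : e3 <= 1 by rewrite /e3 ge_min lexx.
have m4 : e3 <= e * `|p| / 2 by rewrite /e3 ge_min lexx orbT.
have r1 : `|u + p * q| <= e1 * `|q|.
  by have -> : u + p * q = - (- u - p * q); [ring|rewrite normrN].
have main : `|p * q + lt * n| <= e1 * `|q| + e3 * `|n|.
  have -> : p * q + lt * n = (u + p * q) - (u - lt * n) by ring.
  by apply: le_trans (ler_normB _ _) _; lra.
have bq : `|q| <= C * `|n|.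
  have h : `|p| * `|q| <= `|p * q + lt * n| + `|lt| * `|n|.
    by rewrite -!normrM; have := ler_normB (p * q + lt * n) (lt * n); rewrite addrK.
  have k1 := ler_wpM2r q0 m1; have k2 := ler_wpM2r n0 m3.
  rewrite -(ler_pM2l np).
  have -> : `|p| * (C * `|n|) = 2 * (`|lt| + 1) * `|n|.
    by rewrite /C; field; rewrite normr_eq0.
  lra.
rewrite -(ler_pM2l np) -normrM.
have -> : p * (q - - lt / p * n) = p * q + lt * n by field.
apply: le_trans main _.
have k1 := ler_pM (ltW e10) q0 m2 bq.
have k2 := ler_wpM2r n0 m4.
have k3 : e * `|p| / (2 * (C + 1)) * (C * `|n|) <= e * `|p| / 2 * `|n|.
  have -> : e * `|p| / (2 * (C + 1)) * (C * `|n|) = (e * `|p| / 2 * `|n|) * (C / (C + 1)).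
    by field; lra.
  rewrite -[leRHS]mulr1; apply: ler_wpM2l; first by rewrite mulr_ge0 //; lra.
  by rewrite ler_pdivrMr; lra.
by rewrite mulrCA mulrA; lra.
Qed.

Lemma cont2_uniform (F : R -> R -> R) (a b t : R) :
  (forall y, a <= y <= b -> cont2 F y t) ->
  forall e, 0 < e -> exists2 d, 0 < d & forall s, `|s - t| < d ->
    forall y, a <= y <= b -> `|F y s - F y t| < e.
Proof.
move=> Fc e e0.
have := (compact_near_coveringP _).1 (@segment_compact R a b).
move=> /(_ _ (nbhs t) (fun s y => `|F y s - F y t| < e) _) H.
have {H} : \forall s \near t, `[a, b] `<=` (fun y => `|F y s - F y t| < e).
  apply: H => y /=; rewrite in_itv /= => /Fc/cont2P/(_ (e / 2) ltac:(lra))[d d0 hd].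
  exists (ball y d, ball t d); first by split; exact: nbhsx_ballx.
  move=> [z s] []; rewrite /ball /= => yz ts.
  have zs := hd z s; have zt := hd z t.
  rewrite distrC in yz; rewrite distrC in ts.
  have := zs yz ts; have := zt yz; rewrite subrr normr0 => /(_ d0).
  have -> : F z s - F z t = (F z s - F y t) - (F z t - F y t) by ring.
  by have := ler_normB (F z s - F y t) (F z t - F y t); lra.
move=> /nbhs_ballP[d d0 hd]; exists d => // s st y yab.
by apply: (hd s); rewrite /ball /= 1?distrC ?in_itv.
Qed.

Lemma cont2_bounded (F : R -> R -> R) (a b p q : R) :
  (forall y s, a <= y <= b -> p <= s <= q -> cont2 F y s) ->
  exists2 K, 0 <= K & forall y s, a <= y <= b -> p <= s <= q -> `|F y s| <= K.
Proof.
move=> Fc.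
have cK : compact (`[a, b]%classic `*` `[p, q]%classic : set (R * R)).
  by apply: compact_setX; exact: segment_compact.
have ct : {within `[a, b]%classic `*` `[p, q]%classic,
     continuous (fun z : R * R => F z.1 z.2)}.
  apply: continuous_in_subspaceT => -[y s] /set_mem[] /=; rewrite !in_itv /=.
  exact: Fc.
have /compact_bounded := continuous_compact ct cK.
move=> [M [_ /(_ (`|M| + 1))]] hM; exists (`|M| + 1) => [|y s hy hs].
  by have := normr_ge0 M; lra.
apply: hM; first by have := ler_norm M; lra.
by exists (y, s) => //; split => /=; rewrite in_itv.
Qed.
End TwoVariables.

Section PrimitiveWithParameter.
Context {R : realType}.
Implicit Types (f : R -> R) (x t e : R).

(** Over the compact segment from [0] to [x], the difference quotients converge
    uniformly, by the mean value theorem and [cont2_uniform]. *)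
Lemma der_prim_param (F Ft : R -> R -> R) x t d : 0 < d ->
  (forall s, `|s - t| < d -> continuous (fun y => F y s)) ->
  (forall y s, `|s - t| < d -> is_derive s 1 (F y) (Ft y s)) ->
  (forall y, cont2 Ft y t) ->
  is_derive t 1 (fun s => prim (fun y => F y s) x) (prim (fun y => Ft y t) x).
Proof.
move=> d0 Fc Fd Ftc; apply/derP => e e0.
have Ft1 : continuous (fun y => Ft y t).
  exact: cont2_slice.
have x0 : 0 < `|x| + 1 by have := normr_ge0 x; lra.
have [d1 d10 h1] := cont2_uniform Ft (- `|x|) `|x| t (fun y _ => Ftc y)
  (e / (`|x| + 1)) ltac:(by rewrite divr_gt0).
exists (Num.min d d1) => [|s]; first by rewrite lt_min d0.
rewrite lt_min => /andP[s0 s1].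
have Fs := Fc s s0; have Ftt := Fc t ltac:(by rewrite subrr normr0).
pose g y := prim (fun y => F y s) y - prim (fun y => F y t) y
  - (s - t) * prim (fun y => Ft y t) y.
have gd (y : R) : is_derive y 1 g (F y s - F y t - (s - t) * Ft y t).
  apply: derB; last by apply: derZ; exact: (der_prim (fun y => Ft y t)).
  by apply: derB; [exact: (der_prim (fun y => F y s))|exact: (der_prim (fun y => F y t))].
have c0 : 0 <= e / (`|x| + 1) * `|s - t| by rewrite mulr_ge0 // ltW // divr_gt0.
have := mean_value_lin g _ 0 x 0 _ c0 (fun y _ => gd y).
have -> : g 0 = 0 by rewrite /g !prim0 // mulr0 !subr0.
rewrite mul0r !subr0 => H.
have {}H : `|g x| <= e / (`|x| + 1) * `|s - t| * `|x|.
  apply: H => y; rewrite !subr0 => yx.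
  have := mean_value_lin (F y) (Ft y) t s (Ft y t) (e / (`|x| + 1)).
  rewrite [(s - t) * _]mulrC; apply.
  - by rewrite ltW // divr_gt0.
  - by move=> r rt; apply: Fd; exact: le_lt_trans s0.
  - move=> r rt; apply/ltW/h1; first exact: le_lt_trans s1.
    by rewrite -ler_norml.
rewrite [_ * (s - t)]mulrC; apply: le_trans H _.
have -> : e / (`|x| + 1) * `|s - t| * `|x| = (e * `|s - t|) * (`|x| / (`|x| + 1)).
  by field; lra.
rewrite -[leRHS]mulr1; apply: ler_wpM2l; first by rewrite mulr_ge0 // ltW.
by rewrite ler_pdivrMr; lra.
Qed.

Lemma cont2_prim (F : R -> R -> R) x t : (forall y s, cont2 F y s) ->
  cont2 (fun y s => prim (fun z => F z s) y) x t.
Proof.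
move=> Fc; apply/cont2P => e e0.
have F1 s : continuous (fun y => F y s).
  exact: cont2_slice.
have x0 : 0 < `|x| + 1 by have := normr_ge0 x; lra.
have [d1 d10 h1] := cont2_uniform F (- `|x|) `|x| t (fun y _ => Fc y t)
  (e / 2 / (`|x| + 1)) ltac:(by rewrite !divr_gt0).
have [d2 d20 h2] := (cont2P _ _ _).1 (Fc x t) 1 ltr01.
pose K := `|F x t| + 1.
have K0 : 0 < 2 * K by rewrite /K; have := normr_ge0 (F x t); lra.
exists (Num.min (Num.min d1 d2) (e / (2 * K))) => [|y s].
  by rewrite !lt_min d10 d20 divr_gt0.
rewrite !lt_min => /andP[/andP[y1 y2] y3] /andP[/andP[s1 s2] s3].
have A1 : `|prim (fun z => F z s) y - prim (fun z => F z s) x| <= K * `|y - x|.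
  have := mean_value_lin (prim (fun z => F z s)) (fun z => F z s) x y 0 K.
  rewrite mul0r subr0; apply.
  - by lra.
  - by move=> z _; exact: (der_prim (fun z => F z s)).
  - move=> z zy; rewrite subr0 /K.
    have := h2 z s (le_lt_trans zy y2) s2.
    have := ler_normD (F z s - F x t) (F x t); rewrite subrK; lra.
have A2 : `|prim (fun z => F z s) x - prim (fun z => F z t) x|
    <= e / 2 / (`|x| + 1) * `|x|.
  have := mean_value_lin (fun z => prim (fun z => F z s) z - prim (fun z => F z t) z)
    (fun z => F z s - F z t) 0 x 0 (e / 2 / (`|x| + 1)).
  rewrite !prim0 // mul0r !subr0; apply.
  - by rewrite ltW // !divr_gt0.
  - by move=> z _; apply: derB; [exact: (der_prim (fun z => F z s))|
      exact: (der_prim (fun z => F z t))].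
  - by move=> z; rewrite !subr0 => zx; apply/ltW/h1; rewrite -?ler_norml.
have B1 : K * `|y - x| < e / 2.
  by rewrite -ltr_pdivlMl; [apply: lt_le_trans y3 _; rewrite le_eqVlt; apply/orP;
     left; apply/eqP; field; lra|lra].
have B2 : e / 2 / (`|x| + 1) * `|x| <= e / 2.
  have -> : e / 2 / (`|x| + 1) * `|x| = e / 2 * (`|x| / (`|x| + 1)) by field; lra.
  by rewrite -[leRHS]mulr1; apply: ler_wpM2l; [lra|rewrite ler_pdivrMr; lra].
have -> : prim (fun z => F z s) y - prim (fun z => F z t) x =
  (prim (fun z => F z s) y - prim (fun z => F z s) x) +
  (prim (fun z => F z s) x - prim (fun z => F z t) x) by ring.
by apply: (le_lt_trans (ler_normD _ _)); lra.
Qed.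
End PrimitiveWithParameter.

(** * Integrals over the line *)

Section Integrals.
Context {R : realType}.
Local Notation mu := (@lebesgue_measure R).
Implicit Types (f g G : R -> R) (x v w : R) (D : set R).

(** Integrability and the value together: results on integrals over the line are
    then closed under linear combinations without side conditions. *)
Definition has_int f v :=
  mu.-integrable setT (EFin \o f) /\ (\int[mu]_x f x)%R = v.

Lemma has_intE f : mu.-integrable setT (EFin \o f) -> has_int f (\int[mu]_x f x)%R.
Proof. by []. Qed.

Lemma has_int_ext f g v : f =1 g -> has_int f v -> has_int g v.
Proof. by move=> /funext ->. Qed.

Lemma has_intD f g v w : has_int f v -> has_int g w ->
  has_int (fun x => f x + g x) (v + w).
Proof.
move=> [fi <-] [gi <-]; split; last by rewrite RintegralD.
have := integrableD measurableT fi gi.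
by apply: eq_integrable => // x _ /=; rewrite EFinD.
Qed.

Lemma has_intZ (k : R) f v : has_int f v -> has_int (fun x => k * f x) (k * v).
Proof.
move=> [fi <-]; split; last by rewrite RintegralZl.
have := integrableZl measurableT k fi.
by apply: eq_integrable => // x _ /=; rewrite EFinM.
Qed.

Lemma has_intN f v : has_int f v -> has_int (fun x => - f x) (- v).
Proof.
move=> h; rewrite -mulN1r; apply: has_int_ext (has_intZ (-1) _ _ h) => x.
by rewrite mulN1r.
Qed.

Lemma has_intB f g v w : has_int f v -> has_int g w ->
  has_int (fun x => f x - g x) (v - w).
Proof. by move=> hf /has_intN; exact: has_intD. Qed.

Lemma intS f v (D : set (measurableTypeR R)) : measurable D -> has_int f v ->
  mu.-integrable D (EFin \o f).
Proof. move=> mD [fi _]; have H := integrableS measurableT mD (@subsetT _ D) fi; exact: H.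
Qed.

Lemma has_int_restrict f v (D : set (measurableTypeR R)) : measurable D -> has_int f v ->
  has_int (f \_ D) (\int[mu]_(x in D) f x)%R.
Proof.
move=> mD hf; split; last by rewrite [RHS]Rintegral_mkcond.
rewrite -restrict_EFin; apply: (iffLR (integrable_mkcond _ mD)).
exact: (intS f v D mD hf).
Qed.

Lemma restrictE f D x : (f \_ D) x = if x \in D then f x else 0.
Proof. by rewrite patchE. Qed.

Lemma has_int_le f g v : measurable_fun setT f -> has_int g v ->
  (forall x, `|f x| <= g x) -> exists w, has_int f w.
Proof.
move=> mf [gi _] fg; exists (\int[mu]_x f x)%R; split => //.
apply: (le_integrable measurableT _ _ gi); first exact/measurable_EFinP.
move=> x _ /=; rewrite lee_fin; apply: le_trans (fg x) _; exact: ler_norm.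
Qed.

Lemma has_int_norm f v : has_int f v -> exists w, has_int (fun x => `|f x|) w.
Proof.
move=> [fi _]; exists (\int[mu]_x `|f x|)%R; split => //.
by have := integrable_norm fi.
Qed.

(** The fundamental theorem on segments shows that the integral over a half-line and
    the primitive differ by a constant; dominated convergence gives the limits of
    the former. *)
Lemma improper_integral {f G v} : continuous f -> has_int f v ->
  (forall x, is_derive x 1 G (f x)) ->
  exists l, [/\ G x @[x --> -oo] --> l, G x @[x --> +oo] --> l + v &
    forall x, (\int[mu]_(y in `]-oo, x]) f y)%R = G x - l].
Proof.
move=> fc hf Gd; have [fi fv] := hf.
pose I x := (\int[mu]_(y in `]-oo, x]) f y)%R.
have IG x y : x < y -> I y - I x = G y - G x.
  move=> xy; rewrite /I.
  rewrite (@Rintegral_itvB _ f -oo%O (BRight y) x); last 3 first.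
  - by apply: (intS f v).
  - by rewrite bnd_simp.
  - by rewrite bnd_simp ltW.
  rewrite Rintegral_itv_obnd_cbnd; last by apply: (intS f v).
  rewrite /Rintegral (@continuous_FTC2 _ f G) //=.
  - exact: continuous_subspaceT.
  - split=> [z _||].
    + exact: der_derivable (Gd z).
    + by apply: cvg_at_right_filter; exact: der_cont (Gd x).
    + by apply: cvg_at_left_filter; exact: der_cont (Gd y).
  - by move=> z _; exact: der_derive1 (Gd z).
have IE x : I x = G x - (G 0 - I 0).
  by case: (ltgtP x 0) => [/IG|/IG|->]; lra.
have mf : measurable_fun setT f by exact: continuous_measurable_fun.
have dom (u : R ^nat) g : measurable_fun setT g ->
    (forall x, (f \_ `]-oo, u n]) x @[n --> \oo] --> g x) ->
    I (u n) @[n --> \oo] --> (\int[mu]_x g x)%R.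
  move=> mg cvgx.
  have mr n : measurable_fun setT (EFin \o (f \_ `]-oo, u n])).
    by have [/measurable_int] := has_int_restrict f v `]-oo, u n] ltac:(by []) hf.
  have mge : measurable_fun setT (EFin \o g) by exact/measurable_EFinP.
  have cvge : {ae mu, forall x, setT x ->
      (EFin \o (f \_ `]-oo, u n])) x @[n --> \oo] --> (EFin \o g) x}.
    apply/aeW => x _ /=; apply/fine_cvgP; split; [exact: nearW|exact: cvgx].
  have ni : mu.-integrable setT (EFin \o (fun x => `|f x|)) by exact: integrable_norm.
  have le : {ae mu, forall x n, setT x ->
      (`|(EFin \o (f \_ `]-oo, u n])) x| <= (EFin \o (fun x => `|f x|)%R) x)%E}.
    apply/aeW => x n _ /=; rewrite lee_fin restrictE.
    by case: ifP => // _; rewrite normr0.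
  have [a b c] := @dominated_convergence _ _ R mu setT measurableT
    (fun n => EFin \o (f \_ `]-oo, u n])) (EFin \o g) (EFin \o (fun x => `|f x|))
    mr mge cvge ni le.
  rewrite /I; have -> : (fun n => (\int[mu]_(y in `]-oo, u n]) f y)%R) =
    fine \o (fun n => (\int[mu]_x ((f \_ `]-oo, u n]) x)%:E)%E).
    by apply/funext => n /=; rewrite Rintegral_mkcond.
  apply: fine_cvg; rewrite fineK; first exact: c.
  exact: integrable_fin_num.
have GE : (fun x => I x + (G 0 - I 0)) = G by apply/funext => x; rewrite IE; ring.
exists (G 0 - I 0); split.
- have : I x + (G 0 - I 0) @[x --> -oo] --> 0 + (G 0 - I 0).
    apply: cvgD; last exact: cvg_cst.
    apply/cvg_ninftyP => u uy.
    have -> : 0 = (\int[mu]_x (cst 0 x))%R by rewrite /Rintegral integral0.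
    apply: dom => // x; apply: cvg_near_cst.
    move/cvgrNyPlt: uy => /(_ x); apply: filterS => n unx.
    by rewrite restrictE; case: ifPn => //; rewrite inE /= in_itv /= leNgt unx.
  by rewrite GE add0r.
- have : I x + (G 0 - I 0) @[x --> +oo] --> v + (G 0 - I 0).
    apply: cvgD; last exact: cvg_cst.
    apply/cvg_pinftyP => u uy; rewrite -fv.
    apply: dom => // x; apply: cvg_near_cst.
    move/cvgryPge: uy => /(_ x); apply: filterS => n unx.
    by rewrite restrictE mem_set //= in_itv.
  by rewrite GE addrC.
- by move=> x; rewrite -/(I x) IE; ring.
Qed.

Lemma has_int_nonneg f : measurable_fun setT f -> (forall x, 0 <= f x) ->
  (\int[mu]_x (f x)%:E < +oo)%E -> has_int f (\int[mu]_x f x)%R.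
Proof.
move=> mf f0 fi; split => //; apply/integrableP; split; first exact/measurable_EFinP.
by under eq_integral do rewrite /= ger0_norm //.
Qed.

Lemma power_small (C d e : R) : 0 < d -> 0 < e -> exists2 K, 0 <= K &
  forall x, K < `|x| -> C * (1 + `|x|) `^ (- d) < e.
Proof.
move=> d0 e0; have C0 : 0 < `|C| + 1 by have := normr_ge0 C; lra.
pose k := (e / (`|C| + 1)) ^-1; have k0 : 0 < k by rewrite invr_gt0 divr_gt0.
exists (k `^ d^-1); first exact: powR_ge0.
move=> x kx; have x0 : 0 < 1 + `|x| by have := normr_ge0 x; lra.
have : (1 + `|x|) `^ (- d) < e / (`|C| + 1).
  rewrite powRN -[ltRHS]invrK ltf_pV2 ?posrE ?powR_gt0 ?invr_gt0 ?divr_gt0 //.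
  rewrite -/k; have -> : k = (k `^ d^-1) `^ d.
    by rewrite -powRrM mulVf ?gt_eqF // powRr1 // ltW.
  by apply: gt0_ltr_powR => //; rewrite ?nnegrE ?powR_ge0 ?(ltW x0) //; lra.
rewrite ltr_pdivlMr // => h; apply: le_lt_trans h.
rewrite mulrC; apply: ler_wpM2l; first exact: powR_ge0.
by have := ler_norm C; lra.
Qed.

(** A primitive on the right half-line is explicit and has a limit by
    [power_small]; the function is even. *)
Lemma has_int_power (d : R) : 0 < d ->
  exists v, has_int (fun x => (1 + `|x|) `^ (- (1 + d))) v.
Proof.
move=> d0; pose f x : R := (1 + `|x|) `^ (- (1 + d)); rewrite -/f.
have fc : continuous f.
  move=> x.
  have h1 : {for x, continuous (fun y : R => 1 + `|y|)}.
    by apply: cvgD; [exact: cvg_cst|apply: cvg_norm; exact: cvg_id].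
  have h2 : {for 1 + `|x|, continuous (fun y : R => y `^ (- (1 + d)))}.
    apply: der_cont; apply: is_derive1_powR.
    by have := normr_ge0 x; lra.
  exact: (continuous_comp h1 h2).
have f0 x : 0 <= f x by exact: powR_ge0.
eexists; apply: has_int_nonneg => //; first exact: continuous_measurable_fun.
rewrite ge0_symfun_integralT //; last by move=> x; rewrite /f /= normrN.
rewrite -set_itvcy.
pose F x := - d^-1 * (1 + x) `^ (- d).
have Fd x : - 1 < x -> is_derive x 1 F ((1 + x) `^ (- (1 + d))).
  move=> x0; have h := der_comp (fun y : R => 1 + y) (fun y : R => y `^ (- d))
    (derD (derC 1 x) (derI x)) (@is_derive1_powR R (- d) (1 + x) ltac:(lra)).
  apply: (der_eq (derZ (- d^-1) h)).
  have -> : - d - 1 = - (1 + d) by ring.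
  by field; lra.
have F0 : F x @[x --> +oo] --> 0.
  apply/cvgrPdist_lt => e /(power_small d^-1 d e d0)[K K0 hK].
  exists K; split => [|x /= Kx]; first exact: num_real.
  have x0 : 0 <= x by exact/ltW/(le_lt_trans K0).
  rewrite sub0r /F mulNr opprK ger0_norm ?mulr_ge0 ?invr_ge0 ?powR_ge0 ?(ltW d0) //.
  by have := hK x; rewrite ger0_norm //; apply.
rewrite (@ge0_continuous_FTC2y _ f F 0 0) //.
- by rewrite -EFinB -EFinM ltry.
- exact: continuous_subspaceT.
- by move=> x x0; apply: der_derivable; apply: Fd; lra.
- by apply: cvg_at_right_filter; apply: der_cont; apply: Fd; lra.
- move=> x; rewrite in_itv /= andbT => x0.
  by rewrite (der_derive1 (Fd x _)) ?/f ?ger0_norm //; lra.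
Qed.

Lemma has_int_decay f (d C : R) : 0 < d -> continuous f ->
  (forall x, `|f x| <= C * (1 + `|x|) `^ (- (1 + d))) ->
  exists v, has_int f v.
Proof.
move=> d0 fc fC; have [v hv] := has_int_power d d0.
by apply: (has_int_le _ _ _ _ (has_intZ C _ _ hv) fC); exact: continuous_measurable_fun.
Qed.

(** Off the point [y = x] the kernel is [1 - 2 * (y <= x) + (x - y)]: its singular
    part counts the mass on one side of [x]. *)
Lemma has_int_dW f x v w : has_int f v -> has_int (fun y => y * f y) w ->
  has_int (fun y => dW (x - y) * f y)
    (v - 2 * (\int[mu]_(y in `]-oo, x]) f y)%R + x * v - w).
Proof.
move=> hf hyf.
have h1 := has_int_restrict f v `]-oo, x]%classic ltac:(by []) hf.
have h2 := has_int_restrict f v [set x] (measurable_set1 x) hf.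
rewrite Rintegral_set1 in h2.
have := has_intB _ _ _ _ (has_intD _ _ _ _ (has_intD _ _ _ _
  (has_intB _ _ _ _ hf (has_intZ 2 _ _ h1)) h2) (has_intZ x _ _ hf)) hyf.
rewrite addr0; apply: has_int_ext => y.
have e1 : (f \_ `]-oo, x]) y = if y <= x then f y else 0.
  by rewrite restrictE; congr (if _ then _ else _); apply/idP/idP; rewrite inE /= in_itv.
have e2 : (f \_ [set x]) y = if y == x then f y else 0.
  rewrite restrictE; congr (if _ then _ else _).
  by apply/idP/idP; rewrite inE => /eqP.
rewrite e1 e2 /dW; case: (ltgtP y x) => [yx|xy|->].
- by rewrite gtr0_sg ?subr_gt0 //; ring.
- by rewrite ltr0_sg ?subr_lt0 //; ring.
- by rewrite subrr sgr0; ring.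
Qed.

(** If [x] and [x - 1] lie on the same side of [y], the integrands there differ by
    [f y]; two such pairs of points serve the whole line. The first moment is then
    read off at [x = 0]. *)
Lemma dW_integrable f : continuous f ->
  (forall x, mu.-integrable setT (EFin \o (fun y => dW (x - y) * f y))) ->
  exists v w, has_int f v /\ has_int (fun y => y * f y) w.
Proof.
move=> fc Ki; pose K x y := dW (x - y) * f y.
have mf : measurable_fun setT f by exact: continuous_measurable_fun.
have hK x := has_intE (K x) (Ki x).
have [w1 h1] := has_int_norm _ _ (has_intB _ _ _ _ (hK 1) (hK 0)).
have [w2 h2] := has_int_norm _ _ (has_intB _ _ _ _ (hK (-1)) (hK (-2))).
have [v hv] : exists v, has_int f v.
  apply: (has_int_le _ _ _ mf (has_intD _ _ _ _ h1 h2)) => y.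
  have [y0|y0] := leP y (- (1 / 2)).
  - have -> : K 1 y - K 0 y = f y.
      by rewrite /K /dW !gtr0_sg; [ring|lra|lra].
    by rewrite lerDl.
  - have -> : K (-1) y - K (-2) y = f y.
      by rewrite /K /dW !ltr0_sg; [ring|lra|lra].
    by rewrite lerDr.
have [w3 h3] := has_int_norm _ _ (hK 0); have [w4 h4] := has_int_norm _ _ hv.
have [w hw] : exists w, has_int (fun y => y * f y) w.
  apply: (has_int_le _ _ _ _ (has_intD _ _ _ _ h3 h4)) => [|y].
    by apply: continuous_measurable_fun => y; apply: cvgM; [exact: cvg_id|exact: fc].
  have -> : y * f y = - K 0 y + Num.sg y * f y.
    by rewrite /K /dW sub0r sgrN; ring.
  apply: le_trans (ler_normD _ _) _; rewrite normrN lerD2l normrM normr_sg.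
  by case: (y != 0); rewrite ?mul1r ?mul0r.
by exists v, w.
Qed.
End Integrals.

(** * The damped oscillator *)

Section Oscillator.
Context {R : realType}.
Implicit Types (M t s : R) (a b h : R -> R).

(** [a] and [b] solve [y'' + y' + M y = 0] with data [(1, 0)] and [(0, 1)]; [h]
    solves [y'' + y' + M y = 1] with zero data. *)
Definition fund M a b h : Prop :=
  [/\ [/\ a 0 = 1, b 0 = 0 & h 0 = 0],
      forall t, is_derive t 1 a (- M * b t),
      forall t, is_derive t 1 b (a t - b t)
    & forall t, is_derive t 1 h (b t)].

Lemma fund_exists M : exists a b h, fund M a b h.
Proof.
have cst (c : R) : continuous (fun _ : R => c) by move=> t; exact: cvg_cst.
have [a [b [a0 b0 da db]]] := linear_ode _ _ _ _ (cst (- M)) (cst (-1)) (cst 1) (cst 0) 0 1 0.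
have bc : continuous b by move=> t; exact: der_cont (db t).
exists a, b, (prim b); split => //.
- by split => //; exact: (prim0 b bc).
- by move=> t; apply: (der_eq (db t)); ring.
- by move=> t; exact: (der_prim b t bc).
Qed.

Lemma der_shift {f : R -> R} {s t l} : is_derive (t - s) 1 f l ->
  is_derive t 1 (fun y => f (y - s)) l.
Proof.
move=> fd; have h := der_comp (fun y => y - s) f
  (derB (derI t) (derC s t)) fd.
by apply: (der_eq h); ring.
Qed.

(** The variation of constants formula, by uniqueness for the difference of both
    sides. The end points are treated by continuity, since solutions of the Euler
    system satisfy their equations at positive times only. *)
Lemma fund_solve M a b h (D V : R -> R) (c p q s : R) : fund M a b h ->
  p <= s <= q ->
  {within `[p, q], continuous D} -> {within `[p, q], continuous V} ->
  (forall t, p < t < q -> is_derive t 1 D (V t)) ->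
  (forall t, p < t < q -> is_derive t 1 V (- V t - M * D t + c)) ->
  forall t, p <= t <= q ->
    D t = a (t - s) * D s + b (t - s) * V s + h (t - s) * c /\
    V t = - M * b (t - s) * D s + (a (t - s) - b (t - s)) * V s + b (t - s) * c.
Proof.
move=> [[a0 b0 h0] da db dh] psq Dc Vc dD dV t tpq.
pose y t := a (t - s) * D s + b (t - s) * V s + h (t - s) * c.
pose v t := - M * b (t - s) * D s + (a (t - s) - b (t - s)) * V s + b (t - s) * c.
have dy (t' : R) : is_derive t' 1 y (v t').
  apply: (der_eq (derD (derD
    (derZr (D s) (der_shift (da _)))
    (derZr (V s) (der_shift (db _))))
    (derZr c (der_shift (dh _))))).
  by rewrite /v; ring.
have dv (t' : R) : is_derive t' 1 v (- v t' - M * y t' + c * (a (t' - s) + M * h (t' - s))).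
  apply: (der_eq (derD (derD
    (derZr (D s) (derZ (- M) (der_shift (db _))))
    (derZr (V s) (derB (der_shift (da _)) (der_shift (db _)))))
    (derZr c (der_shift (db _))))).
  by rewrite /v /y; ring.
have ah t' : a t' + M * h t' = 1.
  have H (x : R) : is_derive x 1 (fun z => a z + M * h z) 0.
    by apply: (der_eq (derD (da x) (derZ M (dh x)))); ring.
  have := der_diff_eqT 0 t' H (fun x => derC 0 x).
  by rewrite a0 h0; lra.
have K0 : 0 <= 1 + `|M| by rewrite addr_ge0.
have yc : {within `[p, q], continuous y} by exact: (der_within (fun x _ => dy x)).
have vc : {within `[p, q], continuous v} by exact: (der_within (fun x _ => dv x)).
have dDy x : p < x < q -> is_derive x 1 (fun x => D x - y x) (V x - v x).
  by move=> xpq; exact: (derB (dD x xpq) (dy x)).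
have dVv x : p < x < q -> is_derive x 1 (fun x => V x - v x)
    (- (V x - v x) - M * (D x - y x)).
  move=> xpq; apply: (der_eq (derB (dV x xpq) (dv x))).
  by rewrite ah; ring.
have [] := linear_system_zero (1 + `|M|) s
  K0 psq (withinB _ _ _ Dc yc) (withinB _ _ _ Vc vc) dDy dVv _ _ _ _ t tpq.
- move=> x _; have := normr_ge0 (D x - y x); have := normr_ge0 (V x - v x).
  by have := normr_ge0 M; nra.
- move=> x _; apply: le_trans (ler_normB _ _) _; rewrite normrN normrM.
  have := normr_ge0 (D x - y x); have := normr_ge0 (V x - v x).
  by have := normr_ge0 M; nra.
- by rewrite /y subrr a0 b0 h0; ring.
- by rewrite /v subrr a0 b0; ring.
by rewrite /y /v => e1 e2; split; lra.
Qed.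

Section Properties.
Context {M : R} {a b h : R -> R}.
Hypothesis F : fund M a b h.

Lemma fund_a0 : a 0 = 1. Proof. by case: F => [[]]. Qed.
Lemma fund_b0 : b 0 = 0. Proof. by case: F => [[]]. Qed.
Lemma fund_h0 : h 0 = 0. Proof. by case: F => [[]]. Qed.
Lemma der_a t : is_derive t 1 a (- M * b t). Proof. by case: F. Qed.
Lemma der_b t : is_derive t 1 b (a t - b t). Proof. by case: F. Qed.
Lemma der_h t : is_derive t 1 h (b t). Proof. by case: F. Qed.
Lemma cont_a : continuous a. Proof. by move=> t; exact: der_cont (der_a t). Qed.
Lemma cont_b : continuous b. Proof. by move=> t; exact: der_cont (der_b t). Qed.
Lemma cont_h : continuous h. Proof. by move=> t; exact: der_cont (der_h t). Qed.

Lemma fund_ah t : a t = 1 - M * h t.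
Proof.
have H (x : R) : is_derive x 1 (fun z => a z + M * h z) 0.
  by apply: (der_eq (derD (der_a x) (derZ M (der_h x)))); ring.
have := der_diff_eqT 0 t H (fun x => derC 0 x).
by rewrite fund_a0 fund_h0; lra.
Qed.

Lemma fund_solveT (D V : R -> R) (c s : R) :
  (forall t, is_derive t 1 D (V t)) ->
  (forall t, is_derive t 1 V (- V t - M * D t + c)) ->
  forall t, D t = a (t - s) * D s + b (t - s) * V s + h (t - s) * c /\
    V t = - M * b (t - s) * D s + (a (t - s) - b (t - s)) * V s + b (t - s) * c.
Proof.
move=> dD dV t.
have ? : s - `|t - s| <= s <= s + `|t - s| by rewrite lerBlDr lerDl normr_ge0.
have ? : s - `|t - s| <= t <= s + `|t - s|.
  by rewrite -ler_distl.
apply: (fund_solve M a b h D V c (s - `|t - s|) (s + `|t - s|) s F) => //.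
- exact: (der_within (fun x _ => dD x)).
- exact: (der_within (fun x _ => dV x)).
Qed.

(** The Wronskian decays like [exp (- t)] because of the friction; it is the
    determinant of the solution operator. *)
Lemma wronskian t : a t ^+ 2 - a t * b t + M * b t ^+ 2 = expR (- t).
Proof.
have eP (x : R) : is_derive x 1 (fun y => expR (1 * y)) (1 * expR (1 * x)) by exact: der_expM.
have H (x : R) : is_derive x 1
    (fun y => (a y ^+ 2 - a y * b y + M * b y ^+ 2) * expR (1 * y)) 0.
  apply: (der_eq (derM (derD (derB
    (derX2 (der_a x)) (derM (der_a x) (der_b x)))
    (derZ M (derX2 (der_b x)))) (eP x))).
  by ring.
have := der_diff_eqT 0 t H (fun x => derC 0 x).
rewrite fund_a0 fund_b0 mulr0 expR0 mul1r expRN => e.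
apply: (mulIf (lt0r_neq0 (expR_gt0 t))).
by rewrite mulVf ?gt_eqF ?expR_gt0 //; lra.
Qed.

(** Two solutions of the homogeneous equation have a common zero only if they
    are proportional; the sign of this determinant compares [a / b] at two
    times. *)
Lemma fund_det t s : a t * b s - b t * a s = expR (- t) * b (s - t).
Proof.
pose D s := a t * b s - b t * a s.
pose V s := a t * (a s - b s) + b t * (M * b s).
have dD (x : R) : is_derive x 1 D (V x).
  by apply: (der_eq (derB (derZ (a t) (der_b x))
    (derZ (b t) (der_a x)))); rewrite /V; ring.
have dV (x : R) : is_derive x 1 V (- V x - M * D x + 0).
  apply: (der_eq (derD (derZ (a t) (derB (der_a x) (der_b x)))
    (derZ (b t) (derZ M (der_b x))))); rewrite /V /D; ring.
have [e _] := fund_solveT D V 0 t dD dV s; rewrite -/(D s) e.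
by rewrite -wronskian /D /V; ring.
Qed.

(** Overdamped and critical cases: factoring out [exp (- t / 2)] leaves a
    function whose derivative is a hyperbolic cosine, hence at least [1]. *)
Lemma overdamped_b : M <= 1 / 4 -> exists k : R -> R,
  [/\ forall t, b t = expR (- (1 / 2) * t) * k t,
      forall t, 0 <= t -> t <= k t & forall t, t <= 0 -> k t <= t].
Proof.
move=> M4; pose m := Num.sqrt (1 / 4 - M).
have m2 : m * m = 1 / 4 - M by rewrite -expr2 sqr_sqrtr //; lra.
pose ch t := (expR (m * t) + expR (- m * t)) / 2.
pose sh t := (expR (m * t) - expR (- m * t)) / 2.
have dch (t : R) : is_derive t 1 ch (m * sh t).
  apply: (der_eq (derZr 2^-1 (derD (der_expM m t) (der_expM (- m) t)))).
  by rewrite /sh; ring.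
have dsh (t : R) : is_derive t 1 sh (m * ch t).
  apply: (der_eq (derZr 2^-1 (derB (der_expM m t) (der_expM (- m) t)))).
  by rewrite /ch; ring.
have cch : continuous ch by move=> t; exact: der_cont (dch t).
pose k := prim ch.
have dk (t : R) : is_derive t 1 k (ch t) by exact: der_prim.
have k0 : k 0 = 0 by exact: prim0.
have ch1 t : 1 <= ch t.
  rewrite /ch mulNr expRN; have e0 := expR_gt0 (m * t).
  have : 0 <= (expR (m * t))^-1 * (expR (m * t) - 1) ^+ 2.
    by rewrite mulr_ge0 ?sqr_ge0 // invr_ge0 ltW.
  have -> : (expR (m * t))^-1 * (expR (m * t) - 1) ^+ 2 =
    expR (m * t) + (expR (m * t))^-1 - 2 by field; rewrite gt_eqF.
  by lra.
have msh t : m * sh t = m * m * k t.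
  have H (x : R) : is_derive x 1 (fun y => m * sh y - m * m * k y) 0.
    by apply: (der_eq (derB (derZ m (dsh x)) (derZ (m * m) (dk x)))); ring.
  have := der_diff_eqT 0 t H (fun x => derC 0 x).
  by rewrite k0 /sh mulr0 mulr0 subrr mul0r mulr0; lra.
exists k; split.
- move=> t; have dE (x : R) := der_expM (- (1 / 2)) x.
  pose D t := expR (- (1 / 2) * t) * k t.
  pose V t := expR (- (1 / 2) * t) * (ch t - k t / 2).
  have dD (x : R) : is_derive x 1 D (V x).
    by apply: (der_eq (derM (dE x) (dk x))); rewrite /V; field.
  have dV (x : R) : is_derive x 1 V (- V x - M * D x + 0).
    apply: (der_eq (derM (dE x)
      (derB (dch x) (derZr 2^-1 (dk x))))).
    by rewrite msh m2 /V /D; field.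
  have [e _] := fund_solveT D V 0 0 dD dV t.
  have D0 : D 0 = 0 by rewrite /D k0 mulr0.
  have V0 : V 0 = 1 by rewrite /V k0 /ch !mulr0 expR0; field.
  by rewrite -/(D t) e D0 V0 subr0; ring.
- move=> t t0.
  have := der_le_closed t0 (fun x _ => derI x) (fun x _ => dk x) (fun x _ => ch1 x).
  by rewrite k0; lra.
- move=> t t0.
  have := der_le_closed t0 (fun x _ => derI x) (fun x _ => dk x) (fun x _ => ch1 x).
  by rewrite k0; lra.
Qed.

Lemma underdamped : M > 1 / 4 -> let w := Num.sqrt (4 * M - 1) / 2 in
  0 < w /\ forall t, b t = expR (- (1 / 2) * t) * (sin (w * t) / w) /\
    a t = expR (- (1 / 2) * t) * (cos (w * t) + sin (w * t) / w / 2).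
Proof.
move=> M4 w; have w0 : 0 < w by rewrite divr_gt0 // sqrtr_gt0; lra.
have w2 : w * w = M - 1 / 4.
  rewrite /w mulrACA -expr2 sqr_sqrtr; last by lra.
  by field.
have wn : w != 0 by rewrite gt_eqF.
split => // t; have dE (x : R) := der_expM (- (1 / 2)) x.
have ds (x : R) : is_derive x 1 (fun y => sin (w * y) / w) (cos (w * x)).
  apply: (der_eq (derZr w^-1 (der_comp _ (@sin R) (derZI w x) (is_derive_sin _)))).
  by field.
have dc (x : R) : is_derive x 1 (fun y => cos (w * y)) (- w * sin (w * x)).
  apply: (der_eq (der_comp _ (@cos R) (derZI w x) (is_derive_cos _))).
  by ring.
pose D t := expR (- (1 / 2) * t) * (sin (w * t) / w).
pose V t := expR (- (1 / 2) * t) * (cos (w * t) - sin (w * t) / w / 2).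
have dD (x : R) : is_derive x 1 D (V x).
  by apply: (der_eq (derM (dE x) (ds x))); rewrite /V; field.
have dV (x : R) : is_derive x 1 V (- V x - M * D x + 0).
  apply: (der_eq (derM (dE x)
    (derB (dc x) (derZr 2^-1 (ds x))))).
  have -> : M = w * w + 1 / 4 by rewrite w2; ring.
  by rewrite /V /D; field.
have [H1 H2] := fund_solveT D V 0 0 dD dV t.
have D0 : D 0 = 0 by rewrite /D !mulr0 sin0 mul0r mulr0.
have V0 : V 0 = 1 by rewrite /V !mulr0 sin0 cos0 expR0; ring.
rewrite D0 V0 subr0 in H1 H2.
have eb : b t = D t by rewrite H1; ring.
have ea : a t = V t + D t by rewrite H2 -eb; ring.
by rewrite eb ea /V /D; split; field.
Qed.
End Properties.
End Oscillator.

(** * Inverse functions *)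

Section InverseFunctions.
Context {R : realType}.
Implicit Types (f g : R -> R) (x y : R).

Lemma der_lt {f} {df : R -> R} {x y : R} : x < y ->
  (forall z : R, is_derive z 1 f (df z)) -> (forall z : R, x < z < y -> 0 < df z) ->
  f x < f y.
Proof.
move=> xy fd df0.
have fc : {within `[x, y], continuous f} by exact: (der_within (fun z _ => fd z)).
have [z /[!in_itv] /= /df0 zxy e] := MVT xy (fun z _ => fd z) fc.
by rewrite -subr_gt0 e mulr_gt0 // subr_gt0.
Qed.

(** Continuity of the inverse is automatic: the values of [f] at [g s - e] and
    [g s + e] enclose [s]. *)
Lemma increasing_inverse f : continuous f ->
  (forall x y, x < y -> f x < f y) ->
  (forall y, exists x, f x <= y) -> (forall y, exists x, y <= f x) ->
  exists g, [/\ cancel f g, cancel g f, continuous g &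
                forall x y, x < y -> g x < g y].
Proof.
move=> fc fi flo fhi.
have surj y : exists x, f x = y.
  have [u hu] := flo y; have [v hv] := fhi y.
  have uv : u <= v.
    by rewrite leNgt; apply/negP => /fi h; have := lt_le_trans h hu; rewrite ltNge hv.
  have [||x _ <-] := @IVT R f u v y uv; last by exists x.
  - exact: continuous_subspaceT.
  - by rewrite ge_min hu /= le_max hv orbT.
have [g gf] := choice surj.
have finj x y : f x = f y -> x = y.
  by case: (ltgtP x y) => // /fi; [move=> /[swap] ->|move=> /[swap] ->]; rewrite ltxx.
have fg : cancel f g by move=> x; apply: finj.
have fle x y : f x < f y -> x < y.
  rewrite !ltNge; apply: contra; rewrite le_eqVlt => /predU1P[->//|/fi/ltW //].
have gi x y : x < y -> g x < g y by move=> xy; apply: fle; rewrite !gf.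
exists g; split => // s; apply/contP => e e0.
have l1 := fi (g s - e) (g s) ltac:(lra); have l2 := fi (g s) (g s + e) ltac:(lra).
rewrite gf in l1 l2.
exists (Num.min (s - f (g s - e)) (f (g s + e) - s)) => [|y].
  by rewrite lt_min !subr_gt0 l1.
rewrite lt_min => /andP[/ltr_normlP[? ?] /ltr_normlP[? ?]].
have h1 : g s - e < g y by apply: fle; rewrite gf; lra.
have h2 : g y < g s + e by apply: fle; rewrite gf; lra.
by apply/ltr_normlP; split; lra.
Qed.

Lemma der_inverse f g (s l : R) : cancel f g -> cancel g f -> continuous f ->
  is_derive (g s) 1 f l -> l != 0 -> is_derive s 1 g l^-1.
Proof.
move=> fg gf fc fd l0; rewrite -{1}(gf s).
have n1 : {near g s, cancel f g} by near=> y; exact: fg.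
have n2 : {near g s, continuous f} by near=> y; exact: fc.
exact: is_derive_inverse.
Unshelve. all: by end_near.
Qed.

Lemma retract_continuous (T : topologicalType) (A : set T) (f : T -> R) (r : T -> T) :
  (forall z, A (r z)) -> continuous r -> {within A, continuous f} ->
  continuous (f \o r).
Proof.
move=> Ar rc /subspace_continuousP fc x.
apply: cvg_trans (fc (r x) (Ar x)) => P /= Pfr.
have := rc x _ Pfr; rewrite /nbhs /=.
by apply: filterS => y /(_ (Ar y)).
Qed.

(** A function which increases strictly on the range of a retraction [k] onto
    an interval, extended by translations, becomes a homeomorphism of the line;
    this replaces one-sided arguments at the ends of the interval. *)
Lemma retract_inverse f (k : R -> R) : continuous f -> continuous k ->
  (forall x y, x <= y -> k x <= k y /\ k y - k x <= y - x) ->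
  (forall x y, k x < k y -> f (k x) < f (k y)) ->
  (forall y, exists x, f (k x) + (x - k x) <= y) ->
  (forall y, exists x, y <= f (k x) + (x - k x)) ->
  exists g, [/\ continuous g,
    cancel (fun x => f (k x) + (x - k x)) g,
    cancel g (fun x => f (k x) + (x - k x)) &
    forall x y, x < y -> g x < g y].
Proof.
move=> fc kc kle flt lo hi; pose F x := f (k x) + (x - k x).
have Fc : continuous F.
  move=> x; rewrite /F; apply: cvgD; last first.
    by apply: cvgB; [exact: cvg_id|exact: kc].
  by apply: (@continuous_comp _ _ _ k f); [exact: kc|exact: fc].
have [|g [h1 h2 h3 h4]] := increasing_inverse F Fc _ lo hi; last by exists g; split.
move=> x y xy; have [k1 k2] := kle x y (ltW xy); rewrite /F.
by move: k1; rewrite le_eqVlt => /predU1P[->|/flt]; lra.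
Qed.
End InverseFunctions.

(** * Threshold curves *)

Section Thresholds.
Context {R : realType}.
Variables (M : R) (a b h : R -> R).
Hypothesis F : fund M a b h.

(** The solution of [w'' + w' + M w = 2] through [(0, 0)], run backwards in
    time: in the plane of [w = 1 / rho] and [w' = d / rho] it
    traces the boundary of the set of subcritical data. *)
Definition crit (s : R) : R := 2 * h (- s).
Definition dcrit (s : R) : R := - (2 * b (- s)).

Lemma der_crit (s : R) : is_derive s 1 crit (dcrit s).
Proof.
have hN := der_comp (fun y => - y) h (derN (derI s)) (der_h F (- s)).
by apply: (der_eq (derZ 2 hN)); rewrite /dcrit; ring.
Qed.

Lemma der_dcrit (s : R) : is_derive s 1 dcrit (dcrit s + 2 - M * crit s).
Proof.
have hN := der_comp (fun y => - y) b (derN (derI s)) (der_b F (- s)).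
apply: (der_eq (derN (derZ 2 hN))).
by rewrite (fund_ah F) /dcrit /crit; ring.
Qed.

Lemma crit0 : crit 0 = 0. Proof. by rewrite /crit oppr0 (fund_h0 F) mulr0. Qed.
Lemma dcrit0 : dcrit 0 = 0. Proof. by rewrite /dcrit oppr0 (fund_b0 F) mulr0 oppr0. Qed.

Lemma crit_cont : continuous crit.
Proof. by move=> s; exact: der_cont (der_crit s). Qed.

Lemma dcrit_cont : continuous dcrit.
Proof. by move=> s; exact: der_cont (der_dcrit s). Qed.

Section Overdamped.
Hypothesis M4 : M <= 1 / 4.

Lemma b_gt0 (t : R) : 0 < t -> 0 < b t.
Proof.
have [k [bk kp _]] := overdamped_b F M4.
move=> t0; rewrite bk mulr_gt0 ?expR_gt0 //; apply: lt_le_trans t0 (kp _ (ltW t0)).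
Qed.

Lemma b_le (t : R) : t <= 0 -> b t <= t.
Proof.
have [k [bk _ kn]] := overdamped_b F M4.
move=> t0; rewrite bk; have k0 := kn t t0.
have e1 : 1 <= expR (- (1 / 2) * t) by rewrite -[leLHS]expR0 ler_expR; lra.
nra.
Qed.

Lemma dcrit_ge (s : R) : 0 <= s -> 2 * s <= dcrit s.
Proof. by move=> s0; rewrite /dcrit; have := b_le (- s) ltac:(lra); lra. Qed.

Lemma crit_ge (s : R) : 0 <= s -> s ^+ 2 <= crit s.
Proof.
move=> s0.
have d2 (x : R) : is_derive x 1 (fun y => y ^+ 2) (2 * x).
  by apply: (der_eq (derX2 (derI x))); rewrite mulr1.
have := der_le_closed s0 (fun x _ => d2 x) (fun x _ => der_crit x) _.
by rewrite crit0 expr0n /= !subr0; apply => x /andP[x0 _]; exact: dcrit_ge.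
Qed.

Lemma h_ge0 (t : R) : 0 <= h t.
Proof.
have [t0|/ltW t0] := leP 0 t.
  have := der_le_closed t0 (fun x _ => derC 0 x) (fun x _ => der_h F x) _.
  rewrite (fund_h0 F) subrr subr0; apply => x /andP[+ _].
  by rewrite le_eqVlt => /predU1P[<-|/b_gt0/ltW //]; rewrite (fund_b0 F).
have := crit_ge (- t) ltac:(lra); rewrite /crit opprK.
by have := sqr_ge0 (- t); lra.
Qed.

Lemma crit_ge0 (s : R) : 0 <= crit s.
Proof. by rewrite /crit mulr_ge0 ?h_ge0. Qed.

(** On the left half-line [crit] is replaced by the identity, so that the whole
    line is mapped homeomorphically onto itself. *)
Lemma crit_inverse : exists g : R -> R, [/\ continuous g, g 0 = 0,
  forall s, 0 < s -> 0 < g s /\ crit (g s) = s &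
  forall s : R, 0 < s -> is_derive s 1 g (dcrit (g s))^-1].
Proof.
pose k (x : R) := Num.max 0 x.
have kE (x : R) : 0 <= x -> k x = x by move=> ?; rewrite /k max_r.
have kN (x : R) : x <= 0 -> k x = 0 by move=> ?; rewrite /k max_l.
have kc : continuous k by move=> x; apply: continuous_max; [exact: cvg_cst|exact: cvg_id].
have klt (x y : R) : k x < k y -> crit (k x) < crit (k y).
  move=> xy; apply: (der_lt xy der_crit) => z /andP[xz _].
  have z0 : 0 < z by apply: le_lt_trans xz; rewrite /k le_max lexx.
  by have := dcrit_ge z (ltW z0); lra.
have kle (x y : R) : x <= y -> k x <= k y /\ k y - k x <= y - x.
  have [x0|/ltW x0] := leP 0 x; have [y0|/ltW y0] := leP 0 y => xy.
  - by rewrite !kE //; split; lra.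
  - by rewrite (kE x x0) (kN y y0); split; lra.
  - by rewrite (kN x x0) (kE y y0); split; lra.
  - by rewrite !kN //; split; lra.
have [y|y|g [gc g1 g2 gi]] := retract_inverse crit k crit_cont kc kle klt.
- exists (Num.min 0 y); rewrite kN ?crit0 ?ge_min ?lexx //.
  by have : Num.min 0 y <= y by [rewrite ge_min lexx orbT]; lra.
- exists (`|y| + 1); have n0 := normr_ge0 y; rewrite kE; last by lra.
  have := crit_ge (`|y| + 1) ltac:(lra).
  by have := ler_norm y; nra.
have g0 : g 0 = 0.
  by rewrite -[RHS]g1; congr g; rewrite kE // crit0 subrr addr0.
have gs (s : R) : 0 < s -> 0 < g s /\ crit (g s) = s.
  move=> s0; have gs0 : 0 < g s by rewrite -g0; exact: gi.
  by split => //; have := g2 s; rewrite /= kE ?ltW // subrr addr0.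
exists g; split => // s s0; have [gs0 _] := gs s s0.
have fd : is_derive (g s) 1 (fun x => crit (k x) + (x - k x)) (dcrit (g s)).
  apply: (der_pos gs0 _ (der_crit _)) => y y0.
  by rewrite kE ?ltW // subrr addr0.
apply: (der_inverse (fun x => crit (k x) + (x - k x)) g) => //; last first.
  by have := dcrit_ge (g s) (ltW gs0); move=> ?; apply/eqP; lra.
move=> x; apply: cvgD; last first.
  by apply: cvgB; [exact: cvg_id|exact: kc].
by apply: (@continuous_comp _ _ _ k crit); [exact: kc|exact: crit_cont].
Qed.

Lemma Ra_exists : exists Ra, is_Ra M Ra.
Proof.
have [g [gc g0 gs gd]] := crit_inverse.
have g_ge0 (s : R) : 0 <= s -> 0 <= g s.
  by rewrite le_eqVlt => /predU1P[<-|/gs[/ltW]//]; rewrite g0.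
exists (dcrit \o g); split => [|s s0|/=|s s0].
- apply: continuous_subspaceT => x.
  by apply: continuous_comp; [exact: gc|exact: dcrit_cont].
- by have := dcrit_ge _ (g_ge0 s s0); have := g_ge0 s s0; rewrite /=; lra.
- by rewrite g0 dcrit0.
- have [gs0 cgs] := gs s s0.
  have d0 : dcrit (g s) != 0.
    by have := dcrit_ge (g s) (ltW gs0); move=> ?; apply/eqP; lra.
  split => //=; apply: (der_eq (der_comp g dcrit (gd s s0) (der_dcrit _))).
  by rewrite cgs; field.
Qed.

(** Every solution of the threshold equation is the curve [crit]: the equation
    is singular at its starting point, but along the curve the square of the
    difference of two solutions decreases as long as [M * crit <= 2]; further on
    Gronwall applies. *)
Lemma Ra_crit (Ra : R -> R) : is_Ra M Ra ->
  forall s, 0 <= s -> Ra (crit s) = dcrit s.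
Proof.
move=> [Rc R0 Ra0 Rd] s; rewrite le_eqVlt => /predU1P[<-|s0].
  by rewrite crit0 dcrit0.
have c0 (x : R) : 0 < x -> 0 < crit x.
  by move=> x0; apply: lt_le_trans (crit_ge x (ltW x0)); rewrite exprn_gt0.
pose e x := Ra (crit x) - dcrit x.
pose q x := - (2 * (2 - M * crit x) / Ra (crit x)).
have ed (x : R) : 0 < x -> is_derive x 1 (fun y => e y ^+ 2) (q x * e x ^+ 2).
  move=> x0; have [n0 rd] := Rd _ (c0 x x0).
  apply: (der_eq (derX2 (derB
    (der_comp crit Ra (der_crit x) rd) (der_dcrit x)))).
  by rewrite /q /e; field.
have [d d0 hd] : exists2 d, 0 < d & forall x, 0 <= x <= d -> M * crit x <= 2.
  have : {for 0, continuous (fun x => M * crit x)}.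
    by apply: cvgM; [exact: cvg_cst|exact: crit_cont].
  move=> /contP/(_ 2 ltac:(lra))[d d0 h2]; exists (d / 2); first lra.
  move=> x /andP[x0 xd]; have := h2 x; rewrite crit0 mulr0 !subr0.
  by rewrite (ger0_norm x0) => /(_ ltac:(lra))/ltr_normlP[]; lra.
have maxA (x : R) : `[0, +oo[%classic (Num.max 0 x) by rewrite /= in_itv /= andbT le_max lexx.
have maxc : continuous (Num.max (0 : R)).
  by move=> x; apply: continuous_max; [exact: cvg_cst|exact: cvg_id].
have ec (u v : R) : 0 <= u -> {within `[u, v], continuous (fun y => e y ^+ 2)}.
  move=> u0.
  have Rcc := retract_continuous _ _ _ _ maxA maxc Rc.
  have Rc1 : continuous (fun y => Ra (crit y)).
    have -> : (fun y => Ra (crit y)) = (Ra \o Num.max 0) \o crit.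
      by apply/funext => y /=; rewrite max_r // crit_ge0.
    by move=> x; apply: continuous_comp; [exact: crit_cont|exact: Rcc].
  have ec : continuous e by move=> x; apply: cvgB; [exact: Rc1|exact: dcrit_cont].
  by apply: continuous_subspaceT => x; apply: cvgM; exact: ec.
pose s1 := Num.min s d.
have s10 : 0 < s1 by rewrite lt_min s0.
have e1 : e s1 ^+ 2 <= 0.
  apply: (gronwall_fwd 0 (ltW s10) (ec 0 s1 (lexx 0))).
  - by move=> x /andP[x0 _]; exact: ed.
  - move=> x /andP[x0 xs]; rewrite mul0r; have [n0 _] := Rd _ (c0 x x0).
    have Rp : 0 < Ra (crit x) by rewrite lt0r n0 R0 // ltW // c0.
    have := hd x; rewrite /q mulNr oppr_le0 => /(_ _) h2.
    rewrite mulr_ge0 ?sqr_ge0 // divr_ge0 ?(ltW Rp) // mulr_ge0 // subr_ge0 h2 //.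
    by rewrite ltW //= (le_trans (ltW xs)) // ge_min lexx orbT.
  - by rewrite /e crit0 dcrit0 Ra0 subrr expr0n.
have s1s : s1 <= s by rewrite ge_min lexx.
have [K hK] : exists K, forall x, s1 <= x <= s -> q x <= K.
  have [|x _ hx] := @EVT_max R q s1 s s1s; last first.
    by exists (q x) => y ys; apply: hx; rewrite in_itv.
  apply: continuous_in_subspaceT => x /set_mem; rewrite /= in_itv /= => /andP[sx _].
  have x0 : 0 < x by exact: lt_le_trans sx.
  have [n0 rd] := Rd _ (c0 x x0).
  exact: (der_cont (derN (derM
    (derZ 2 (derB (derC 2 x) (derZ M (der_crit x))))
    (derV n0 (der_comp crit Ra (der_crit x) rd))))).
have : e s ^+ 2 <= 0.
  apply: (gronwall_fwd K s1s (ec s1 s (ltW s10))) => //.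
  - by move=> x /andP[x0 _]; apply: ed; exact: lt_trans x0.
  - move=> x /andP[x0 xs]; apply: ler_wpM2r; first exact: sqr_ge0.
    by apply: hK; rewrite !ltW.
move=> es; have : e s ^+ 2 == 0 by rewrite eq_le es sqr_ge0.
by rewrite sqrf_eq0 subr_eq0 => /eqP.
Qed.

(** Time translates of [crit] are solutions; the one that agrees with given data
    [1 / r] at time zero differs from the solution with velocity [d] by a
    multiple of [b], and vanishes at a positive time. *)
Lemma region_aboveP (Ra : R -> R) (r d : R) : is_Ra M Ra -> 0 < r ->
  (forall t, 0 <= t -> 0 < a t + b t * d + h t * (2 * r)) <->
  region_above Ra (r, d).
Proof.
move=> Rac r0; have [g [_ _ gs _]] := crit_inverse.
have [s0 cs] := gs (1 / r) ltac:(by rewrite divr_gt0).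
set s := g (1 / r) in s0 cs.
have RaE : Ra (1 / r) = dcrit s by rewrite -cs; apply: Ra_crit => //; exact: ltW.
pose e := d + r * dcrit s.
have yE t : a t + b t * d + h t * (2 * r) = r * crit (s - t) + e * b t.
  have dN (x : R) : is_derive x 1 (fun y => s - y) (- 1).
    by apply: (der_eq (derB (derC s x) (derI x))); ring.
  have dD (x : R) : is_derive x 1 (fun t => r * crit (s - t)) (- (r * dcrit (s - x))).
    by apply: (der_eq (derZ r (der_comp _ crit (dN x) (der_crit _)))); ring.
  have dV (x : R) : is_derive x 1 (fun t => - (r * dcrit (s - t)))
     (- - (r * dcrit (s - x)) - M * (r * crit (s - x)) + 2 * r).
    apply: (der_eq (derN (derZ r (der_comp _ dcrit (dN x) (der_dcrit _))))).
    by ring.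
  have [-> _] := fund_solveT F _ _ _ 0 dD dV t.
  by rewrite !subr0 cs /e; field; rewrite gt_eqF.
rewrite /region_above /= RaE; split => [pos|[+ _] t t0].
- split => //; have := pos s (ltW s0); rewrite yE subrr crit0 mulr0 add0r.
  by rewrite pmulr_lgt0 ?b_gt0 // /e; lra.
- rewrite mulNr => de; have e0 : 0 < e by rewrite /e; lra.
  rewrite yE; move: t0; rewrite le_eqVlt => /predU1P[<-|t0].
    by rewrite subr0 cs (fund_b0 F) mulr0 addr0 mul1r divff ?gt_eqF.
  by rewrite ltr_wpDl ?mulr_gt0 ?b_gt0 // mulr_ge0 ?crit_ge0 // ltW.
Qed.
End Overdamped.

Section Underdamped.
Hypothesis M4 : M > 1 / 4.
Let w : R := Num.sqrt (4 * M - 1) / 2.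
Let T : R := pi / w.

Let w0 : 0 < w. Proof. by have [] := underdamped F M4. Qed.
Let T0 : 0 < T. Proof. by rewrite divr_gt0 // pi_gt0. Qed.
Let wT : w * T = pi. Proof. by rewrite /T mulrC divfK // gt_eqF. Qed.
Let M0 : 0 < M. Proof. by have := M4; lra. Qed.

Let bE t : b t = expR (- (1 / 2) * t) * (sin (w * t) / w).
Proof. by have [_ /(_ t)[]] := underdamped F M4. Qed.

Let aE t : a t = expR (- (1 / 2) * t) * (cos (w * t) + sin (w * t) / w / 2).
Proof. by have [_ /(_ t)[]] := underdamped F M4. Qed.

(** After half a period a solution without forcing has changed sign, whatever
    its initial velocity. *)
Lemma half_period : exists t, [/\ 0 < t, b t = 0 & a t < 0].
Proof.
exists T; split => //; first by rewrite bE wT sinpi mul0r mulr0.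
by rewrite aE wT sinpi cospi !mul0r addr0 mulrN1 oppr_lt0 expR_gt0.
Qed.

Let dcritE s : dcrit s = 2 * expR (1 / 2 * s) * (sin (w * s) / w).
Proof.
rewrite /dcrit bE (_ : w * - s = - (w * s)); last by ring.
rewrite sinN (_ : - (1 / 2) * - s = 1 / 2 * s); last by ring.
by field; rewrite gt_eqF.
Qed.

Let aN s : a (- s) = expR (1 / 2 * s) * (cos (w * s) - sin (w * s) / w / 2).
Proof.
rewrite aE (_ : w * - s = - (w * s)); last by ring.
rewrite sinN cosN (_ : - (1 / 2) * - s = 1 / 2 * s); last by ring.
by field; rewrite gt_eqF.
Qed.

Let critE s : crit s = 2 / M * (1 - a (- s)).
Proof. by rewrite (fund_ah F) /crit; field; rewrite gt_eqF. Qed.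

Let critT : crit T = gamma M.
Proof.
rewrite critE aN wT sinpi cospi !mul0r subr0 mulrN1 opprK.
rewrite /gamma; congr (_ * (1 + expR _)); rewrite /T /w.
by field; rewrite gt_eqF // sqrtr_gt0; have := M4; lra.
Qed.

Let crit2T : crit (T + T) < 0.
Proof.
rewrite critE aN (mulrDr w) wT -mulr2n sin2pi cos2pi !mul0r subr0 mulr1.
rewrite pmulr_rlt0 ?divr_gt0 // subr_lt0 -[ltLHS]expR0 ltr_expR.
by have := T0; lra.
Qed.

Let dcrit_gt0 s : 0 < s < T -> 0 < dcrit s.
Proof.
move=> /andP[s0 sT]; rewrite dcritE; apply: mulr_gt0; first by rewrite mulr_gt0 ?expR_gt0.
by apply: divr_gt0 => //; apply: sin_gt0_pi; rewrite mulr_gt0 //= -wT ltr_pM2l.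
Qed.

Let dcrit_lt0 s : 0 < s < T -> dcrit (T + s) < 0.
Proof.
move=> /andP[s0 sT]; rewrite dcritE pmulr_rlt0 ?mulr_gt0 ?expR_gt0 //.
rewrite mulrDr wT addrC sinDpi mulNr oppr_lt0.
by apply: divr_gt0 => //; apply: sin_gt0_pi; rewrite mulr_gt0 //= -wT ltr_pM2l.
Qed.

(** Outside of [[0, T]] the function is continued with slope one, which makes the
    inverse continuous on the whole line. *)
Let segment_inverse (f df : R -> R) : f 0 = 0 ->
  (forall x : R, is_derive x 1 f (df x)) -> (forall x, 0 < x < T -> 0 < df x) ->
  exists g : R -> R, [/\ continuous g, g 0 = 0, g (f T) = T,
    forall s, 0 < s < f T -> 0 < g s < T /\ f (g s) = s &
    forall s : R, 0 < s < f T -> is_derive s 1 g (df (g s))^-1].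
Proof.
move=> f0 fd df0; pose k (x : R) := Num.max 0 (Num.min T x).
have fc : continuous f by move=> x; exact: der_cont (fd x).
have kE (x : R) : 0 <= x <= T -> k x = x.
  by move=> /andP[? ?]; rewrite /k min_r // max_r.
have kN (x : R) : x <= 0 -> k x = 0.
  by move=> ?; rewrite /k min_r ?max_l //; have := T0; lra.
have kT (x : R) : T <= x -> k x = T.
  by move=> ?; rewrite /k min_l ?max_r // ltW.
have k01 (x : R) : 0 <= k x <= T.
  by rewrite /k le_max lexx /= ge_max (ltW T0) ge_min lexx.
have kc : continuous k.
  move=> x; apply: continuous_max; first exact: cvg_cst.
  by apply: continuous_min; [exact: cvg_cst|exact: cvg_id].
have flt (x y : R) : 0 <= x -> y <= T -> x < y -> f x < f y.
  by move=> x0 yT xy; apply: (der_lt xy fd) => z /andP[? ?]; apply: df0; lra.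
have klt (x y : R) : k x < k y -> f (k x) < f (k y).
  by apply: flt; have := k01 x; have := k01 y; lra.
have kle (x y : R) : x <= y -> k x <= k y /\ k y - k x <= y - x.
  move=> xy; have [x0|/ltW x0] := leP x 0.
    have [y0|/ltW y0] := leP y 0; first by rewrite !kN //; split; lra.
    have [yT|/ltW yT] := leP y T.
      by rewrite (kN x) // (kE y) ?y0 //; split; lra.
    by rewrite (kN x) // (kT y) //; have := T0; split; lra.
  have [xT|/ltW xT] := leP x T.
    have [yT|/ltW yT] := leP y T.
      by rewrite (kE x) ?x0 // (kE y) ?yT ?andbT; [split|]; lra.
    by rewrite (kE x) ?x0 // (kT y) //; split; lra.
  by rewrite !kT //; [split|]; lra.
have [y|y|g [gc g1 g2 gi]] := retract_inverse f k fc kc kle klt.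
- exists (Num.min 0 y); rewrite kN ?f0 ?ge_min ?lexx //.
  by have : Num.min 0 y <= y by [rewrite ge_min lexx orbT]; lra.
- exists (T + `|y|); rewrite kT ?lerDl //.
  have := flt 0 T (lexx _) (lexx _) T0; rewrite f0.
  by have := ler_norm y; lra.
have g0 : g 0 = 0.
  by rewrite -[RHS]g1; congr g; rewrite kN // f0 subrr addr0.
have gT : g (f T) = T.
  by rewrite -[RHS]g1; congr g; rewrite kT // subrr addr0.
have gs (s : R) : 0 < s < f T -> 0 < g s < T /\ f (g s) = s.
  move=> /andP[s0 sT]; have gs0 : 0 < g s < T.
    by apply/andP; split; [rewrite -[ltLHS]g0|rewrite -[ltRHS]gT]; exact: gi.
  by split => //; have := g2 s; rewrite /= kE ?subrr ?addr0 //; lra.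
exists g; split => // s s0; have [/andP[gs0 gs1] _] := gs s s0.
have fd' : is_derive (g s) 1 (fun x => f (k x) + (x - k x)) (df (g s)).
  apply: (@der_near _ f _ _ _ _ (fd _)).
  have n1 : \forall y \near g s, 0 < y by apply: lt_nbhsr.
  have n2 : \forall y \near g s, y < T by apply: lt_nbhsl.
  by apply: filterS2 n1 n2 => y y0 y1; rewrite kE ?(ltW y0) ?(ltW y1) // subrr addr0.
apply: (der_inverse (fun x => f (k x) + (x - k x)) g) => //; last first.
  by rewrite gt_eqF // df0 // gs0.
move=> x; apply: cvgD; last first.
  by apply: cvgB; [exact: cvg_id|exact: kc].
by apply: (@continuous_comp _ _ _ k f); [exact: kc|exact: fc].
Qed.

Lemma R1_exists : exists R1, is_R1 M R1.
Proof.
have [g [gc g0 gT gs gd]] := segment_inverse crit dcrit crit0 der_crit dcrit_gt0.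
rewrite critT in gT gs gd.
exists (dcrit \o g); split => [|s /andP[s0 sT]|/=|s s0].
- apply: continuous_subspaceT => x.
  by apply: continuous_comp; [exact: gc|exact: dcrit_cont].
- move: s0 sT; rewrite le_eqVlt => /predU1P[<- _|s0].
    by rewrite /= g0 dcrit0.
  rewrite le_eqVlt => /predU1P[->|sT].
    by rewrite /= gT dcritE wT sinpi mul0r mulr0.
  by have [/dcrit_gt0/ltW] := gs s ltac:(by rewrite s0).
- by rewrite g0 dcrit0.
- have [gs0 cgs] := gs s s0.
  have d0 : dcrit (g s) != 0 by rewrite gt_eqF // dcrit_gt0.
  split => //=; apply: (der_eq (der_comp g dcrit (gd s s0) (der_dcrit _))).
  by rewrite cgs; field.
Qed.

(** After the half period [crit] runs back from [gamma] and passes below [0] before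
    the full period, so the second arc covers the whole segment. *)
Lemma R2_exists : exists R2, is_R2 M R2.
Proof.
pose f x := gamma M - crit (T + x).
have dTx (x : R) : is_derive x 1 (fun y => T + y) 1.
  by apply: (der_eq (derD (derC T x) (derI x))); ring.
have fd (x : R) : is_derive x 1 f (- dcrit (T + x)).
  apply: (der_eq (derB (derC _ x) (der_comp _ crit (dTx x) (der_crit _)))).
  by ring.
have f0 : f 0 = 0 by rewrite /f addr0 critT subrr.
have [|g [gc g0 gT gs gd]] := segment_inverse f _ f0 fd.
  by move=> x /dcrit_lt0; lra.
have gfT : gamma M < f T by rewrite /f; have := crit2T; lra.
have sub s : 0 < s <= gamma M -> 0 < s < f T.
  by move=> /andP[-> sg] /=; exact: le_lt_trans gfT.
have dr (x : R) : is_derive x 1 (fun y => dcrit (T + y))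
    (dcrit (T + x) + 2 - M * crit (T + x)).
  by apply: (der_eq (der_comp _ dcrit (dTx x) (der_dcrit _))); ring.
exists (fun s => dcrit (T + g s)); split => [|s /andP[s0 sT]|/=|s s0].
- apply: continuous_subspaceT => x.
  apply: (@continuous_comp _ _ _ g (fun y => dcrit (T + y))); first exact: gc.
  exact: der_cont (dr _).
- move: s0; rewrite le_eqVlt => /predU1P[<-|s0].
    by rewrite g0 addr0 dcritE wT sinpi mul0r mulr0.
  by have [/dcrit_lt0/ltW] := gs s (sub s ltac:(by rewrite s0)).
- by rewrite g0 addr0 dcritE wT sinpi mul0r mulr0.
- have s1 : 0 < s < f T by move/andP: s0 => [? ?]; apply: sub; lra.
  have [gs0 cgs] := gs s s1.
  have d0 : dcrit (T + g s) != 0 by rewrite lt_eqF // dcrit_lt0.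
  split => //=; apply: (der_eq (der_comp g _ (gd s s1) (dr _))).
  have -> : gamma M - s = crit (T + g s) by rewrite -{1}cgs /f; ring.
  by field.
Qed.
End Underdamped.
End Thresholds.

Lemma is_RbP {R : realType} (Rb : R -> R) : is_Rb Rb <-> is_Ra (1 / 4) Rb.
Proof.
have e (s : R) : s / 4 = 1 / 4 * s by rewrite mulrC mul1r.
by split=> -[h1 h2 h3 h4]; split => // s /h4 []; rewrite e.
Qed.

(** * Characteristics of an arbitrary solution *)

Section PositiveTimes.
Context {R : realType}.

Lemma seg_bounded (f : R -> R) (a b : R) :
  (forall x, a <= x <= b -> {for x, continuous f}) ->
  exists2 K, 0 <= K & forall x, a <= x <= b -> `|f x| <= K.
Proof.
move=> fc; have [|K K0 hK] := @cont2_bounded R (fun y _ => f y) a b 0 0.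
  by move=> y s yab _; apply: cont2_1; exact: fc.
by exists K => // x xab; apply: (hK x 0) => //; rewrite lexx.
Qed.

Lemma within_seg (f : R -> R) (a b : R) :
  (forall x, a <= x <= b -> {for x, continuous f}) -> {within `[a, b], continuous f}.
Proof.
by move=> fc; apply: continuous_in_subspaceT => x /set_mem /=; rewrite in_itv; exact: fc.
Qed.

Lemma linear_system_zero_pos (e g k1 k2 k3 k4 : R -> R) s : 0 < s ->
  (forall t, 0 < t -> [/\ {for t, continuous k1}, {for t, continuous k2},
                         {for t, continuous k3} & {for t, continuous k4}]) ->
  (forall t : R, 0 < t -> is_derive t 1 e (k1 t * e t + k2 t * g t)) ->
  (forall t : R, 0 < t -> is_derive t 1 g (k3 t * e t + k4 t * g t)) ->
  e s = 0 -> g s = 0 -> forall t, 0 < t -> e t = 0 /\ g t = 0.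
Proof.
move=> s0 kc de dg es gs t t0; pose p := Num.min s t; pose r := Num.max s t.
have p0 : 0 < p by rewrite lt_min s0.
have pos x : p <= x <= r -> 0 < x by move=> /andP[+ _]; exact: lt_le_trans.
have pos' x : p < x < r -> 0 < x by move=> /andP[+ _]; exact: lt_trans.
pose k x := `|k1 x| + `|k2 x| + (`|k3 x| + `|k4 x|).
have [|K K0 hK] := seg_bounded k p r.
  by move=> x /pos/kc[*]; do !apply: cvgD; apply: cvg_norm.
have kK x : p < x < r -> `|k x| <= K by move=> /andP[? ?]; apply: hK; rewrite !ltW.
have bound x c d : `|c| + `|d| <= `|k x| -> p < x < r ->
    `|c * e x + d * g x| <= K * (`|e x| + `|g x|).
  move=> cd /kK/(le_trans cd) le; have := normr_ge0 c; have := normr_ge0 d => ? ?.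
  rewrite mulrDr; apply: le_trans (ler_normD _ _) _; rewrite !normrM.
  by apply: lerD; apply: ler_wpM2r => //; lra.
have kE x : `|k x| = k x by rewrite ger0_norm // !addr_ge0.
have psr : p <= s <= r by rewrite ge_min lexx le_max lexx.
have ptr : p <= t <= r by rewrite ge_min lexx orbT le_max lexx orbT.
apply: (linear_system_zero K s K0 psr
  (within_seg e p r (fun x h => der_cont (de x (pos x h))))
  (within_seg g p r (fun x h => der_cont (dg x (pos x h))))
  (fun x h => de x (pos' x h)) (fun x h => dg x (pos' x h)) _ _ es gs t ptr) => x px.
  by apply: bound; rewrite // kE /k lerDl addr_ge0.
by apply: bound; rewrite // kE /k lerDr addr_ge0.
Qed.

(** Linear equations on the half-line of positive times; the substitution
    [t = exp r] makes it the whole line. *)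
Lemma linear_ode_pos (m q : R -> R) (s y0 v0 : R) : 0 < s ->
  (forall t, 0 < t -> {for t, continuous m}) ->
  (forall t, 0 < t -> {for t, continuous q}) ->
  exists y v : R -> R, [/\ y s = y0, v s = v0,
    forall t : R, 0 < t -> is_derive t 1 y (v t) &
    forall t : R, 0 < t -> is_derive t 1 v (- v t - m t * y t + q t)].
Proof.
move=> s0 mc qc.
have ec : continuous (@expR R) by exact: continuous_expR.
have comp (f : R -> R) : (forall t, 0 < t -> {for t, continuous f}) ->
    continuous (fun r => f (expR r)).
  move=> fc r; apply: (@continuous_comp _ _ _ (@expR R) f); first exact: ec.
  exact/fc/expR_gt0.
have mec := comp m mc; have qec := comp q qc.
have [] := @linear_ode R (@expR R) (fun r => - expR r) (fun r => - (expR r * m (expR r)))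
  (fun r => expR r * q (expR r)) ec _ _ _ (ln s) y0 v0.
- by move=> r; apply: cvgN; exact: ec.
- by move=> r; apply: cvgN; apply: cvgM; [exact: ec|exact: mec].
- by move=> r; apply: cvgM; [exact: ec|exact: qec].
move=> y [v [ys vs dy dv]]; exists (y \o @ln R), (v \o @ln R); split => //= t t0.
- apply: (der_eq (der_comp _ y (is_derive1_ln t0) (dy _))).
  by rewrite lnK ?posrE //; field; rewrite gt_eqF.
- apply: (der_eq (der_comp _ v (is_derive1_ln t0) (dv _))).
  by rewrite lnK ?posrE //; field; rewrite gt_eqF.
Qed.

(** Continuation by the initial value to negative times: continuity on the closed
    half-plane becomes continuity on the plane. *)
Definition ext (f : R -> R -> R) (x t : R) : R := f x (Num.max 0 t).

Lemma extE f x t : 0 <= t -> ext f x t = f x t.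
Proof. by move=> t0; rewrite /ext max_r. Qed.

Lemma ext_cont2 f : continuous_closed_halfplane f -> forall x t, cont2 (ext f) x t.
Proof.
move=> fc x t; pose r (p : R * R) := (p.1, Num.max 0 p.2).
have rc : continuous r.
  move=> p; have h1 : (fun q : R * R => q.1) x @[x --> p] --> p.1 by exact: cvg_fst.
  have h2 : Num.max 0 x.2 @[x --> p] --> Num.max 0 p.2.
    by apply: continuous_max; [exact: cvg_cst|exact: cvg_snd].
  exact: (cvg_pair h1 h2).
have rA p : [set p : R * R | 0 <= p.2] (r p) by rewrite /= le_max lexx.
exact: (retract_continuous _ _ _ _ rA rc fc (x, t)).
Qed.

Lemma near_pos (t : R) : 0 < t -> forall s, `|s - t| < t -> 0 < s.
Proof. by move=> t0 s /ltr_normlP[]; lra. Qed.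

Section Solution.
Variables (rho u : R -> R -> R).
Hypotheses (rhoC1 : C1_halfplane rho) (uC1 : C1_halfplane u)
  (rhoC0 : continuous_closed_halfplane rho) (uC0 : continuous_closed_halfplane u)
  (sys : euler_system rho u).

Lemma C1_der (f : R -> R -> R) : C1_halfplane f -> forall x t : R, 0 < t ->
  [/\ is_derive x 1 (fun y => f y t) (dx f x t), is_derive t 1 (f x) (dt f x t),
      cont2 (dx f) x t & cont2 (dt f) x t].
Proof.
move=> fC x t t0; have [d1 d2 c1 c2] := fC x t t0.
by split; [exact: derivable_der d1|exact: derivable_der d2|exact: c1|exact: c2].
Qed.

Let rp := ext rho.
Let up := ext u.
Let rpc x t : cont2 rp x t. Proof. exact: ext_cont2. Qed.
Let upc x t : cont2 up x t. Proof. exact: ext_cont2. Qed.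

Let rp_slice t : continuous (fun y => rp y t). Proof. exact: cont2_slice. Qed.

Lemma C1_cont2 (f : R -> R -> R) x t : continuous_closed_halfplane f -> 0 < t -> cont2 f x t.
Proof.
move=> fc t0; apply: (cont2_near (ext f) _ _ _ t t0) (ext_cont2 f fc x t).
by move=> y s _ /(near_pos t t0)/ltW; exact: extE.
Qed.

(** The mass between the origin and a moving particle varies only through what
    crosses the origin; subtracting the accumulated flux there gives a quantity
    which is transported by the velocity field. *)
Definition cumul x t := prim (fun y => rp y t) x.
Definition flux0 t := rp 0 t * up 0 t.
Definition lagmass x t := cumul x t - prim flux0 t.

Lemma flux0_cont : continuous flux0.
Proof.
move=> t; apply: cvgM.
  by apply: (cont2_curve rp (fun=> 0) (fun y => y)) => //; exact: cvg_cst.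
by apply: (cont2_curve up (fun=> 0) (fun y => y)) => //; exact: cvg_cst.
Qed.

Lemma cumul_cont2 x t : cont2 cumul x t.
Proof. exact: (cont2_prim rp). Qed.

Lemma lagmass_cont2 x t : cont2 lagmass x t.
Proof.
apply: cont2D; first exact: cumul_cont2.
apply: cont2N; apply: (cont2_2 (prim flux0)); exact: prim_cont flux0_cont t.
Qed.

Lemma der_cumul_x (x t : R) : is_derive x 1 (fun y => cumul y t) (rp x t).
Proof. exact: (der_prim (fun y => rp y t) x (rp_slice t)). Qed.

Lemma cumul0 t : cumul 0 t = 0.
Proof. exact: (prim0 (fun y => rp y t) (rp_slice t)). Qed.

Lemma der_cumul_t (x t : R) : 0 < t ->
  is_derive t 1 (cumul x) (flux0 t - rho x t * u x t).
Proof.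
move=> t0.
have rtc y : cont2 (dt rho) y t by have [] := C1_der rho rhoC1 y t t0.
have Hd (y s : R) : `|s - t| < t -> is_derive s 1 (rp y) (dt rho y s).
  move=> /(near_pos t t0) s0; have [_ d _ _] := C1_der rho rhoC1 y s s0.
  by apply: (der_pos s0 _ d) => r /ltW r0; rewrite /rp extE.
apply: (der_eq (der_prim_param rp (dt rho) x t t t0 (fun s _ => rp_slice s) Hd rtc)).
have rtc1 : continuous (fun y => dt rho y t).
  exact: cont2_slice.
have dru (y : R) : is_derive y 1 (fun z => - (rho z t * u z t)) (dt rho y t).
  have [d1 _ _ _] := C1_der rho rhoC1 y t t0.
  have [d2 _ _ _] := C1_der u uC1 y t t0.
  have d := derM d1 d2.
  apply: (der_eq (derN d)).
  have [_ + _] := sys y t t0; rewrite /dx (der_derive1 d) /=.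
  by move=> /eqP; rewrite addr_eq0 => /eqP ->.
have := der_diff_eqT 0 x (fun y => der_prim _ y rtc1) dru.
rewrite prim0 // /flux0 /rp /up !extE ?ltW //.
by move=> e; rewrite -[LHS]subr0 e; ring.
Qed.

(** At each time integrability of the kernel gives a finite mass and a finite first
    moment, hence the shape of the force; nothing is said on how [M], [N] and [l]
    depend on time. *)
Lemma force_at t : 0 < t -> exists M N l : R,
  [/\ forall x, dt u x t + u x t * dx u x t + u x t = 2 * cumul x t - M * x + N,
      cumul x t @[x --> -oo] --> l & cumul x t @[x --> +oo] --> l + M].
Proof.
move=> t0; have rc := rp_slice t.
have e : (fun y => rho y t) = (fun y => rp y t).
  by apply/funext => y; rewrite /rp extE ?ltW.
have eK x : dW_kernel rho x t = (fun y => dW (x - y) * rp y t).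
  by apply/funext => y; rewrite /dW_kernel /rp extE ?ltW.
have [M [w [hM hw]]] : exists v w, has_int (fun y => rp y t) v /\
    has_int (fun y => y * rp y t) w.
  apply: dW_integrable => // x; have [+ _ _] := sys x t t0.
  by rewrite eK.
have [l [lN lP lI]] := improper_integral rc hM (fun x => der_cumul_x x t).
exists M, (w - M - 2 * l), l; split => // x.
have [_ _ ->] := sys x t t0; rewrite /dW_conv eK.
have [_ ->] := has_int_dW _ x _ _ hM hw.
by rewrite lI; ring.
Qed.

Definition is_force (M N l : R -> R) := forall t, 0 < t ->
  [/\ forall x, dt u x t + u x t * dx u x t + u x t = 2 * cumul x t - M t * x + N t,
      cumul x t @[x --> -oo] --> l t & cumul x t @[x --> +oo] --> l t + M t].

Lemma force_exists : exists M N l, is_force M N l.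
Proof.
have /choice[f hf] : forall t, exists p : R * R * R, 0 < t ->
  [/\ forall x, dt u x t + u x t * dx u x t + u x t = 2 * cumul x t - p.1.1 * x + p.1.2,
      cumul x t @[x --> -oo] --> p.2 & cumul x t @[x --> +oo] --> p.2 + p.1.1].
  move=> t; case: (ltP 0 t) => [/force_at[M [N [l h]]]|_]; last by exists (0, 0, 0).
  by exists (M, N, l).
by exists (fun t => (f t).1.1), (fun t => (f t).1.2), (fun t => (f t).2).
Qed.

Section Force.
Variables (M N l : R -> R).
Hypothesis force : is_force M N l.

Let acc x t := dt u x t + u x t * dx u x t + u x t.

Let acc_cont x t : 0 < t -> {for t, continuous (acc x)}.
Proof.
move=> t0; have [_ _ c1 c2] := C1_der u uC1 x t t0.
have c3 := C1_cont2 u x t uC0 t0.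
have along (f : R -> R -> R) : cont2 f x t -> {for t, continuous (f x)}.
  by move=> fc; apply: (cont2_curve f (fun=> x) (fun y => y)) => //; exact: cvg_cst.
have k1 := along _ c1; have k2 := along _ c2; have k3 := along _ c3.
by apply: cvgD => //; apply: cvgD => //; apply: cvgM.
Qed.

(** Continuity in time of the coefficients of the force is read off from the left
    hand side of the velocity equation, at the points [0] and [1]. *)
Lemma N_cont t : 0 < t -> {for t, continuous N}.
Proof.
move=> t0; have := acc_cont 0 t t0.
move=> /contP h; apply/contP => e /h[d d0 hd].
exists (Num.min d t) => [|s]; first by rewrite lt_min d0.
rewrite lt_min => /andP[/hd + /(near_pos t t0) s0].
have [+ _ _] := force s s0; have [+ _ _] := force t t0.
by rewrite /acc => -> ->; rewrite !cumul0 !mulr0 !subr0 !add0r.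
Qed.

Lemma M_cont t : 0 < t -> {for t, continuous M}.
Proof.
move=> t0; pose f s := 2 * cumul 1 s + N s - acc 1 s.
have fc : {for t, continuous f}.
  apply: cvgB; last exact: acc_cont.
  apply: cvgD; last exact: N_cont.
  apply: cvgM; first exact: cvg_cst.
  by apply: (cont2_curve cumul (fun=> 1) (fun y => y)) => //; [exact: cumul_cont2|exact: cvg_cst].
move/contP: fc => h; apply/contP => e /h[d d0 hd].
exists (Num.min d t) => [|s]; first by rewrite lt_min d0.
rewrite lt_min => /andP[/hd + /(near_pos t t0) s0].
have [e1 _ _] := force s s0; have [e2 _ _] := force t t0.
by rewrite /f /acc e1 e2 !mulr1; congr (_ < _); congr `|_|; ring.
Qed.

(** The construction yields the velocity equation and the conservation of [lagmass]
    together with the curve, and it is through them that two characteristics are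
    compared. *)
Definition is_char (X : R -> R) := forall t : R, 0 < t ->
  [/\ is_derive t 1 X (u (X t) t),
      is_derive t 1 (fun r => u (X r) r)
        (- u (X t) t - M t * X t + (2 * cumul (X t) t + N t))
    & lagmass (X t) t = lagmass (X 1) 1].

(** The equation of characteristics is nonlinear, but freezing the lagmass at its
    initial value turns it into a linear equation, which is solvable globally.
    The errors made on velocity and lagmass then satisfy a homogeneous linear
    system. *)
Lemma char_exists s x : 0 < s -> exists2 X, is_char X & X s = x.
Proof.
move=> s0; pose c := lagmass x s.
pose q t := 2 * (c + prim flux0 t) + N t.
have Jd (t : R) : is_derive t 1 (prim flux0) (flux0 t) by exact: der_prim flux0_cont.
have qc (t : R) : 0 < t -> {for t, continuous q}.
  move=> t0; apply: cvgD; last exact: N_cont.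
  apply: cvgM; first exact: cvg_cst.
  by apply: cvgD; [exact: cvg_cst|exact: der_cont (Jd t)].
have [Y [V [Ys Vs dY dV]]] := linear_ode_pos M q s x (u x s) s0 M_cont qc.
pose e t := u (Y t) t - V t.
pose g t := lagmass (Y t) t - c.
have du (t : R) : 0 < t -> is_derive t 1 (fun r => u (Y r) r)
    (dx u (Y t) t * V t + dt u (Y t) t).
  move=> t0; have [_ d2 c1 _] := C1_der u uC1 (Y t) t t0.
  apply: (der_along u (dx u) Y t (V t) _ t t0 _ c1 (dY t t0) d2).
  by move=> y r _ /(near_pos t t0) r0; have [] := C1_der u uC1 y r r0.
have dcu (t : R) : 0 < t -> is_derive t 1 (fun r => lagmass (Y r) r)
    (rho (Y t) t * V t + (flux0 t - rho (Y t) t * u (Y t) t) - flux0 t).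
  move=> t0; apply: derB (Jd t).
  have -> : rho (Y t) t = rp (Y t) t by rewrite /rp extE ?ltW.
  apply: (der_along cumul rp Y t (V t) _ t t0 _ (rpc _ _) (dY t t0)).
    by move=> y r _ _; exact: der_cumul_x.
  by rewrite /rp extE ?ltW //; exact: der_cumul_t.
have de (t : R) : 0 < t -> is_derive t 1 e (- (dx u (Y t) t + 1) * e t + 2 * g t).
  move=> t0; apply: (der_eq (derB (du t t0) (dV t t0))).
  have [/(_ (Y t)) H _ _] := force t t0.
  have -> : dt u (Y t) t = 2 * cumul (Y t) t - M t * Y t + N t
      - u (Y t) t * dx u (Y t) t - u (Y t) t by rewrite -H; ring.
  by rewrite /e /g /q /lagmass; ring.
have dg (t : R) : 0 < t -> is_derive t 1 g (- rho (Y t) t * e t + 0 * g t).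
  by move=> t0; apply: (der_eq (derB (dcu t t0) (derC c t))); rewrite /e; ring.
have zero : forall t, 0 < t -> e t = 0 /\ g t = 0.
  apply: (linear_system_zero_pos e g (fun t => - (dx u (Y t) t + 1)) (fun=> 2)
    (fun t => - rho (Y t) t) (fun=> 0) s s0 _ de dg).
  - move=> t t0; have [_ _ c1 _] := C1_der u uC1 (Y t) t t0.
    have Yc := der_cont (dY t t0).
    split; [|exact: cvg_cst| |exact: cvg_cst]; apply: cvgN.
      by apply: cvgD; [exact: (cont2_curve (dx u) Y (fun y => y))|exact: cvg_cst].
    by apply: (cont2_curve rho Y (fun y => y)) => //; exact: C1_cont2.
  - by rewrite /e Ys Vs subrr.
  - by rewrite /g Ys subrr.
have eV (t : R) : 0 < t -> V t = u (Y t) t by move=> /zero[]; rewrite /e; lra.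
have eg (t : R) : 0 < t -> lagmass (Y t) t = c by move=> /zero[_]; rewrite /g; lra.
exists Y => // t t0; split.
- by apply: (der_eq (dY t t0)); exact: eV.
- apply: (der_pos t0 eV (der_eq (dV t t0) _)).
  by rewrite eV // /q -(eg t t0) /lagmass; ring.
- by rewrite !eg.
Qed.

(** Two characteristics through the same point carry the same [lagmass], so that
    their difference solves a homogeneous linear equation. *)
Lemma char_unique X Y s : is_char X -> is_char Y -> 0 < s -> X s = Y s ->
  forall t, 0 < t -> X t = Y t.
Proof.
move=> cX cY s0 XYs t t0.
have chXY (r : R) : 0 < r -> cumul (X r) r = cumul (Y r) r.
  have [_ _ q1] := cX s s0; have [_ _ q2] := cY s s0.
  move=> r0; have [_ _ q3] := cX r r0; have [_ _ q4] := cY r r0.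
  have : lagmass (X r) r = lagmass (Y r) r by rewrite q3 q4 -q1 -q2 XYs.
  by rewrite /lagmass; lra.
pose D r := X r - Y r; pose V r := u (X r) r - u (Y r) r.
have dD (r : R) : 0 < r -> is_derive r 1 D (0 * D r + 1 * V r).
  move=> r0; have [d1 _ _] := cX r r0; have [d2 _ _] := cY r r0.
  by apply: (der_eq (derB d1 d2)); rewrite mul0r mul1r add0r.
have dV (r : R) : 0 < r -> is_derive r 1 V (- M r * D r + - 1 * V r).
  move=> r0; have [_ d1 _] := cX r r0; have [_ d2 _] := cY r r0.
  apply: (der_eq (derB d1 d2)); rewrite chXY // /V /D; ring.
have [] := linear_system_zero_pos D V (fun=> 0) (fun=> 1) (fun r => - M r)
  (fun=> - 1) s s0 _ dD dV _ _ t t0.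
- by move=> r /M_cont Mc; split; [exact: cvg_cst|exact: cvg_cst|exact: cvgN|exact: cvg_cst].
- by rewrite /D XYs subrr.
- by rewrite /V XYs subrr.
by rewrite /D; lra.
Qed.

Lemma char_order X Y s t : is_char X -> is_char Y -> 0 < s -> 0 < t ->
  X s < Y s -> X t < Y t.
Proof.
move=> cX cY s0 t0 XY; rewrite ltNge; apply/negP => YX.
pose D r := Y r - X r.
have Dc (r : R) : 0 < r -> {for r, continuous D}.
  move=> r0; have [d1 _ _] := cX r r0; have [d2 _ _] := cY r r0.
  exact: der_cont (derB d2 d1).
pose p := Num.min s t; pose q := Num.max s t.
have p0 : 0 < p by rewrite lt_min s0.
have pq : p <= q by rewrite le_max ge_min lexx.
have Dw : {within `[p, q], continuous D}.
  by apply: within_seg => x /andP[+ _] => /(lt_le_trans p0); exact: Dc.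
have [|c] := IVT pq Dw (v := 0).
  have h1 : 0 < D s by rewrite /D; lra.
  have h2 : D t <= 0 by rewrite /D; lra.
  rewrite /p /q; have [st|ts] := leP s t.
    by rewrite ge_min le_max h2 (ltW h1) orbT.
  by rewrite ge_min le_max h2 (ltW h1) orbT.
rewrite in_itv /= => /andP[pc _] Dc0.
have c0 : 0 < c by exact: lt_le_trans pc.
have e : X c = Y c by move: Dc0; rewrite /D; lra.
by move: XY; rewrite (char_unique X Y c cX cY c0 e s s0) ltxx.
Qed.
End Force.
End Solution.
End PositiveTimes.

(** * Characteristics issued from the initial time *)

(** The flow of a solution, labelled by initial positions: it covers the line at
    every time, and up to a time-dependent translation it is explicit. *)
Definition is_flow {R : realType} (rho u : R -> R -> R) (rho0 u0 a b h : R -> R)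
    (X : R -> R -> R) : Prop :=
  [/\ [/\ forall x, X x 0 = x, forall x, continuous (X x) &
          forall x t, 0 < t -> exists y, X y t = x],
      forall x (t : R), 0 < t -> is_derive t 1 (X x) (u (X x t) t) /\
        is_derive t 1 (fun r => ext u (X x r) r)
          (- u (X x t) t - dW_conv rho (X x t) t),
      forall x t, 0 <= t -> X x t = X 0 t + (a t * x + b t * (u0 x - u0 0) +
         h t * (2 * prim rho0 x)) &
      forall x t, 0 <= t -> cumul rho (X x t) t = cumul rho (X 0 t) t + prim rho0 x].

Section InitialTime.
Context {R : realType}.
Implicit Types (r s t x y z : R).

(** The intervals of centre [f t] and radius [K * t] intersect each other, so they
    have a common point. *)
Lemma lipschitz_limit (f : R -> R) (d K : R) : 0 < d ->
  (forall s t, 0 < s < d -> 0 < t < d -> `|f s - f t| <= K * (s + t)) ->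
  exists l, forall t, 0 < t < d -> `|f t - l| <= K * t.
Proof.
move=> d0 fK; pose S := [set f t - K * t | t in [set t | 0 < t < d]].
have d2 : 0 < d / 2 < d by apply/andP; split; lra.
have ub s : 0 < s < d -> ubound S (f s + K * s).
  by move=> sd _ [t td <-]; have /ler_normlP[] := fK s t sd td; lra.
exists (sup S) => t td; apply/ler_normlP.
have h1 : sup S <= f t + K * t.
  by apply: sup_le_ub; [exists (f (d / 2) - K * (d / 2)), (d / 2)|exact: ub].
have h2 : f t - K * t <= sup S.
  by apply: ub_le_sup; [exists (f (d / 2) + K * (d / 2)); exact: ub|exists t].
by split; lra.
Qed.

Lemma right_value (f : R -> R) (c : R) : {for 0, continuous f} ->
  (forall t, 0 < t -> f t = c) -> f 0 = c.
Proof.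
move=> /contP fc fE; apply/eqP; rewrite -subr_eq0 -normr_eq0 eq_le normr_ge0 andbT.
rewrite leNgt; apply/negP => h.
have [d d0 hd] := fc _ h.
have d2 : 0 < d / 2 by lra.
have := hd (d / 2); rewrite fE // subr0 (ger0_norm (ltW d2)) distrC ltxx.
by move=> /(_ ltac:(lra)).
Qed.

Lemma cvgy_eps (f : R -> R) (l : R) : f x @[x --> +oo] --> l ->
  forall e, 0 < e -> exists A, forall x, A < x -> `|f x - l| < e.
Proof.
move=> /cvgrPdist_lt h e /h[A [_ hA]]; exists A => x /hA.
by rewrite /= distrC.
Qed.

Lemma cvgNy_eps (f : R -> R) (l : R) : f x @[x --> -oo] --> l ->
  forall e, 0 < e -> exists A, forall x, x < A -> `|f x - l| < e.
Proof.
move=> /cvgrPdist_lt h e /h[A [_ hA]]; exists A => x /hA.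
by rewrite /= distrC.
Qed.

Lemma cvgy_unique {f : R -> R} {k l : R} :
  f x @[x --> +oo] --> k -> f x @[x --> +oo] --> l -> k = l.
Proof. by move=> h1 h2; apply: (cvg_unique _ h1 h2). Qed.

Lemma cvgNy_unique {f : R -> R} {k l : R} :
  f x @[x --> -oo] --> k -> f x @[x --> -oo] --> l -> k = l.
Proof. by move=> h1 h2; apply: (cvg_unique _ h1 h2). Qed.

Lemma surj_cvgy (f : R -> R) : (forall x y, x <= y -> f x <= f y) ->
  (forall y, exists x, f x = y) -> f x @[x --> +oo] --> +oo.
Proof.
move=> fm fs; apply/cvgryPge => A; have [x0 fx] := fs A.
exists x0; split => [|x /= /ltW /fm]; first exact: num_real.
by rewrite fx.
Qed.

Lemma surj_cvgNy (f : R -> R) : (forall x y, x <= y -> f x <= f y) ->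
  (forall y, exists x, f x = y) -> f x @[x --> -oo] --> -oo.
Proof.
move=> fm fs; apply/cvgrNyPle => A; have [x0 fx] := fs A.
exists x0; split => [|x /= /ltW /fm]; first exact: num_real.
by rewrite fx.
Qed.

Variables (rho u : R -> R -> R) (rho0 u0 : R -> R).
Hypotheses (rhoC1 : C1_halfplane rho) (uC1 : C1_halfplane u)
  (rhoC0 : continuous_closed_halfplane rho) (uC0 : continuous_closed_halfplane u)
  (sys : euler_system rho u)
  (init : forall x, rho x 0 = rho0 x /\ u x 0 = u0 x)
  (rho0_cont : continuous rho0) (rho0_gt0 : forall x, 0 < rho0 x).
Variable M0 : R.
Hypothesis rho0_int : has_int rho0 M0.
Variables (M N l : R -> R).
Hypothesis force : is_force rho u M N l.

Local Notation cum := (cumul rho).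
Local Notation lag := (lagmass rho u).
Local Notation is_char := (is_char rho u M N).

Let lagmass_c x t : cont2 lag x t := lagmass_cont2 rho u rhoC0 uC0 x t.
Let cumul_c x t : cont2 cum x t := cumul_cont2 rho rhoC0 x t.

Let labels : exists X : R -> R -> R, forall x, is_char (X x) /\ X x 1 = x.
Proof.
pose P (x : R) (Y : R -> R) := is_char Y /\ Y 1 = x.
suff /choice[X hX] : forall x, exists Y, P x Y by exists X.
move=> x.
have [Y cY Y1] := char_exists rho u rhoC1 uC1 rhoC0 uC0 sys M N l force 1 x ltr01.
by exists Y.
Qed.

Let X : R -> R -> R := projT1 (cid labels).
Let Xchar x : is_char (X x). Proof. by have [] := projT2 (cid labels) x. Qed.
Let X1 x : X x 1 = x. Proof. by have [] := projT2 (cid labels) x. Qed.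

Let Xlt t x y : 0 < t -> x < y -> X x t < X y t.
Proof.
move=> t0 xy.
by apply: (char_order rho u uC1 rhoC0 uC0 M N l force _ _ 1 t (Xchar x) (Xchar y) ltr01 t0); rewrite !X1.
Qed.

Let Xle t x y : 0 < t -> x <= y -> X x t <= X y t.
Proof. by move=> t0; rewrite le_eqVlt => /predU1P[->//|/(Xlt t _ _ t0)/ltW]. Qed.

Let Xle_inv t x y : 0 < t -> X x t <= X y t -> x <= y.
Proof. by move=> t0; rewrite !leNgt; apply: contra; exact: Xlt. Qed.

Let Xsurj t x : 0 < t -> exists y, X y t = x.
Proof.
move=> t0.
have [Y cY Yt] := char_exists rho u rhoC1 uC1 rhoC0 uC0 sys M N l force t x t0.
exists (Y 1); rewrite -Yt.
by apply: (char_unique rho u uC1 rhoC0 uC0 M N l force _ _ 1 (Xchar (Y 1)) cY ltr01 _ t t0); rewrite X1.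
Qed.

Let Xlag x t : 0 < t -> lag (X x t) t = lag x 1.
Proof. by move=> t0; have [_ _ ->] := Xchar x t t0; rewrite X1. Qed.

Let Xcumul x y t : 0 < t ->
  cum (X x t) t - cum (X y t) t = cum x 1 - cum y 1.
Proof.
move=> t0; have := Xlag x t t0; have := Xlag y t t0.
by rewrite /lagmass; lra.
Qed.

Let lag_lim t : 0 < t ->
  lag x t @[x --> -oo] --> l t - prim (flux0 rho u) t /\
  lag x t @[x --> +oo] --> l t + M t - prim (flux0 rho u) t.
Proof.
move=> t0; have [_ lN lP] := force t t0.
by split; apply: cvgB => //; exact: cvg_cst.
Qed.

(** The flow between two times is a nondecreasing surjection of the line, so it
    respects both ends, and there the transported quantity [lagmass] has limits
    which differ by the total mass. *)
Lemma mass_constant t : 0 < t -> M t = M 1.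
Proof.
move=> t0; have [aN aP] := lag_lim t t0; have [bN bP] := lag_lim 1 ltr01.
have Xm x y : x <= y -> X x t <= X y t by exact: Xle.
have Xs y : exists x, X x t = y by exact: Xsurj.
have e : (fun x => lag x 1) = (fun x => lag x t) \o (fun x => X x t).
  by apply/funext => x /=; rewrite Xlag.
have cP : lag x 1 @[x --> +oo] --> l t + M t - prim (flux0 rho u) t.
  by rewrite e; apply: cvg_comp aP; exact: surj_cvgy.
have cN : lag x 1 @[x --> -oo] --> l t - prim (flux0 rho u) t.
  by rewrite e; apply: cvg_comp aN; exact: surj_cvgNy.
pose J := prim (flux0 rho u).
have e1 : l 1 + M 1 - J 1 = l t + M t - J t := cvgy_unique bP cP.
have e2 : l 1 - J 1 = l t - J t := cvgNy_unique bN cN.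
by lra.
Qed.

Let Xder t x : 0 < t -> is_derive t 1 (X x) (u (X x t) t).
Proof. by move=> t0; have [] := Xchar x t t0. Qed.

Let Uder t x : 0 < t -> is_derive t 1 (fun r => u (X x r) r)
  (- u (X x t) t - M 1 * X x t + (2 * cum (X x t) t + N t)).
Proof. by move=> t0; have [_ + _] := Xchar x t t0; rewrite mass_constant. Qed.

Let diff_der x y t : 0 < t ->
  is_derive t 1 (fun r => X x r - X y r) (u (X x t) t - u (X y t) t) /\
  is_derive t 1 (fun r => u (X x r) r - u (X y r) r)
    (- (u (X x t) t - u (X y t) t) - M 1 * (X x t - X y t)
     + 2 * (cum x 1 - cum y 1)).
Proof.
move=> t0; split; first exact: (derB (Xder t x t0) (Xder t y t0)).
apply: (der_eq (derB (Uder t x t0) (Uder t y t0))).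
by rewrite -(Xcumul x y t t0); ring.
Qed.

Section Fundamental.
Variables a b h : R -> R.
Hypothesis F : fund (M 1) a b h.

Let Z x t := a (t - 1) * x + b (t - 1) * (u x 1 - u 0 1) + h (t - 1) * (2 * cum x 1).

Let XZ x t : 0 < t -> X x t = X 0 t + Z x t.
Proof.
move=> t0; pose p := Num.min 1 t; pose q := Num.max 1 t.
have p0 : 0 < p by rewrite lt_min ltr01.
have pos r : p <= r <= q -> 0 < r by move=> /andP[+ _]; exact: lt_le_trans.
have pos' r : p < r < q -> 0 < r by move=> /andP[+ _]; exact: lt_trans.
have p1q : p <= 1 <= q by rewrite ge_min lexx le_max lexx.
have ptq : p <= t <= q by rewrite ge_min lexx orbT le_max lexx orbT.
have Dc := within_seg (fun r => X x r - X 0 r) p q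
  (fun r hr => der_cont (diff_der x 0 r (pos r hr)).1).
have Vc := within_seg (fun r => u (X x r) r - u (X 0 r) r) p q
  (fun r hr => der_cont (diff_der x 0 r (pos r hr)).2).
have [+ _] := fund_solve (M 1) a b h (fun r => X x r - X 0 r) (fun r => u (X x r) r - u (X 0 r) r) _ p q 1 F p1q Dc Vc
  (fun r hr => (diff_der x 0 r (pos' r hr)).1)
  (fun r hr => (diff_der x 0 r (pos' r hr)).2) t ptq.
rewrite !X1 (cumul0 rho rhoC0) !subr0 /Z; lra.
Qed.

Let Z_cont2 x t : cont2 Z x t.
Proof.
have sh (f : R -> R) : continuous f -> cont2 (fun _ r : R => f (r - 1)) x t.
  move=> fc; apply: (cont2_2 (fun r => f (r - 1))).
  apply: (@continuous_comp _ _ _ (fun r => r - 1) f); last exact: fc.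
  by apply: cvgB; [exact: cvg_id|exact: cvg_cst].
have uc : {for x, continuous (fun y => u y 1)}.
  apply: (cont2_curve u (fun y => y) (fun=> 1)) => //; last exact: cvg_cst.
  exact: C1_cont2.
have cc : {for x, continuous (fun y => cum y 1)}.
  by apply: (cont2_curve cum (fun y => y) (fun=> 1)) => //; exact: cvg_cst.
apply: cont2D.
  apply: cont2D; apply: cont2M.
  - exact: sh (cont_a F).
  - by apply: (cont2_1 (fun y => y)); exact: cvg_id.
  - exact: sh (cont_b F).
  - by apply: (cont2_1 (fun y => u y 1 - u 0 1)); apply: cvgB => //; exact: cvg_cst.
apply: cont2M; first exact: sh (cont_h F).
by apply: (cont2_1 (fun y => 2 * cum y 1)); apply: cvgM => //; exact: cvg_cst.
Qed.

Let cumul_at0 x : cum x 0 = prim rho0 x.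
Proof.
rewrite /cumul; congr (prim _ x); apply/funext => y.
by rewrite extE //; have [] := init y.
Qed.

Let primd (x : R) : is_derive x 1 (prim rho0) (rho0 x).
Proof. exact: der_prim. Qed.

Let prim_lt x y : x < y -> prim rho0 x < prim rho0 y.
Proof. by move=> xy; apply: (der_lt xy primd). Qed.

(** No mass is lost or gained at the initial time: the mass between [z1] and
    [z2] stays bounded below, so at small times these points are separated by a
    characteristic with a label in a fixed bounded set. *)
Let bounded_labels z1 z2 : z1 < z2 -> exists A d, 0 < d /\
  forall t, 0 < t < d -> exists x, `|x| <= A /\ z1 <= X x t <= z2.
Proof.
move=> z12; pose P := (prim rho0 z2 - prim rho0 z1) / 4.
have P0 : 0 < P by rewrite /P; have := prim_lt _ _ z12; lra.
have [_ cN cP] := force 1 ltr01.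
have [A1 h1] := cvgy_eps _ _ cP P P0; have [A2 h2] := cvgNy_eps _ _ cN P P0.
pose A := Num.max 0 (Num.max A1 (- A2)).
have [A0 AA1 AA2] : [/\ 0 <= A, A1 <= A & - A2 <= A].
  by rewrite !le_max !lexx /= !orbT.
have [d1 d10 k1] := (cont2P _ _ _).1 (cumul_c z1 0) P P0.
have [d2 d20 k2] := (cont2P _ _ _).1 (cumul_c z2 0) P P0.
exists A, (Num.min d1 d2); rewrite lt_min d10; split => // t.
rewrite lt_min => /and3P[t0 td1 td2].
have [x1 e1] := Xsurj t z1 t0; have [x2 e2] := Xsurj t z2 t0.
have x12 : x1 <= x2 by apply: (Xle_inv t) => //; rewrite e1 e2 ltW.
have := k1 z1 t; have := k2 z2 t; rewrite !subrr !normr0 !subr0 gtr0_norm //.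
move=> /(_ d20 td2)/ltr_normlP[m1 m2] /(_ d10 td1)/ltr_normlP[m3 m4].
have big : 2 * P < cum x2 1 - cum x1 1.
  rewrite -(Xcumul x2 x1 t t0) e1 e2; move: m1 m2 m3 m4; rewrite !cumul_at0 /P; lra.
have n1 : x1 <= A.
  rewrite leNgt; apply/negP => Ax1.
  have /ltr_normlP[? ?] := h1 x1 (le_lt_trans AA1 Ax1).
  have /ltr_normlP[? ?] := h1 x2 (le_lt_trans AA1 (lt_le_trans Ax1 x12)).
  lra.
have n2 : - A <= x2.
  rewrite leNgt; apply/negP => Ax2.
  have /ltr_normlP[? ?] := h2 x2 ltac:(lra).
  have /ltr_normlP[? ?] := h2 x1 ltac:(lra).
  lra.
have ok x : x1 <= x <= x2 -> - A <= x <= A -> exists y, `|y| <= A /\ z1 <= X y t <= z2.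
  move=> /andP[xa xb] xA; exists x; rewrite ler_norml xA -e1 -e2; split => //.
  by rewrite !Xle.
have [a1|a1] := leP (- A) x1; first by apply: (ok x1); [rewrite lexx|apply/andP].
have [a2|a2] := leP x2 A; first by apply: (ok x2); [rewrite x12 lexx|apply/andP].
by apply: (ok 0); apply/andP; split; lra.
Qed.

(** One characteristic with bounded label and position is enough, since the others
    differ from it by the explicit function [Z], which is bounded on compact sets
    up to the initial time. *)
Let bounded_flow : exists d, 0 < d < 1 /\ forall A, 0 <= A -> exists2 K, 0 <= K &
  forall x t, `|x| <= A -> 0 < t < d -> `|X x t| <= K /\ `|u (X x t) t| <= K.
Proof.
have diffb A : exists2 C, 0 <= C & forall x t, `|x| <= A -> 0 <= t <= 1 -> `|Z x t| <= C.
  have [C C0 hC] := cont2_bounded Z (- A) A 0 1 (fun x t _ _ => Z_cont2 x t).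
  by exists C => // x t; rewrite ler_norml => xA t1; exact: hC.
have [A1 [d1 [d10 hd1]]] := bounded_labels 0 1 ltr01.
have [C1 C10 hC1] := diffb A1.
exists (Num.min d1 (1 / 2)); split.
  rewrite lt_min d10 gt_min; apply/andP; split; first by rewrite /= divr_gt0.
  by apply/orP; right; lra.
move=> A A0; have [C2 C20 hC2] := diffb A.
pose B := 1 + C1 + C2.
have [K K0 hK] := cont2_bounded (ext u) (- B) B 0 1 (fun x t _ _ => ext_cont2 u uC0 x t).
exists (B + K) => [|x t xA /andP[t0]]; first by rewrite /B !addr_ge0.
rewrite lt_min => /andP[td t12].
have t1 : 0 <= t <= 1 by rewrite ltW //=; lra.
have [y [yA /andP[y0 y1]]] := hd1 t ltac:(by rewrite t0).
have /ler_normlP[b1 b2] := hC1 y t yA t1; have /ler_normlP[b3 b4] := hC2 x t xA t1.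
have e1 := XZ y t t0; have e2 := XZ x t t0.
have XB : - B <= X x t <= B by rewrite /B; apply/andP; split; lra.
split; first by have : `|X x t| <= B by [rewrite ler_norml]; lra.
have := hK (X x t) t XB t1; rewrite (extE _ _ _ (ltW t0)) => k.
have : 0 <= B by rewrite /B !addr_ge0.
lra.
Qed.

(** Bounded velocities make characteristics Lipschitz near the initial time; [Phi]
    maps labels, which are positions at time [1], to initial positions. *)
Let start : exists Phi : R -> R, exists2 d, 0 < d < 1 & forall A, 0 <= A ->
  exists2 K, 0 <= K & forall x t, `|x| <= A -> 0 < t < d -> `|X x t - Phi x| <= K * t.
Proof.
have [d [/andP[d0 d1] hd]] := bounded_flow.
have lip A : 0 <= A -> exists2 K, 0 <= K & forall x s t, `|x| <= A ->
    0 < s < d -> 0 < t < d -> `|X x s - X x t| <= K * (s + t).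
  move=> A0; have [K K0 hK] := hd A A0; exists K => // x s t xA.
  wlog st : s t / s <= t.
    move=> H sd td; case: (leP s t) => [st|ts]; first exact: (H s t st sd td).
    by rewrite distrC (addrC s); exact: (H t s (ltW ts) td sd).
  move=> /andP[s0 sd] /andP[t0 td].
  have pos r : s <= r <= t -> 0 < r < d by move=> /andP[? ?]; lra.
  have up : X x t - X x s <= K * t - K * s.
    apply: (der_le_closed st (fun r hr => Xder r x _) (fun r _ => derZI K r)) => r hr.
      by have /andP[] := pos r hr.
    by have [_ /ler_normlP[]] := hK x r xA (pos r hr).
  have dn : - K * t - - K * s <= X x t - X x s.
    apply: (der_le_closed st (fun r _ => derZI (- K) r) (fun r hr => Xder r x _)) => r hr.
      by have /andP[] := pos r hr.
    by have [_ /ler_normlP[]] := hK x r xA (pos r hr); lra.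
  have := mulr_ge0 K0 (ltW s0); have := mulr_ge0 K0 (ltW t0).
  by move=> ? ?; apply/ler_normlP; split; lra.
have lim x : exists L, forall K, 0 <= K -> (forall s t, 0 < s < d -> 0 < t < d ->
     `|X x s - X x t| <= K * (s + t)) -> forall t, 0 < t < d -> `|X x t - L| <= K * t.
  have [K1 K10 h1] := lip `|x| (normr_ge0 x).
  have [L hL] := lipschitz_limit (X x) d K1 d0 (fun s t => h1 x s t (lexx _)).
  exists L => K K0 hK t td.
  have [L' hL'] := lipschitz_limit (X x) d K d0 hK.
  suff -> : L = L' by exact: hL'.
  apply/eqP; rewrite -subr_eq0 -normr_eq0 eq_le normr_ge0 andbT leNgt; apply/negP => n0.
  pose r := Num.min (d / 2) (`|L - L'| / (2 * (K + K1 + 1))).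
  have k0 : 0 < 2 * (K + K1 + 1) by lra.
  have r0 : 0 < r by rewrite lt_min !divr_gt0.
  have rd : r < d by rewrite gt_min; apply/orP; left; lra.
  have r1 : r <= `|L - L'| / (2 * (K + K1 + 1)) by rewrite ge_min lexx orbT.
  have b1 := hL r ltac:(by rewrite r0); have b2 := hL' r ltac:(by rewrite r0).
  have b3 : `|L - L'| <= `|X x r - L'| + `|X x r - L|.
    by have := ler_normB (X x r - L') (X x r - L); congr (`|_| <= _); ring.
  move: r1; rewrite ler_pdivlMr // => r1.
  have := mulr_ge0 K0 (ltW r0); have := mulr_ge0 K10 (ltW r0).
  lra.
have [Phi hPhi] := choice lim.
exists Phi, d; first by rewrite d0.
move=> A A0; have [K K0 hK] := lip A A0; exists K => // x t xA.
by apply: hPhi => // s r; exact: hK.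
Qed.

Let Phi : R -> R := projT1 (cid start).
Let Phi_approx : exists2 d, 0 < d < 1 & forall A, 0 <= A ->
  exists2 K, 0 <= K & forall x t, `|x| <= A -> 0 < t < d -> `|X x t - Phi x| <= K * t.
Proof. exact: (projT2 (cid start)). Qed.

Let Y x t := if t <= 0 then Phi x else X x t.
Let YE x t : 0 < t -> Y x t = X x t. Proof. by rewrite /Y leNgt => ->. Qed.
Let Y0 x : Y x 0 = Phi x. Proof. by rewrite /Y lexx. Qed.

Let Y_der x t : 0 < t -> is_derive t 1 (Y x) (u (Y x t) t).
Proof.
move=> t0; rewrite YE //.
by apply: (der_pos t0 _ (Xder t x t0)) => r r0; rewrite YE.
Qed.

Let Y_cont x : continuous (Y x).
Proof.
move=> t; case: (ltgtP t 0) => [t0|t0|->]; last 1 first.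
- have [d /andP[d0 d1] /(_ `|x| (normr_ge0 x))[K K0 hK]] := Phi_approx.
  apply/contP => e e0; exists (Num.min d (e / (K + 1))) => [|r].
    by rewrite lt_min d0 divr_gt0 //; lra.
  rewrite Y0 subr0 lt_min => /andP[rd re].
  have [r0|r0] := leP r 0; first by rewrite /Y r0 subrr normr0.
  rewrite YE //; rewrite gtr0_norm // in rd re.
  apply: le_lt_trans (hK x r (lexx _) _) _; first by rewrite r0.
  by move: re; rewrite ltr_pdivlMr; lra.
- apply/contP => e e0; exists (- t) => [|r]; first by rewrite oppr_gt0.
  move=> /ltr_normlP[? ?]; rewrite /Y (ltW t0) ifT ?subrr ?normr0 //; lra.
- exact: der_cont (Y_der x t t0).
Qed.

Let V x t := ext u (Y x t) t.
Let VE x t : 0 <= t -> V x t = u (Y x t) t. Proof. exact: extE. Qed.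

Let V_cont x : continuous (V x).
Proof.
move=> t; apply: (cont2_curve (ext u) (Y x) (fun r => r)).
- exact: ext_cont2.
- exact: Y_cont.
- exact: cvg_id.
Qed.

Let V_der x t : 0 < t -> is_derive t 1 (V x)
  (- V x t - M 1 * Y x t + (2 * cum (Y x t) t + N t)).
Proof.
move=> t0; rewrite VE ?ltW // YE //.
by apply: (der_pos t0 _ (Uder t x t0)) => r r0; rewrite VE ?ltW // YE.
Qed.

Let V0 x : V x 0 = u0 (Phi x).
Proof. by rewrite VE // Y0; have [] := init (Phi x). Qed.

Let Y_lag x t : 0 <= t -> lag (Y x t) t = lag x 1.
Proof.
have pos r : 0 < r -> lag (Y x r) r = lag x 1 by move=> r0; rewrite YE // Xlag.
rewrite le_eqVlt => /predU1P[<-|]; last exact: pos.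
apply: (right_value (fun r => lag (Y x r) r)) => //.
apply: (cont2_curve lag (Y x) (fun r => r)); [exact: lagmass_c|exact: Y_cont|exact: cvg_id].
Qed.

Let lag_at0 x : lag x 0 = prim rho0 x.
Proof. by rewrite /lagmass cumul_at0 prim0 ?subr0 //; exact: flux0_cont. Qed.

Let Y_cumul x y t : 0 <= t ->
  cum (Y x t) t - cum (Y y t) t = prim rho0 (Phi x) - prim rho0 (Phi y).
Proof.
move=> t0; rewrite -!lag_at0 -!Y0 !Y_lag // -(Y_lag x t t0) -(Y_lag y t t0).
by rewrite /lagmass; ring.
Qed.

(** The same comparison of two characteristics, now on a time interval closed
    at [0], and from either of its ends. *)
Let Y_formula x y s t : 0 <= s -> 0 <= t ->
  Y x t - Y y t = a (t - s) * (Y x s - Y y s) + b (t - s) * (V x s - V y s) +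
    h (t - s) * (2 * (prim rho0 (Phi x) - prim rho0 (Phi y))).
Proof.
move=> s0 t0; pose q := Num.max s t.
have sq : 0 <= s <= q by rewrite s0 le_max lexx.
have tq : 0 <= t <= q by rewrite t0 le_max lexx orbT.
have dD r : 0 < r < q -> is_derive r 1 (fun r => Y x r - Y y r) (V x r - V y r).
  move=> /andP[r0 _]; rewrite !VE ?ltW //.
  exact: (derB (Y_der x r r0) (Y_der y r r0)).
have dV r : 0 < r < q -> is_derive r 1 (fun r => V x r - V y r)
   (- (V x r - V y r) - M 1 * (Y x r - Y y r) +
    2 * (prim rho0 (Phi x) - prim rho0 (Phi y))).
  move=> /andP[r0 _].
  apply: (der_eq (derB (V_der x r r0) (V_der y r r0))).
  by rewrite -(Y_cumul x y r (ltW r0)); ring.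
have Dc : {within `[0, q], continuous (fun r => Y x r - Y y r)}.
  by apply: withinB; apply: continuous_subspaceT; exact: Y_cont.
have Vc : {within `[0, q], continuous (fun r => V x r - V y r)}.
  by apply: withinB; apply: continuous_subspaceT; exact: V_cont.
by have [] := fund_solve (M 1) a b h _ _ _ 0 q s F sq Dc Vc dD dV t tq.
Qed.

Let Phi_cont : continuous Phi.
Proof.
have e : Phi = (fun x => Phi 0 + Z x 0).
  apply/funext => x; have := Y_formula x 0 1 0 ler01 (lexx 0).
  rewrite !Y0 !VE // !YE // !X1.
  have := Y_cumul x 0 1 ler01; rewrite !YE // !X1 (cumul0 rho rhoC0) => <-.
  by rewrite /Z !subr0; lra.
rewrite e => x; apply: cvgD; first exact: cvg_cst.
by apply: (cont2_curve Z (fun y => y) (fun=> 0)) => //; exact: cvg_cst.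
Qed.

(** The initial positions come close to any interval of length [1], by
    [bounded_labels], and they depend continuously on the label. *)
Let Phi_surj z : exists x, Phi x = z.
Proof.
have [d /andP[d0 d1] hd] := Phi_approx.
have near_val z1 z2 : z1 < z2 -> exists x, z1 - 1 <= Phi x <= z2 + 1.
  move=> z12; have [A [d2 [d20 hA]]] := bounded_labels z1 z2 z12.
  have [K K0 hK] := hd `|A| (normr_ge0 A).
  pose t := Num.min (Num.min (d / 2) (d2 / 2)) (1 / (K + 1)).
  have t0 : 0 < t by rewrite !lt_min !divr_gt0 //; lra.
  have td : t < d by rewrite !gt_min; apply/orP; left; apply/orP; left; lra.
  have td2 : t < d2 by rewrite !gt_min; apply/orP; left; apply/orP; right; lra.
  have tK : t <= 1 / (K + 1) by rewrite ge_min lexx orbT.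
  have [x [xA /andP[x1 x2]]] := hA t ltac:(by rewrite t0).
  have /ler_normlP[k1 k2] := hK x t (le_trans xA (ler_norm A)) ltac:(by rewrite t0).
  have Kt : K * t <= 1 by move: tK; rewrite ler_pdivlMr; lra.
  by exists x; apply/andP; split; lra.
have [x1 /andP[_ h1]] := near_val (z - 3) (z - 2) ltac:(lra).
have [x2 /andP[h2 _]] := near_val (z + 2) (z + 3) ltac:(lra).
have Pw p q : {within `[p, q], continuous Phi} by exact: continuous_subspaceT.
have [x12|/ltW x21] := leP x1 x2.
- have [|x _ <-] := IVT x12 (Pw _ _) (v := z); last by exists x.
  by rewrite ge_min le_max; apply/andP; split; apply/orP; [left|right]; lra.
- have [|x _ <-] := IVT x21 (Pw _ _) (v := z); last by exists x.
  by rewrite ge_min le_max; apply/andP; split; apply/orP; [right|left]; lra.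
Qed.

Let Phi_le x y : x <= y -> Phi x <= Phi y.
Proof.
move=> xy; rewrite leNgt; apply/negP => yx.
have /contP/(_ (Phi x - Phi y))[|d d0 hd] : {for 0, continuous (fun t => Y y t - Y x t)}.
- by apply: cvgB; exact: Y_cont.
- by rewrite subr_gt0.
have := hd (d / 2); rewrite !Y0 subr0 gtr0_norm; last lra.
move=> /(_ ltac:(lra))/ltr_normlP[_]; rewrite !YE; try lra.
by have := Xle (d / 2) x y ltac:(lra) xy; lra.
Qed.

(** The argument of [mass_constant] once more, between the times [0] and [1]. *)
Lemma mass_initial : M 1 = M0.
Proof.
have [aN aP] := lag_lim 1 ltr01.
have [l0 [bN bP _]] := improper_integral rho0_cont rho0_int primd.
have e : (fun x => lag x 1) = prim rho0 \o Phi.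
  by apply/funext => x /=; rewrite -lag_at0 -Y0 Y_lag.
rewrite e in aN aP.
pose J := prim (flux0 rho u).
have e1 : l 1 + M 1 - J 1 = l0 + M0 :=
  cvgy_unique aP (cvg_comp _ _ (surj_cvgy _ Phi_le Phi_surj) bP).
have e2 : l 1 - J 1 = l0 :=
  cvgNy_unique aN (cvg_comp _ _ (surj_cvgNy _ Phi_le Phi_surj) bN).
by lra.
Qed.

(** Relabelling by initial positions is possible even before [Phi] is known to be
    injective: characteristics with the same initial position coincide by the
    explicit formula. *)
Lemma relabelled_flow : exists X, is_flow rho u rho0 u0 a b h X.
Proof.
have [Psi Psi_K] := choice Phi_surj.
have same x y t : 0 <= t -> Phi x = Phi y -> Y x t = Y y t.
  move=> t0 e; have := Y_formula x y 0 t (lexx 0) t0.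
  by rewrite !Y0 !V0 e !subrr !mulr0 !addr0; lra.
exists (fun x => Y (Psi x)); split.
- split => [x|x|x t t0]; first by rewrite Y0.
    exact: Y_cont.
  have [y Xy] := Xsurj t x t0; exists (Phi y).
  by rewrite -Xy -YE //; apply: same; [exact: ltW|exact: Psi_K].
- move=> x t t0; split; first exact: Y_der.
  apply: (der_eq (V_der (Psi x) t t0)).
  have [e1 _ _] := force t t0; have := e1 (Y (Psi x) t).
  have [_ _] := sys (Y (Psi x) t) t t0; rewrite (mass_constant t t0) VE ?ltW //.
  by lra.
- move=> x t t0; have := Y_formula (Psi x) (Psi 0) 0 t (lexx 0) t0.
  rewrite !subr0 !Y0 !V0 !Psi_K (prim0 _ rho0_cont).
  by lra.
- move=> x t t0; have := Y_cumul (Psi x) (Psi 0) t t0.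
  by rewrite !Psi_K (prim0 _ rho0_cont); lra.
Qed.
End Fundamental.

Lemma flow_from_zero a b h : fund M0 a b h ->
  exists X, is_flow rho u rho0 u0 a b h X.
Proof.
have [a' [b' [h' F']]] := fund_exists (M 1).
by rewrite -(mass_initial a' b' h' F'); exact: relabelled_flow.
Qed.
End InitialTime.

(** * Necessary conditions and uniqueness *)

Section Consequences.
Context {R : realType}.
Implicit Types (r s t x y z : R).

Lemma cvgy_shift (f : R -> R) (c l : R) :
  f x @[x --> +oo] --> l -> f (x - c) @[x --> +oo] --> l.
Proof.
move=> /cvgrPdist_lt fl; apply/cvgrPdist_lt => e /fl[A [_ hA]].
exists (A + c); split => [|x /= xA]; first exact: num_real.
by apply: hA; rewrite ltrBrDr.
Qed.

Lemma cvgNy_shift (f : R -> R) (c l : R) :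
  f x @[x --> -oo] --> l -> f (x - c) @[x --> -oo] --> l.
Proof.
move=> /cvgrPdist_lt fl; apply/cvgrPdist_lt => e /fl[A [_ hA]].
exists (A + c); split => [|x /= xA]; first exact: num_real.
by apply: hA; rewrite ltrBlDr.
Qed.

(** Translation invariance of the interaction force; since the force depends on the
    density through its mass, first moment and primitive only, it suffices to
    translate primitives. *)
Lemma dW_translate (f g : R -> R) (c v w v' w' x : R) : continuous f -> continuous g ->
  (forall y, g y = f (y - c)) ->
  has_int f v -> has_int (fun y => y * f y) w ->
  has_int g v' -> has_int (fun y => y * g y) w' ->
  (\int[lebesgue_measure]_y (dW (x + c - y) * g y))%R =
  (\int[lebesgue_measure]_y (dW (x - y) * f y))%R.
Proof.
move=> fc gc gf fv fw gv gw.
have yc (k : R -> R) : continuous k -> continuous (fun y => y * k y).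
  by move=> kc y; apply: cvgM; [exact: cvg_id|exact: kc].
have dP := fun y => der_prim f y fc.
have dQ := fun y => der_prim _ y (yc _ fc).
have [l [lN lP lI]] := improper_integral fc fv dP.
have [k [kN kP kI]] := improper_integral (yc _ fc) fw dQ.
have dPs (y : R) : is_derive y 1 (fun z => prim f (z - c)) (g y).
  by rewrite gf; exact: der_shift (dP _).
have dQs (y : R) : is_derive y 1
    (fun z => prim (fun y => y * f y) (z - c) + c * prim f (z - c)) (y * g y).
  apply: (der_eq (derD (der_shift (dQ _)) (derZ c (dPs y)))).
  by rewrite gf; ring.
have [l' [lN' lP' lI']] := improper_integral gc gv dPs.
have [k' [kN' kP' kI']] := improper_integral (yc _ gc) gw dQs.
have e1 : l' = l := cvgNy_unique lN' (cvgNy_shift _ c _ lN).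
have e2 : l' + v' = l + v := cvgy_unique lP' (cvgy_shift _ c _ lP).
have e3 : k' = k + c * l := cvgNy_unique kN' (cvgD (cvgNy_shift _ c _ kN)
  (cvgM (cvg_cst c) (cvgNy_shift _ c _ lN))).
have e4 : k' + w' = k + w + c * (l + v) := cvgy_unique kP' (cvgD (cvgy_shift _ c _ kP)
  (cvgM (cvg_cst c) (cvgy_shift _ c _ lP))).
have [_ ->] := has_int_dW f x v w fv fw.
have [_ ->] := has_int_dW g (x + c) v' w' gv gw.
rewrite lI lI' addrK.
have e5 : v' = v by apply: (addrI l'); rewrite e2 e1.
have e6 : w' = w + c * v by apply: (addrI k'); rewrite e4 e3; ring.
by rewrite e5 e6 e1; ring.
Qed.

Section OneFlow.
Variables (rho u : R -> R -> R) (rho0 u0 : R -> R) (M0 : R) (a b h : R -> R)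
  (X : R -> R -> R).
Hypotheses (F : fund M0 a b h) (rho0_cont : continuous rho0)
  (rho0_gt0 : forall x, 0 < rho0 x) (u0_der : forall x, derivable u0 x 1)
  (rhoC0 : continuous_closed_halfplane rho) (flow : is_flow rho u rho0 u0 a b h X).

(** The Jacobian of the flow with respect to the label. *)
Definition flow_jac x t := a t + b t * derive1 u0 x + h t * (2 * rho0 x).

Lemma der_flow x t : 0 <= t -> is_derive x 1 (fun y => X y t) (flow_jac x t).
Proof.
move=> t0; have [_ _ Xf _] := flow.
have d1 := derZ (a t) (derI x).
have d2 := derZ (b t) (derB (derivable_der (u0_der x)) (derC (u0 0) x)).
have d3 := derZ (h t) (derZ 2 (der_prim rho0 x rho0_cont)).
have d := derD (derC (X 0 t) x) (derD (derD d1 d2) d3).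
have -> : (fun y => X y t) = (fun y => X 0 t + (a t * y + b t * (u0 y - u0 0) +
    h t * (2 * prim rho0 y))) by apply/funext => y; exact: Xf.
by apply: (der_eq d); rewrite /flow_jac; ring.
Qed.

Lemma rho_jac x t : 0 <= t -> rho (X x t) t * flow_jac x t = rho0 x.
Proof.
move=> t0; have [_ _ _ Xc] := flow.
have d1 := der_comp (fun y => X y t) (fun y => cumul rho y t) (der_flow x t t0)
  (der_cumul_x rho rhoC0 _ t).
have d2 := derD (derC (cumul rho (X 0 t) t) x) (der_prim rho0 x rho0_cont).
have e : (fun y => cumul rho (X y t) t) = (fun y => cumul rho (X 0 t) t + prim rho0 y).
  by apply/funext => y; exact: Xc.
rewrite e in d1; have := der_derive1 d1; rewrite (der_derive1 d2).
by rewrite extE // add0r => ->.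
Qed.

(** Mass conservation keeps the Jacobian away from zero, hence positive. *)
Lemma jac_gt0 x t : 0 <= t -> 0 < flow_jac x t.
Proof.
move=> t0; rewrite ltNge; apply/negP => jt.
have jc : continuous (flow_jac x).
  move=> s; apply: cvgD; [apply: cvgD|].
  - exact: cont_a F s.
  - by apply: cvgM; [exact: cont_b F s|exact: cvg_cst].
  - by apply: cvgM; [exact: cont_h F s|exact: cvg_cst].
have [|s] := IVT t0 (continuous_subspaceT jc) (v := 0).
  rewrite ge_min le_max jt orbT /=.
  by rewrite /flow_jac (fund_a0 F) (fund_b0 F) (fund_h0 F) !mul0r !addr0 ler01.
rewrite in_itv /= => /andP[s0 _] js; have := rho_jac x s s0.
by rewrite js mulr0 => e; have := rho0_gt0 x; rewrite -e ltxx.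
Qed.
End OneFlow.

(** Two solutions with the same data have the same flow up to a translation
    depending on time, which is therefore a solution of [c'' + c' = 0] with zero
    data. *)
Lemma flow_unique (rho u rho' u' : R -> R -> R) (rho0 u0 : R -> R) (M0 : R)
    (a b h : R -> R) (X X' : R -> R -> R) :
  fund M0 a b h -> continuous rho0 -> (forall x, 0 < rho0 x) ->
  (forall x, derivable u0 x 1) ->
  continuous_closed_halfplane rho -> continuous_closed_halfplane rho' ->
  continuous_closed_halfplane u -> continuous_closed_halfplane u' ->
  euler_system rho u -> euler_system rho' u' ->
  (forall x, u x 0 = u0 x) -> (forall x, u' x 0 = u0 x) ->
  is_flow rho u rho0 u0 a b h X -> is_flow rho' u' rho0 u0 a b h X' ->
  forall x t, 0 < t -> rho' x t = rho x t /\ u' x t = u x t.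
Proof.
move=> F rho0c rho0_gt0 u0d rc rc' uc uc' sys sys' i i' fl fl'.
have [[X0 Xc Xs] Xd Xf _] := fl; have [[X0' Xc' Xs'] Xd' Xf' _] := fl'.
pose c t := X' 0 t - X 0 t; pose v t := ext u' (X' 0 t) t - ext u (X 0 t) t.
have XX x t : 0 <= t -> X' x t = X x t + c t.
  by move=> t0; rewrite (Xf x t t0) (Xf' x t t0) /c; ring.
have rr x t : 0 <= t -> rho' (X x t + c t) t = rho (X x t) t.
  move=> t0; rewrite -XX //.
  have e1 := rho_jac _ _ _ _ _ _ _ _ rho0c u0d rc fl x t t0.
  have e2 := rho_jac _ _ _ _ _ _ _ _ rho0c u0d rc' fl' x t t0.
  have j0 := jac_gt0 _ _ _ _ _ _ _ _ _ F rho0c rho0_gt0 u0d rc fl x t t0.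
  by apply: (mulIf (lt0r_neq0 j0)); rewrite e1 e2.
have rt x t : 0 < t -> rho' x t = rho (x - c t) t.
  move=> t0; have [y Xy] := Xs (x - c t) t t0.
  by rewrite -Xy -rr ?ltW // Xy subrK.
have slice (f : R -> R -> R) t : continuous_closed_halfplane f -> continuous (fun y => ext f y t).
  by move=> fc; apply: cont2_slice => y; exact: ext_cont2.
have moments (r w : R -> R -> R) t : 0 < t -> continuous_closed_halfplane r ->
   euler_system r w -> exists p q, has_int (fun y => ext r y t) p /\
     has_int (fun y => y * ext r y t) q.
  move=> t0 rc0 s; apply: dW_integrable => [|x]; first exact: slice.
  have [+ _ _] := s x t t0.
  have -> // : dW_kernel r x t = (fun y => dW (x - y) * ext r y t).
  by apply/funext => y; rewrite /dW_kernel extE ?ltW.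
have conv x t : 0 < t -> dW_conv rho' (x + c t) t = dW_conv rho x t.
  move=> t0; have [p [q [hp hq]]] := moments rho u t t0 rc sys.
  have [p' [q' [hp' hq']]] := moments rho' u' t t0 rc' sys'.
  have := dW_translate _ _ (c t) _ _ _ _ x (slice rho t rc) (slice rho' t rc') _ hp hq hp' hq'.
  have eK (r : R -> R -> R) z : dW_kernel r z t = (fun y => dW (z - y) * ext r y t).
    by apply/funext => y; rewrite /dW_kernel extE ?ltW.
  rewrite /dW_conv !eK; apply => y.
  by rewrite !extE ?ltW //; exact: rt.
have dc t : 0 < t -> is_derive t 1 c (v t).
  move=> t0; have [d _] := Xd 0 t t0; have [d' _] := Xd' 0 t t0.
  by rewrite /v !extE ?ltW //; exact: (derB d' d).
have dv t : 0 < t -> is_derive t 1 v (- v t - 0 * c t + 0).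
  move=> t0; have [_ d] := Xd 0 t t0; have [_ d'] := Xd' 0 t t0.
  apply: (der_eq (derB d' d)).
  by rewrite XX ?ltW // conv // -XX ?ltW // /v !extE ?ltW //; ring.
have [a0 [b0 [h0 F0]]] := @fund_exists R 0.
have c0 t : 0 <= t -> c t = 0.
  move=> t0; have tt : 0 <= t <= t by rewrite t0 lexx.
  have zt : 0 <= (0 : R) <= t by rewrite lexx t0.
  have cc : {within `[0, t], continuous c}.
    by apply: withinB; apply: continuous_subspaceT; [exact: Xc'|exact: Xc].
  have vc : {within `[0, t], continuous v}.
    apply: withinB; apply: continuous_subspaceT => s.
      by apply: (cont2_curve (ext u') (X' 0) (fun y => y)); [exact: ext_cont2|exact: Xc'|exact: cvg_id].
    by apply: (cont2_curve (ext u) (X 0) (fun y => y)); [exact: ext_cont2|exact: Xc|exact: cvg_id].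
  have [-> _] := fund_solve 0 a0 b0 h0 c v 0 0 t 0 F0 zt cc vc
    (fun r hr => dc r (andP hr).1) (fun r hr => dv r (andP hr).1) t tt.
  by rewrite /c /v X0 X0' !extE // i i' !subrr !mulr0 !addr0.
move=> x t t0; have [y Xy] := Xs x t t0; split.
  by rewrite rt // c0 ?subr0 ?ltW.
have [d _] := Xd y t t0; have [d' _] := Xd' y t t0.
have XX' s : 0 <= s -> X' y s = X y s by move=> s0; rewrite XX // c0 // addr0.
have d2 : is_derive t 1 (X' y) (u (X y t) t).
  by apply: (der_pos t0 _ d) => s /ltW s0; rewrite XX'.
have := der_derive1 d2; rewrite (der_derive1 d').
by rewrite XX' ?ltW // Xy.
Qed.
End Consequences.

(** * Construction of the solution *)

Section Existence.
Context {R : realType}.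
Implicit Types (r s t x y z : R).

Variables (rho0 u0 : R -> R) (delta M B C0 : R) (a b h : R -> R).
Hypotheses (rho0_C1 : C1 rho0) (u0_C1 : C1 u0) (du0_C1 : C1 (derive1 u0))
  (rho0_gt0 : forall x, 0 < rho0 x) (delta_gt0 : 0 < delta)
  (du0_le : forall x, `|derive1 u0 x| <= B)
  (rho0_le : forall x, rho0 x <= C0 * (1 + `|x|) `^ (- (2 + delta)))
  (hM : has_int rho0 M) (M_gt0 : 0 < M) (M_le : M <= 1 / 4)
  (F : fund M a b h).
Local Notation jac := (flow_jac rho0 u0 a b h).
Hypothesis jac_pos : forall x t, 0 <= t -> 0 < jac x t.

Let drho0 (x : R) : is_derive x 1 rho0 (derive1 rho0 x).
Proof. by apply: derivable_der; case: rho0_C1. Qed.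
Let du0 (x : R) : is_derive x 1 u0 (derive1 u0 x).
Proof. by apply: derivable_der; case: u0_C1. Qed.
Let ddu0 (x : R) : is_derive x 1 (derive1 u0) (derive1 (derive1 u0) x).
Proof. by apply: derivable_der; case: du0_C1. Qed.
Let rho0_c : continuous rho0. Proof. by move=> x; exact: der_cont (drho0 x). Qed.
Let u0_c : continuous u0. Proof. by move=> x; exact: der_cont (du0 x). Qed.
Let C0_ge0 : 0 <= C0.
Proof.
have := lt_le_trans (rho0_gt0 0) (rho0_le 0).
by rewrite pmulr_lgt0 ?powR_gt0 ?normr0 ?addr0 // => /ltW.
Qed.
Let B_ge0 : 0 <= B. Proof. exact: le_trans (du0_le 0). Qed.

Let n1 x : 0 < 1 + `|x|. Proof. by have := normr_ge0 x; lra. Qed.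

Let u0_growth : exists2 U, 0 <= U & forall x, `|u0 x| <= U * (1 + `|x|).
Proof.
exists (`|u0 0| + B) => [|x]; first by rewrite addr_ge0.
have := mean_value_lin u0 (derive1 u0) 0 x 0 B B_ge0 (fun y _ => du0 y).
rewrite mul0r !subr0 => H.
have {}H : `|u0 x - u0 0| <= B * `|x| by apply: H => y _; rewrite subr0.
have := ler_normD (u0 x - u0 0) (u0 0); rewrite subrK.
have := mulr_ge0 (normr_ge0 (u0 0)) (normr_ge0 x); have := B_ge0; lra.
Qed.

Let decay_mul x : (1 + `|x|) * (1 + `|x|) `^ (- (2 + delta)) =
  (1 + `|x|) `^ (- (1 + delta)).
Proof.
rewrite -{1}(powRr1 (ltW (n1 x))) -powRD; last by apply/implyP => _; rewrite gt_eqF.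
by congr (_ `^ _); ring.
Qed.

Let decay_mul1 x : (1 + `|x|) * (1 + `|x|) `^ (- (1 + delta)) =
  (1 + `|x|) `^ (- delta).
Proof.
rewrite -{1}(powRr1 (ltW (n1 x))) -powRD; last by apply/implyP => _; rewrite gt_eqF.
by congr (_ `^ _); ring.
Qed.

Let moment (f : R -> R) (C : R) : continuous f -> 0 <= C ->
  (forall x, `|f x| <= C * (1 + `|x|)) -> exists v, has_int (fun x => f x * rho0 x) v.
Proof.
move=> fc K0 fC; apply: (has_int_decay _ delta (C * C0)) => //.
  by move=> x; apply: cvgM; [exact: fc|exact: rho0_c].
move=> x; rewrite normrM (gtr0_norm (rho0_gt0 x)) -decay_mul.
have -> : C * C0 * ((1 + `|x|) * (1 + `|x|) `^ (- (2 + delta))) =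
  (C * (1 + `|x|)) * (C0 * (1 + `|x|) `^ (- (2 + delta))) by ring.
by apply: ler_pM => //; exact/ltW/rho0_gt0.
Qed.

Let p0_ex : exists v, has_int (fun x => x * rho0 x) v.
Proof.
apply: (moment (fun x => x) 1) => // [x|x]; first exact: cvg_id.
by rewrite mul1r; lra.
Qed.

Let q0_ex : exists v, has_int (fun x => u0 x * rho0 x) v.
Proof. by have [U U0 hU] := u0_growth; exact: (moment u0 U). Qed.

Let p0 := projT1 (cid p0_ex).
Let hp : has_int (fun x => x * rho0 x) p0. Proof. exact: projT2 (cid p0_ex). Qed.
Let q0 := projT1 (cid q0_ex).
Let hq : has_int (fun x => u0 x * rho0 x) q0. Proof. exact: projT2 (cid q0_ex). Qed.

Let G0 := prim rho0.
Let dG0 (x : R) : is_derive x 1 G0 (rho0 x). Proof. exact: der_prim. Qed.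
Let l0 := projT1 (cid (improper_integral rho0_c hM dG0)).
Let G0_lim : G0 x @[x --> -oo] --> l0 /\ G0 x @[x --> +oo] --> l0 + M.
Proof. by have [] := projT2 (cid (improper_integral rho0_c hM dG0)). Qed.

(* The centre of mass [m] moves by inertia and friction only: the internal
   forces cancel. In the coordinates attached to it the flow is a solution of
   the oscillator equation, with constant forcing [2 * (G0 x - l0) - M]. *)
Let c := p0 / M.
Let v := q0 / M.
Let m t := c + v * (1 - expR (- 1 * t)).
Let X x t := a t * (x - c) + b t * (u0 x - v) + h t * (2 * (G0 x - l0) - M) + m t.
Let V x t := - M * b t * (x - c) + (a t - b t) * (u0 x - v)
  + b t * (2 * (G0 x - l0) - M) + v * expR (- 1 * t).
Let djac x t := - M * b t + (a t - b t) * derive1 u0 x + b t * (2 * rho0 x).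
Let acc x t := - V x t - M * X x t + (2 * (G0 x - l0) - M) + M * m t.

Let X_der_x (x t : R) : is_derive x 1 (fun y => X y t) (jac x t).
Proof.
have d1 := derZ (a t) (derB (derI x) (derC c x)).
have d2 := derZ (b t) (derB (du0 x) (derC v x)).
have d3 := derZ (h t) (derB (derZ 2 (derB (dG0 x) (derC l0 x))) (derC M x)).
apply: (der_eq (derD (derD (derD d1 d2) d3) (derC (m t) x))).
by rewrite /flow_jac; ring.
Qed.

Let V_der_x (x t : R) : is_derive x 1 (fun y => V y t) (djac x t).
Proof.
have d1 := derZ (- M * b t) (derB (derI x) (derC c x)).
have d2 := derZ (a t - b t) (derB (du0 x) (derC v x)).
have d3 := derZ (b t) (derB (derZ 2 (derB (dG0 x) (derC l0 x))) (derC M x)).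
apply: (der_eq (derD (derD (derD d1 d2) d3) (derC (v * expR (- 1 * t)) x))).
by rewrite /djac; ring.
Qed.

Let dm (t : R) : is_derive t 1 m (v * expR (- 1 * t)).
Proof.
apply: (der_eq (derD (derC c t) (derZ v (derB (derC 1 t) (der_expM (- 1) t))))).
by ring.
Qed.

Let X_der_t (x t : R) : is_derive t 1 (X x) (V x t).
Proof.
apply: (der_eq (derD (derD (derD
  (derZr (x - c) (der_a F t)) (derZr (u0 x - v) (der_b F t)))
  (derZr (2 * (G0 x - l0) - M) (der_h F t))) (dm t))).
by rewrite /V; ring.
Qed.

Let V_der_t (x t : R) : is_derive t 1 (V x) (acc x t).
Proof.
apply: (der_eq (derD (derD (derD
  (derZr (x - c) (derZ (- M) (der_b F t)))
  (derZr (u0 x - v) (derB (der_a F t) (der_b F t))))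
  (derZr (2 * (G0 x - l0) - M) (der_b F t)))
  (derZ v (der_expM (- 1) t)))).
by rewrite /acc /V /X (fund_ah F); ring.
Qed.

Let jac_der_t (x t : R) : is_derive t 1 (jac x) (djac x t).
Proof.
apply: (der_eq (derD (derD
  (der_a F t) (derZr (derive1 u0 x) (der_b F t)))
  (derZr (2 * rho0 x) (der_h F t)))).
by rewrite /djac; ring.
Qed.

Let jac_x x t := b t * derive1 (derive1 u0) x + h t * (2 * derive1 rho0 x).
Let jac_der_x (x t : R) : is_derive x 1 (fun y => jac y t) (jac_x x t).
Proof.
apply: (der_eq (derD (derD
  (derC (a t) x) (derZ (b t) (ddu0 x)))
  (derZ (h t) (derZ 2 (drho0 x))))).
by rewrite /jac_x; ring.
Qed.

Let tc (f : R -> R) x t : continuous f -> cont2 (fun _ s => f s) x t.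
Proof. by move=> fc; apply: (cont2_2 f); exact: fc. Qed.
Let xc (f : R -> R) x t : continuous f -> cont2 (fun y _ => f y) x t.
Proof. by move=> fc; apply: (cont2_1 f); exact: fc. Qed.
Let kc (k : R) x t : cont2 (fun _ _ => k) x t.
Proof. by apply: (xc (fun=> k)) => y; exact: cvg_cst. Qed.

Let ac : continuous a := cont_a F.
Let bc : continuous b := cont_b F.
Let hc : continuous h := cont_h F.
Let du0_c : continuous (derive1 u0). Proof. by case: u0_C1. Qed.
Let ddu0_c : continuous (derive1 (derive1 u0)). Proof. by case: du0_C1. Qed.
Let drho0_c : continuous (derive1 rho0). Proof. by case: rho0_C1. Qed.
Let G0_c : continuous G0. Proof. exact: prim_cont. Qed.
Let mc : continuous m. Proof. by move=> t; exact: der_cont (dm t). Qed.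
Let ec : continuous (fun t => expR (- 1 * t) : R).
Proof. by move=> t; exact: der_cont (der_expM (- 1) t). Qed.
Let idc : continuous (fun x : R => x). Proof. by move=> x; exact: cvg_id. Qed.

Let cont2B (f g : R -> R -> R) x t : cont2 f x t -> cont2 g x t ->
  cont2 (fun y s => f y s - g y s) x t.
Proof. by move=> fc gc; apply: cont2D => //; exact: cont2N. Qed.

Ltac c2 := lazymatch goal with
  | |- cont2 (fun _ _ => ?k) _ _ => exact (kc k _ _)
  | |- cont2 (fun y _ => y) _ _ => exact (xc _ _ _ idc)
  | |- cont2 (fun _ s => expR (- 1 * s)) _ _ => exact (tc _ _ _ ec)
  | |- cont2 (fun _ s => ?f s) _ _ => apply (tc f); assumption
  | |- cont2 (fun y _ => ?f y) _ _ => apply (xc f); assumption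
  | |- cont2 (fun y s => - @?f y s) ?x ?t => apply (cont2N f x t); c2
  | |- cont2 (fun y s => @?f y s + @?g y s) ?x ?t => apply (cont2D f g x t); c2
  | |- cont2 (fun y s => @?f y s * @?g y s) ?x ?t => apply (cont2M f g x t); c2
  end.

Let jac_c x t : cont2 jac x t. Proof. rewrite /flow_jac; c2. Qed.
Let X_c x t : cont2 X x t. Proof. rewrite /X; c2. Qed.
Let V_c x t : cont2 V x t. Proof. rewrite /V; c2. Qed.
Let djac_c x t : cont2 djac x t. Proof. rewrite /djac; c2. Qed.
Let jac_x_c x t : cont2 jac_x x t. Proof. rewrite /jac_x; c2. Qed.
Let acc_c x t : cont2 acc x t. Proof. rewrite /acc /V /X; c2. Qed.

(** At a fixed time the Jacobian is bounded below. On compact sets this is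
    continuity; near infinity the density is negligible and positivity of the
    Jacobian at the later time [t + 1] bounds [u0'] from below. *)
Let jac_lower t : 0 <= t -> exists2 k, 0 < k & forall x, k <= jac x t.
Proof.
move=> t0; pose T := t + 1; have T0 : 0 < T by rewrite /T; lra.
have bT := b_gt0 M a b h F M_le T T0.
have b1 := b_gt0 M a b h F M_le 1 ltr01.
pose k := expR (- t) * b 1 / b T.
have k0 : 0 < k by apply: divr_gt0 => //; apply: mulr_gt0 => //; exact: expR_gt0.
have bt : 0 <= b t.
  by move: t0; rewrite le_eqVlt => /predU1P[<-|/(b_gt0 M a b h F M_le)/ltW //]; rewrite (fund_b0 F).
pose K := 2 * (b t * h T / b T).
have hT := h_ge0 M a b h F M_le T; have ht := h_ge0 M a b h F M_le t.
have K0 : 0 <= K by rewrite /K mulr_ge0 // divr_ge0 ?(ltW bT) // mulr_ge0.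
have main x : k - K * rho0 x <= jac x t.
  have jT := jac_pos x T (ltW T0); have r0 := rho0_gt0 x.
  have e := fund_det F t T; rewrite (_ : T - t = 1) in e; last by rewrite /T; ring.
  have -> : k = (a t * b T - b t * a T) / b T by rewrite /k e.
  rewrite -(ler_pM2r bT) mulrBl divfK ?gt_eqF // /K.
  have -> : 2 * (b t * h T / b T) * rho0 x * b T = b t * (h T * (2 * rho0 x)).
    by field; rewrite gt_eqF.
  have s1 := mulr_ge0 bt (ltW jT).
  have s2 : 0 <= h t * (2 * rho0 x) * b T.
    by rewrite mulr_ge0 ?(ltW bT) // mulr_ge0 // mulr_ge0 // ltW.
  move: s1; rewrite /flow_jac => s1.
  have -> : (a t + b t * derive1 u0 x + h t * (2 * rho0 x)) * b T =
    a t * b T + b t * (b T * derive1 u0 x) + h t * (2 * rho0 x) * b T by ring.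
  have s3 : b t * (a T + b T * derive1 u0 x + h T * (2 * rho0 x)) =
    b t * a T + b t * (b T * derive1 u0 x) + b t * (h T * (2 * rho0 x)) by ring.
  by lra.
have d2 : 0 < 2 + delta by rewrite addr_gt0.
have k2 : 0 < k / 2 by rewrite divr_gt0.
have [A A0 hA] := power_small (K * C0) (2 + delta) (k / 2) d2 k2.
have AA : - A <= A by lra.
have [|z _ hz] := @EVT_min R (fun x => jac x t) (- A) A AA.
  by apply: continuous_subspaceT => x; exact: der_cont (jac_der_x x t).
exists (Num.min (k / 2) (jac z t)).
  by rewrite lt_min jac_pos // andbT; lra.
move=> x; rewrite ge_min; have [xA|Ax] := leP `|x| A.
  by rewrite hz ?orbT // in_itv /= -ler_norml.
apply/orP; left; apply: le_trans (main x).
have h1 := hA x Ax; have h2 := ler_wpM2l K0 (rho0_le x).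
by lra.
Qed.

Let X_lt t x y : 0 <= t -> x < y -> X x t < X y t.
Proof.
move=> t0 xy.
by apply: (der_lt xy (fun z => X_der_x z t)) => z _; exact: jac_pos.
Qed.

Let X_inverse t : 0 <= t -> exists g, [/\ cancel (fun x => X x t) g,
  cancel g (fun x => X x t), continuous g & forall x y, x < y -> g x < g y].
Proof.
move=> t0; have [k k0 hk] := jac_lower t t0.
have grow x y : x <= y -> k * y - k * x <= X y t - X x t.
  move=> xy; apply: (der_le_closed xy (fun z _ => derZI k z) (fun z _ => X_der_x z t)) => z _.
  exact: hk.
apply: increasing_inverse.
- by move=> x; exact: der_cont (X_der_x x t).
- by move=> x y; exact: X_lt.
- move=> y; exists (- (`|y - X 0 t| / k)).
  have n0 : 0 <= `|y - X 0 t| / k by rewrite divr_ge0 // ltW.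
  have := grow (- (`|y - X 0 t| / k)) 0 ltac:(lra).
  rewrite mulr0 mulrN mulrC divfK ?gt_eqF //.
  by have := ler_norm (- (y - X 0 t)); rewrite normrN; lra.
- move=> y; exists (`|y - X 0 t| / k).
  have n0 : 0 <= `|y - X 0 t| / k by rewrite divr_ge0 // ltW.
  have := grow 0 (`|y - X 0 t| / k) n0.
  rewrite mulr0 mulrC divfK ?gt_eqF //.
  by have := ler_norm (y - X 0 t); lra.
Qed.

Let labels : exists A : R -> R -> R, forall t, 0 <= t ->
  [/\ cancel (fun x => X x t) (fun x => A x t), cancel (fun x => A x t) (fun x => X x t),
      continuous (fun x => A x t) & forall x y, x < y -> A x t < A y t].
Proof.
pose P t (g : R -> R) := 0 <= t -> [/\ cancel (fun x => X x t) g,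
  cancel g (fun x => X x t), continuous g & forall x y, x < y -> g x < g y].
have /choice[g hg] : forall t, exists g, P t g.
  move=> t; have [t0|t0] := leP 0 t.
    by have [g hg] := X_inverse t t0; exists g.
  by exists (fun x => x) => /le_lt_trans/(_ t0); rewrite ltxx.
by exists (fun x t => g t x) => t; exact: hg.
Qed.

Let A0 : R -> R -> R := projT1 (cid labels).
Let A0P t : 0 <= t ->
  [/\ cancel (fun x => X x t) (fun x => A0 x t), cancel (fun x => A0 x t) (fun x => X x t),
      continuous (fun x => A0 x t) & forall x y, x < y -> A0 x t < A0 y t].
Proof. exact: (projT2 (cid labels)). Qed.

Let pos t := Num.max 0 t.
Let pos_ge0 t : 0 <= pos t. Proof. by rewrite /pos le_max lexx. Qed.
Let posE t : 0 <= t -> pos t = t. Proof. by move=> t0; rewrite /pos max_r. Qed.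
Let pos_c : continuous pos.
Proof. by move=> t; apply: continuous_max; [exact: cvg_cst|exact: cvg_id]. Qed.

Let A x t := A0 x (pos t).
Let XA x t : X (A x t) (pos t) = x.
Proof. by have [_ k _ _] := A0P (pos t) (pos_ge0 t); exact: k. Qed.
Let XA0 x t : 0 <= t -> X (A x t) t = x.
Proof. by move=> t0; have := XA x t; rewrite posE. Qed.
Let AX x t : A (X x (pos t)) t = x.
Proof. by have [k _ _ _] := A0P (pos t) (pos_ge0 t); exact: k. Qed.
Let A_lt t x y : x < y -> A x t < A y t.
Proof. by have [_ _ _] := A0P (pos t) (pos_ge0 t); apply. Qed.
Let A_le t x y : x <= y -> A x t <= A y t.
Proof. by rewrite le_eqVlt => /predU1P[->//|/(A_lt t)/ltW]. Qed.
Let A_surj t x : exists y, A y t = x. Proof. by exists (X x (pos t)); exact: AX. Qed.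
Let XE t x y : X x (pos t) < X y (pos t) -> x < y.
Proof.
rewrite !ltNge; apply: contra; rewrite le_eqVlt => /predU1P[->//|].
by move=> /(X_lt (pos t) _ _ (pos_ge0 t))/ltW.
Qed.

Let pos2 (f : R -> R -> R) x t : (forall y s, cont2 f y s) ->
  cont2 (fun y s => f y (pos s)) x t.
Proof.
move=> fc; apply: (cont2_comp f (fun y _ => y) (fun _ s => pos s)).
- exact: fc.
- exact: (xc _ _ _ idc).
- exact: (tc _ _ _ pos_c).
Qed.

Let A_c x t : cont2 A x t.
Proof.
apply/cont2P => e e0; set y := A x t.
have Xl := X_lt (pos t) (y - e) y (pos_ge0 t) ltac:(lra).
have Xr := X_lt (pos t) y (y + e) (pos_ge0 t) ltac:(lra).
rewrite XA in Xl Xr.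
have [d1 d10 h1] := (cont2P _ _ _).1 (pos2 X (y - e) t X_c) ((x - X (y - e) (pos t)) / 2) ltac:(lra).
have [d2 d20 h2] := (cont2P _ _ _).1 (pos2 X (y + e) t X_c) ((X (y + e) (pos t) - x) / 2) ltac:(lra).
exists (Num.min (Num.min d1 d2) (Num.min ((x - X (y - e) (pos t)) / 2) ((X (y + e) (pos t) - x) / 2))).
  by rewrite !lt_min d10 d20 /=; apply/andP; split; lra.
move=> x' s; rewrite !lt_min => /andP[_ /andP[/ltr_normlP[x1 x2] /ltr_normlP[x3 x4]]].
move=> /andP[/andP[s1 s2] _].
have /ltr_normlP[k1 k2] := h1 (y - e) s ltac:(by rewrite subrr normr0) s1.
have /ltr_normlP[k3 k4] := h2 (y + e) s ltac:(by rewrite subrr normr0) s2.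
have g1 : y - e < A x' s by apply: (XE s); rewrite XA; lra.
have g2 : A x' s < y + e by apply: (XE s); rewrite XA; lra.
by rewrite ltr_norml; apply/andP; split; [rewrite ltrBrDl|rewrite ltrBlDl].
Qed.

Let jacA x t : 0 < jac (A x t) (pos t). Proof. exact: jac_pos. Qed.

Let A_der_x (x t : R) : is_derive x 1 (fun y => A y t) (jac (A x t) (pos t))^-1.
Proof.
have k1 : cancel (fun y => X y (pos t)) (fun y => A y t) by move=> y; exact: AX.
have k2 : cancel (fun y => A y t) (fun y => X y (pos t)) by move=> y; exact: XA.
have k3 : continuous (fun y => X y (pos t)).
  by move=> y; exact: der_cont (X_der_x y (pos t)).
have k4 : jac (A x t) (pos t) != 0 by rewrite gt_eqF // jacA.
exact: (der_inverse (fun y => X y (pos t)) (fun y => A y t) x _ k1 k2 k3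
  (X_der_x (A x t) (pos t)) k4).
Qed.

Let A_der_t (x t : R) : 0 < t -> is_derive t 1 (A x) (- V (A x t) t / jac (A x t) t).
Proof.
move=> t0; have k1 y s : `|y - A x t| < t -> `|s - t| < t ->
  is_derive y 1 (fun z => X z s) (jac y s) by move=> _ _; exact: X_der_x.
have k2 : jac (A x t) t != 0 by rewrite gt_eqF // jac_pos // ltW.
have k3 s : `|s - t| < t -> X (A x s) s = x.
  by move=> /(near_pos t t0)/ltW; exact: XA0.
have k4 : {for t, continuous (A x)}.
  by apply: (cont2_curve A (fun=> x) (fun s => s)); [exact: A_c|exact: cvg_cst|exact: cvg_id].
exact: (der_implicit X jac (A x) t _ t x t0 k1 (jac_c _ _) k2 k3 k4 (X_der_t (A x t) t)).
Qed.

Definition sol_u x t := V (A x t) (pos t).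
Definition sol_rho x t := rho0 (A x t) / jac (A x t) (pos t).

Let alongA (f : R -> R -> R) x t : (forall y s, cont2 f y s) ->
  cont2 (fun y s => f (A y s) (pos s)) x t.
Proof.
move=> fc; apply: (cont2_comp f A (fun _ s => pos s)); first exact: fc.
  exact: A_c.
exact: (tc _ _ _ pos_c).
Qed.

Let alongA0 (f : R -> R) x t : continuous f -> cont2 (fun y s => f (A y s)) x t.
Proof. by move=> fc; apply: (alongA (fun y _ => f y)) => y s; exact: xc. Qed.

Let sol_u_c x t : cont2 sol_u x t. Proof. exact: alongA. Qed.
Let sol_rho_c x t : cont2 sol_rho x t.
Proof.
apply: cont2M; first exact: alongA0.
apply: cont2V; first by rewrite gt_eqF // jacA.
exact: alongA.
Qed.

Let closed_halfplane (f : R -> R -> R) : (forall x t, cont2 f x t) ->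
  continuous_closed_halfplane f.
Proof. by move=> fc; apply: continuous_subspaceT => -[x t]; exact: fc. Qed.

Let near_time (f g : R -> R -> R) x t : 0 < t -> (forall y s, 0 < s -> f y s = g y s) ->
  cont2 g x t -> cont2 f x t.
Proof.
move=> t0 fg; apply: (cont2_near g f x t t t0) => y s _ /(near_pos t t0) s0.
by rewrite fg.
Qed.

Let u_x x t := djac (A x t) (pos t) / jac (A x t) (pos t).
Let u_t x t := acc (A x t) (pos t) - V (A x t) (pos t) * u_x x t.
Let Qx x t := derive1 rho0 x / jac x t - rho0 x * jac_x x t / jac x t ^+ 2.
Let Qt x t := - (rho0 x * djac x t / jac x t ^+ 2).
Let r_x x t := Qx (A x t) (pos t) / jac (A x t) (pos t).
Let r_t x t := Qt (A x t) (pos t) - V (A x t) (pos t) * r_x x t.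

Let sol_u_x (x t : R) : is_derive x 1 (fun y => sol_u y t) (u_x x t).
Proof.
exact: (der_comp (fun y => A y t) (fun y => V y (pos t)) (A_der_x x t) (V_der_x _ _)).
Qed.

Let sol_u_t (x t : R) : 0 < t -> is_derive t 1 (sol_u x) (u_t x t).
Proof.
move=> t0; have e := posE t (ltW t0).
have d : is_derive t 1 (fun s => V (A x s) s)
    (djac (A x t) t * (- V (A x t) t / jac (A x t) t) + acc (A x t) t).
  exact: (der_along V djac (A x) t _ _ t t0 (fun y s _ _ => V_der_x y s)
    (djac_c _ _) (A_der_t x t t0) (V_der_t (A x t) t)).
have d' : is_derive t 1 (fun s => V (A x s) s) (u_t x t).
  by apply: (der_eq d); rewrite /u_t /u_x e; ring.
by apply: (der_pos t0 _ d') => s s0; rewrite /sol_u posE ?ltW.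
Qed.

Let Q_der_x (x t : R) : 0 <= t ->
  is_derive x 1 (fun y => rho0 y / jac y t) (Qx x t).
Proof.
move=> t0; have j0 : jac x t != 0 by rewrite gt_eqF // jac_pos.
apply: (der_eq (derM (drho0 x) (derV (f := fun y => jac y t) j0 (jac_der_x x t)))).
by rewrite /Qx; field.
Qed.

Let Q_der_t (x t : R) : 0 <= t -> is_derive t 1 (fun s => rho0 x / jac x s) (Qt x t).
Proof.
move=> t0; have j0 : jac x t != 0 by rewrite gt_eqF // jac_pos.
apply: (der_eq (derZ (rho0 x) (derV (f := jac x) j0 (jac_der_t x t)))).
by rewrite /Qt; field.
Qed.

Let Qx_c x t : 0 <= t -> cont2 Qx x t.
Proof.
move=> t0; have j0 : jac x t != 0 by rewrite gt_eqF // jac_pos.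
apply: cont2B; apply: cont2M.
- exact: xc.
- exact: cont2V.
- by apply: cont2M; [exact: xc|exact: jac_x_c].
- by apply: cont2V; [rewrite expf_neq0|apply: cont2M].
Qed.

Let sol_rho_x (x t : R) : is_derive x 1 (fun y => sol_rho y t) (r_x x t).
Proof.
exact: (der_comp (fun y => A y t) (fun y => rho0 y / jac y (pos t)) (A_der_x x t)
  (Q_der_x _ _ (pos_ge0 t))).
Qed.

Let sol_rho_t (x t : R) : 0 < t -> is_derive t 1 (sol_rho x) (r_t x t).
Proof.
move=> t0; have e := posE t (ltW t0).
have d : is_derive t 1 (fun s => rho0 (A x s) / jac (A x s) s)
    (Qx (A x t) t * (- V (A x t) t / jac (A x t) t) + Qt (A x t) t).
  exact: (der_along (fun y s => rho0 y / jac y s) Qx (A x) t _ _ t t0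
    (fun y s _ st => Q_der_x y s (ltW (near_pos t t0 s st)))
    (Qx_c _ _ (ltW t0)) (A_der_t x t t0) (Q_der_t (A x t) t (ltW t0))).
have d' : is_derive t 1 (fun s => rho0 (A x s) / jac (A x s) s) (r_t x t).
  by apply: (der_eq d); rewrite /r_t /r_x e; ring.
by apply: (der_pos t0 _ d') => s s0; rewrite /sol_rho posE ?ltW.
Qed.

Let C1_of (f fx ft : R -> R -> R) :
  (forall x t : R, 0 < t -> is_derive x 1 (fun y => f y t) (fx x t)) ->
  (forall x t : R, 0 < t -> is_derive t 1 (f x) (ft x t)) ->
  (forall x t, 0 < t -> cont2 fx x t) -> (forall x t, 0 < t -> cont2 ft x t) ->
  C1_halfplane f.
Proof.
move=> fdx fdt fxc ftc x t t0; split.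
- exact: der_derivable (fdx x t t0).
- exact: der_derivable (fdt x t t0).
- apply: (near_time (dx f) fx x t t0) => [y s s0|]; last exact: fxc.
  exact: der_derive1 (fdx y s s0).
- apply: (near_time (dt f) ft x t t0) => [y s s0|]; last exact: ftc.
  exact: der_derive1 (fdt y s s0).
Qed.

Let invjac_c x t : cont2 (fun y s => (jac (A y s) (pos s))^-1) x t.
Proof. by apply: cont2V; [rewrite gt_eqF // jacA|exact: alongA]. Qed.

Let u_x_c x t : cont2 u_x x t.
Proof. by apply: cont2M; [exact: alongA|exact: invjac_c]. Qed.

Let along_pos (f : R -> R -> R) x t : (forall y s, 0 <= s -> cont2 f y s) ->
  cont2 (fun y s => f (A y s) (pos s)) x t.
Proof.
move=> fc; apply: (cont2_comp f A (fun _ s => pos s)).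
- exact/fc/pos_ge0.
- exact: A_c.
- exact: (tc _ _ _ pos_c).
Qed.

Let Qt_c x t : 0 <= t -> cont2 Qt x t.
Proof.
move=> t0; have j0 : jac x t != 0 by rewrite gt_eqF // jac_pos.
apply: cont2N; apply: cont2M; first by apply: cont2M; [exact: xc|exact: djac_c].
by apply: cont2V; [rewrite expf_neq0|apply: cont2M].
Qed.

Let sol_u_C1 : C1_halfplane sol_u.
Proof.
apply: (C1_of sol_u u_x u_t (fun x t _ => sol_u_x x t) sol_u_t) => x t _; first exact: u_x_c.
apply: cont2B; first exact: (alongA acc).
by apply: cont2M; [exact: (alongA V)|exact: u_x_c].
Qed.

Let sol_rho_C1 : C1_halfplane sol_rho.
Proof.
have rxc x t : cont2 r_x x t.
  by apply: cont2M; [exact: (along_pos Qx)|exact: invjac_c].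
apply: (C1_of sol_rho r_x r_t (fun x t _ => sol_rho_x x t) sol_rho_t) => x t _; first exact: rxc.
apply: cont2B; first exact: (along_pos Qt).
by apply: cont2M; [exact: (alongA V)|exact: rxc].
Qed.

(** Positions and velocities at a fixed time are combinations of this kind: the
    three terms are affine, of linear growth, and bounded. *)
Let affine_growth (k1 k2 k3 k4 : R) : exists2 C, 0 <= C & forall x,
  `|k1 * (x - c) + k2 * (u0 x - v) + k3 * (2 * (G0 x - l0) - M) + k4| <= C * (1 + `|x|).
Proof.
have [U U0 hU] := u0_growth; have [lN lP] := G0_lim.
have mono y z : y <= z -> G0 y <= G0 z.
  by rewrite le_eqVlt => /predU1P[->//|/der_lt/(_ dG0)] lt; apply/ltW/lt.
have hS x : `|2 * (G0 x - l0) - M| <= 3 * M.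
  have h1 : l0 <= G0 x.
    apply: (cvgr_to_le lN); exists x; split => [|y /= yx]; first exact: num_real.
    exact/mono/ltW.
  have h2 : G0 x <= l0 + M.
    apply: (cvgr_to_ge lP); exists x; split => [|y /= yx]; first exact: num_real.
    exact/mono/ltW.
  by apply/ler_normlP; split; have := M_gt0; lra.
exists (`|k1| * (1 + `|c|) + `|k2| * (U + `|v|) + `|k3| * (3 * M) + `|k4|) => [|x].
  by rewrite !addr_ge0 ?mulr_ge0 ?addr_ge0 // ltW.
set n := 1 + `|x|; have n0 : 1 <= n by rewrite /n lerDl.
have wide y : 0 <= y -> y <= y * n by move=> y0; have := ler_wpM2l y0 n0; rewrite mulr1.
have e1 : `|x - c| <= (1 + `|c|) * n.
  apply: le_trans (ler_normB _ _) _; rewrite /n.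
  by have := mulr_ge0 (normr_ge0 c) (normr_ge0 x); lra.
have e2 : `|u0 x - v| <= (U + `|v|) * n.
  apply: le_trans (ler_normB _ _) _; have := hU x; rewrite -/n.
  by have := wide _ (normr_ge0 v); lra.
have e3 : `|2 * (G0 x - l0) - M| <= 3 * M * n.
  by apply: le_trans (hS x) (wide _ _); rewrite mulr_ge0 // ltW.
have -> : (`|k1| * (1 + `|c|) + `|k2| * (U + `|v|) + `|k3| * (3 * M) + `|k4|) * n =
  `|k1| * ((1 + `|c|) * n) + `|k2| * ((U + `|v|) * n) + `|k3| * (3 * M * n) + `|k4| * n.
  by ring.
apply: le_trans (ler_normD _ _) (lerD _ (wide _ (normr_ge0 _))).
apply: le_trans (ler_normD _ _) (lerD _ _); last by rewrite normrM ler_wpM2l.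
by apply: le_trans (ler_normD _ _) (lerD _ _); rewrite normrM ler_wpM2l.
Qed.

Let growth t : exists2 C, 1 <= C & forall x,
  `|X x t| <= C * (1 + `|x|) /\ `|V x t| <= C * (1 + `|x|).
Proof.
have [C1 p1 h1] := affine_growth (a t) (b t) (h t) (m t).
have [C2 p2 h2] := affine_growth (- M * b t) (a t - b t) (b t) (v * expR (- 1 * t)).
exists (1 + C1 + C2) => [|x]; first by lra.
have n0 := ltW (n1 x); have := mulr_ge0 p1 n0; have := mulr_ge0 p2 n0.
by split; [apply: le_trans (h1 x) _|apply: le_trans (h2 x) _]; lra.
Qed.

(** By [growth] a label is at least of the order of the position, so that negative
    powers of labels are bounded by those of positions. *)
Let sol_decay t : 0 <= t -> exists2 C, 0 <= C & forall x,
  sol_rho x t <= C * (1 + `|x|) `^ (- (2 + delta)) /\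
  sol_rho x t * (1 + `|sol_u x t|) ^+ 2 <= C * (1 + `|x|) `^ (- delta).
Proof.
move=> t0; have e := posE t t0; have [k k0 hk] := jac_lower t t0.
have [C C1' hC] := growth t; have Cp : 0 < C by lra.
pose D := 2 * C; have D0 : 0 < D by rewrite /D; lra.
pose K := C0 / k; have K0 : 0 <= K by rewrite divr_ge0 // ltW.
have pw (p x y : R) : 0 <= p -> 1 + `|x| <= D * (1 + `|y|) ->
    (1 + `|y|) `^ (- p) <= D `^ p * (1 + `|x|) `^ (- p).
  move=> p0' xy; have nx := ltW (n1 x); have ny := ltW (n1 y); have nD := ltW D0.
  have Dy : 0 <= D * (1 + `|y|) by exact: mulr_ge0.
  have le : (1 + `|x|) `^ p <= D `^ p * (1 + `|y|) `^ p.
    by rewrite -powRM //; exact: (ge0_ler_powR p0' nx Dy xy).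
  rewrite !powRN ler_pdivlMr ?powR_gt0 // ler_pdivrMl ?powR_gt0 //.
  by rewrite mulrC.
have rel x : 1 + `|x| <= D * (1 + `|A x t|).
  have [h1 _] := hC (A x t); rewrite XA0 // in h1.
  by have := normr_ge0 (A x t); rewrite /D; nra.
have base x : sol_rho x t <= K * (1 + `|A x t|) `^ (- (2 + delta)).
  rewrite /sol_rho e /K mulrAC; apply: ler_pM.
  - exact/ltW/rho0_gt0.
  - by rewrite invr_ge0 ltW // jac_pos.
  - exact: rho0_le.
  - by rewrite lef_pV2 ?posrE ?hk // jac_pos.
have uA x : 1 + `|sol_u x t| <= D * (1 + `|A x t|).
  have [_ h1] := hC (A x t); rewrite /sol_u e.
  by have := normr_ge0 (A x t); rewrite /D; nra.
have r0 x : 0 <= sol_rho x t by rewrite /sol_rho divr_ge0 ?ltW ?rho0_gt0 ?jacA.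
have KD2 : 0 <= K * D ^+ 2 by apply: mulr_ge0 => //; exact: sqr_ge0.
have KD p : 0 <= K * D `^ p by apply: mulr_ge0 => //; exact: powR_ge0.
have KDp p : 0 <= K * D ^+ 2 * D `^ p by apply: mulr_ge0 => //; exact: powR_ge0.
exists (K * D `^ (2 + delta) + K * D ^+ 2 * D `^ delta) => [|x]; first exact: addr_ge0.
have q2 := mulr_ge0 (KDp delta) (powR_ge0 (1 + `|x|) (- (2 + delta))).
have q3 := mulr_ge0 (KD (2 + delta)) (powR_ge0 (1 + `|x|) (- delta)).
split.
- apply: le_trans (base x) _.
  have d2 : 0 <= 2 + delta by rewrite addr_ge0 // ltW.
  have := ler_wpM2l K0 (pw (2 + delta) x (A x t) d2 (rel x)); lra.
- have sq : (1 + `|sol_u x t|) ^+ 2 <= (D * (1 + `|A x t|)) ^+ 2.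
    by rewrite ler_pXn2r ?nnegrE ?(ltW (n1 _)) // mulr_ge0 ?(ltW D0) ?(ltW (n1 _)).
  have h1 := ler_pM (r0 x) (sqr_ge0 (1 + `|sol_u x t|)) (base x) sq.
  apply: le_trans h1 _.
  have -> : K * (1 + `|A x t|) `^ (- (2 + delta)) * (D * (1 + `|A x t|)) ^+ 2 =
    K * D ^+ 2 * (1 + `|A x t|) `^ (- delta).
    have -> : (1 + `|A x t|) `^ (- delta) =
        (1 + `|A x t|) * ((1 + `|A x t|) * (1 + `|A x t|) `^ (- (2 + delta))).
      by rewrite decay_mul decay_mul1.
    by ring.
  have := ler_wpM2l KD2 (pw delta x (A x t) (ltW delta_gt0) (rel x)); lra.
Qed.

Let sol_rho_ge0 x t : 0 <= sol_rho x t.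
Proof. by rewrite /sol_rho divr_ge0 ?ltW ?rho0_gt0 ?jacA. Qed.

Let A_cvgy t : A x t @[x --> +oo] --> +oo.
Proof. by apply: surj_cvgy => [x y|y]; [exact: A_le|exact: A_surj]. Qed.
Let A_cvgNy t : A x t @[x --> -oo] --> -oo.
Proof. by apply: surj_cvgNy => [x y|y]; [exact: A_le|exact: A_surj]. Qed.

(** Primitives of [sol_rho] and of its first moment are obtained by composing with
    [A] primitives of [rho0] and of [X y t * rho0 y]; the limits at both ends are
    those of the initial data. The quadratic term [G0 ^+ 2] in [H] accounts for
    the internal forces, whose contribution cancels between the two ends. *)
Let sol_moments t : 0 <= t ->
  [/\ has_int (fun y => sol_rho y t) M, has_int (fun y => y * sol_rho y t) (M * m t) &
    forall x, (\int[lebesgue_measure]_(y in `]-oo, x]) sol_rho y t)%R = G0 (A x t) - l0].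
Proof.
move=> t0; have e := posE t t0; have [C C_ge0 hC] := sol_decay t t0.
have rc : continuous (fun y => sol_rho y t) by exact: cont2_slice.
have yrc : continuous (fun y => y * sol_rho y t).
  by move=> y; apply: cvgM; [exact: cvg_id|exact: rc].
have [w1 hw1] : exists w, has_int (fun y => sol_rho y t) w.
  have d1 : 0 < 1 + delta by rewrite addr_gt0.
  apply: (has_int_decay _ _ C d1 rc) => x.
  have [h1 _] := hC x; rewrite (ger0_norm (sol_rho_ge0 x t)).
  by have -> : 1 + (1 + delta) = 2 + delta by ring.
have [w2 hw2] : exists w, has_int (fun y => y * sol_rho y t) w.
  apply: (has_int_decay _ _ C delta_gt0 yrc) => x.
  have [h1 _] := hC x; rewrite normrM (ger0_norm (sol_rho_ge0 x t)) -decay_mul.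
  have xn : `|x| <= 1 + `|x| by rewrite lerDr.
  have := ler_pM (normr_ge0 x) (sol_rho_ge0 x t) xn h1.
  by rewrite (mulrCA C).
have dP (x : R) : is_derive x 1 (fun y => G0 (A y t)) (sol_rho x t).
  exact: (der_comp (fun y => A y t) G0 (A_der_x x t) (dG0 _)).
have [lN lP] := G0_lim.
have [k1 [kN kP kI]] := improper_integral rc hw1 dP.
have e1 : k1 = l0 := cvgNy_unique kN (cvg_comp _ _ (A_cvgNy t) lN).
have e2 : k1 + w1 = l0 + M := cvgy_unique kP (cvg_comp _ _ (A_cvgy t) lP).
have e3 : w1 = M by apply: (addrI k1); rewrite e2 e1.
have yr0c (f : R -> R) : continuous f -> continuous (fun y => f y * rho0 y).
  by move=> fc y; apply: cvgM; [exact: fc|exact: rho0_c].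
have dp := fun y => der_prim _ y (yr0c _ idc).
have dq := fun y => der_prim _ y (yr0c _ u0_c).
set P1 := prim _ in dp; set P2 := prim _ in dq.
have [l1 [pN pP _]] := improper_integral (yr0c _ idc) hp dp.
have [l2 [qN qP _]] := improper_integral (yr0c _ u0_c) hq dq.
pose r := - (a t * c) - b t * v - h t * (2 * l0 + M) + m t.
pose H y := a t * P1 y + b t * P2 y + h t * (G0 y * G0 y) + r * G0 y.
have dH (y : R) : is_derive y 1 H (X y t * rho0 y).
  apply: (der_eq (derD (derD (derD
    (derZ (a t) (dp y)) (derZ (b t) (dq y)))
    (derZ (h t) (derM (dG0 y) (dG0 y)))) (derZ r (dG0 y)))).
  by rewrite /X /r; ring.
have dHA (x : R) : is_derive x 1 (fun y => H (A y t)) (x * sol_rho x t).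
  apply: (der_eq (der_comp (fun y => A y t) H (A_der_x x t) (dH _))).
  by rewrite XA0 // /sol_rho e; ring.
have [k2 [jN jP _]] := improper_integral yrc hw2 dHA.
have cZ (k : R) (f : R -> R) (FF : set_system R) (FFF : Filter FF) (l : R) :
    f x @[x --> FF] --> l -> k * f x @[x --> FF] --> k * l.
  by move=> hf; apply: cvgM => //; exact: cvg_cst.
have HN : H y @[y --> -oo] --> a t * l1 + b t * l2 + h t * (l0 * l0) + r * l0.
  by apply: cvgD; [apply: cvgD; [apply: cvgD|]|]; apply: cZ => //; apply: cvgM.
have HP : H y @[y --> +oo] --> a t * (l1 + p0) + b t * (l2 + q0) +
    h t * ((l0 + M) * (l0 + M)) + r * (l0 + M).
  by apply: cvgD; [apply: cvgD; [apply: cvgD|]|]; apply: cZ => //; apply: cvgM.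
have e4 : k2 = a t * l1 + b t * l2 + h t * (l0 * l0) + r * l0 :=
  cvgNy_unique jN (cvg_comp _ _ (A_cvgNy t) HN).
have e5 : k2 + w2 = a t * (l1 + p0) + b t * (l2 + q0) +
    h t * ((l0 + M) * (l0 + M)) + r * (l0 + M) :=
  cvgy_unique jP (cvg_comp _ _ (A_cvgy t) HP).
have e6 : w2 = M * m t.
  apply: (addrI k2); rewrite e5 e4 /r /c /v; field; rewrite gt_eqF //.
rewrite e3 in hw1; rewrite e6 in hw2; split => //.
by move=> x; rewrite kI e1.
Qed.

Let sol_system : euler_system sol_rho sol_u.
Proof.
move=> x t t0; have e := posE t (ltW t0); have [h1 h2 h3] := sol_moments t (ltW t0).
have [hi hv] := has_int_dW _ x _ _ h1 h2.
have jn : jac (A x t) t != 0 by rewrite gt_eqF // jac_pos // ltW.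
split; first exact: hi.
- rewrite /dt (der_derive1 (sol_rho_t x t t0)) /dx.
  rewrite (der_derive1 (derM (sol_rho_x x t) (sol_u_x x t))).
  by rewrite /r_t /r_x /u_x /Qt /sol_rho /sol_u e; field.
- rewrite /dt (der_derive1 (sol_u_t x t t0)) /dx (der_derive1 (sol_u_x x t)).
  rewrite /dW_conv hv h3 /u_t /sol_u e /acc XA0 ?(ltW t0) //; ring.
Qed.

Let sol_init x : sol_rho x 0 = rho0 x /\ sol_u x 0 = u0 x.
Proof.
have e := posE 0 (lexx 0).
have X0 y : X y 0 = y.
  have E : expR (- 1 * 0) = 1 :> R by rewrite mulr0 expR0.
  by rewrite /X /m (fund_a0 F) (fund_b0 F) (fund_h0 F) E; ring.
have A00 : A x 0 = x by rewrite -{1}(X0 x) -{1}e AX.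
have E : expR (- 1 * 0) = 1 :> R by rewrite mulr0 expR0.
rewrite /sol_rho /sol_u A00 e /V /flow_jac (fund_a0 F) (fund_b0 F) (fund_h0 F) E.
by split; [rewrite !mul0r !addr0 divr1|ring].
Qed.

Let sol_decays t : 0 <= t -> decay delta sol_rho sol_u t.
Proof.
move=> t0; have [C C_ge0 hC] := sol_decay t t0; split; last first.
  exists C => x x0; have [h1 _] := hC x; apply: le_trans h1 _.
  apply: ler_wpM2l => //; rewrite powRN lef_pV2 ?posrE ?powR_gt0 ?normr_gt0 //.
  by apply: ge0_ler_powR; rewrite ?nnegrE ?addr_ge0 ?(ltW delta_gt0) // lerDr.
move=> i i12.
have le x : `|sol_rho x t * `|sol_u x t| ^+ i| <= C * (1 + `|x|) `^ (- delta).
  have [_ h1] := hC x; apply: le_trans h1.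
  rewrite normrM (ger0_norm (sol_rho_ge0 x t)); apply: ler_wpM2l => //.
  rewrite ger0_norm ?exprn_ge0 //.
  have n0 := normr_ge0 (sol_u x t).
  by case: i i12 => [|[|[|i]]] // _; rewrite ?expr1 ?expr2; nra.
split; apply/cvgrPdist_lt => e e0; have [K K0 hK] := power_small C delta e delta_gt0 e0.
- exists K; split => [|x /= Kx]; first exact: num_real.
  by rewrite sub0r normrN; apply: le_lt_trans (le x) (hK x _); apply: lt_le_trans Kx (ler_norm x).
- exists (- K); split => [|x /= Kx]; first exact: num_real.
  rewrite sub0r normrN; apply: le_lt_trans (le x) (hK x _).
  by have := ler_norm (- x); rewrite normrN; lra.
Qed.

Lemma solution_exists : exists rho u, global_solution delta rho0 u0 rho u.
Proof.
exists sol_rho, sol_u; split => //.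
by split; apply: closed_halfplane.
Qed.
End Existence.

(** * Thresholds and global solutions *)

Section Criterion.
Context {R : realType}.
Variables (delta : R) (rho0 u0 : R -> R).
Hypotheses (rho0_C1 : C1 rho0) (u0_C1 : C1 u0) (du0_C1 : C1 (derive1 u0))
  (rho0_gt0 : forall x : R, 0 < rho0 x) (delta_gt0 : 0 < delta)
  (du0_bounded : bounded_fun (derive1 u0))
  (rho0_bounded :
     bounded_fun (fun x : R => (1 + x ^+ 2) `^ ((2 + delta) / 2) * rho0 x)).

Lemma bounded_fun_le (f : R -> R) : bounded_fun f -> exists K, forall x, `|f x| <= K.
Proof.
move=> [K [_ /(_ (`|K| + 1))]] h; exists (`|K| + 1) => x.
by apply: h => //; have := ler_norm K; lra.
Qed.

Let rho0_c : continuous rho0.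
Proof. by move=> x; apply: der_cont (derivable_der _); case: rho0_C1. Qed.

Let u0_d (x : R) : derivable u0 x 1. Proof. by case: u0_C1. Qed.

Lemma rho0_power : exists C0, forall x, rho0 x <= C0 * (1 + `|x|) `^ (- (2 + delta)).
Proof.
have [K hK] := bounded_fun_le _ rho0_bounded.
pose p := (2 + delta) / 2; have p0 : 0 <= p by rewrite /p; have := delta_gt0; lra.
exists (K * 2 `^ p) => x.
have x1 : 0 < 1 + `|x| by have := normr_ge0 x; lra.
have x2 : 0 < 1 + x ^+ 2 by have := sqr_ge0 x; lra.
have sq : (1 + `|x|) ^+ 2 <= 2 * (1 + x ^+ 2).
  rewrite -(real_normK (num_real x)); have := sqr_ge0 (`|x| - 1); lra.
have pw : (1 + `|x|) `^ (2 + delta) <= 2 `^ p * (1 + x ^+ 2) `^ p.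
  have -> : 2 + delta = 2%:R * p by rewrite /p; field.
  rewrite powRrM powR_mulrn ?(ltW x1) // -powRM ?(ltW x2) //.
  by apply: (ge0_ler_powR p0) sq; rewrite ?nnegrE ?sqr_ge0 // mulr_ge0 // ltW.
have := hK x; rewrite ger0_norm; last by rewrite mulr_ge0 ?powR_ge0 // ltW.
rewrite -/p => k; have w0 : 0 < (1 + `|x|) `^ (2 + delta) by exact: powR_gt0.
rewrite powRN ler_pdivlMr //.
have h1 := ler_wpM2l (ltW (rho0_gt0 x)) pw.
have h2 := ler_wpM2l (powR_ge0 2 p) k.
by lra.
Qed.

Lemma rho0_mass : has_int rho0 (mass rho0).
Proof.
have [C0 hC] := rho0_power.
have d1 : 0 < 1 + delta by rewrite addr_gt0.
have [v [hv _]] : exists v, has_int rho0 v.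
  apply: (has_int_decay _ _ C0 d1 rho0_c) => x.
  rewrite (gtr0_norm (rho0_gt0 x)); have -> : 1 + (1 + delta) = 2 + delta by ring.
  exact: hC.
by [].
Qed.

Lemma mass_gt0 : 0 < mass rho0.
Proof.
have dG := fun x => der_prim rho0 x rho0_c.
have [l [lN lP _]] := improper_integral rho0_c rho0_mass dG.
have lt x y : x < y -> prim rho0 x < prim rho0 y by move=> xy; exact: (der_lt xy dG).
have h1 : l <= prim rho0 0.
  apply: (cvgr_to_le lN); exists 0; split => [|y /= y0]; first exact: num_real.
  exact/ltW/lt.
have h2 : prim rho0 1 <= l + mass rho0.
  apply: (cvgr_to_ge lP); exists 1; split => [|y /= y0]; first exact: num_real.
  exact/ltW/lt.
by have := lt 0 1 ltr01; lra.
Qed.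

Lemma rho0_small (e : R) : 0 < e -> exists x, rho0 x < e.
Proof.
move=> e0; have [C0 hC] := rho0_power.
have d2 : 0 < 2 + delta by rewrite addr_gt0.
have [K K0 hK] := power_small C0 (2 + delta) e d2 e0.
exists (K + 1); apply: le_lt_trans (hC _) (hK _ _).
by rewrite ger0_norm; lra.
Qed.

Lemma global_flow (a b h : R -> R) (rho u : R -> R -> R) : fund (mass rho0) a b h ->
  global_solution delta rho0 u0 rho u -> exists X, is_flow rho u rho0 u0 a b h X.
Proof.
move=> F [[r1 u1] [rc uc] sys init _].
have [M [N [l force]]] := force_exists rho u rc sys.
exact: (flow_from_zero rho u rho0 u0 r1 u1 rc uc sys init rho0_c rho0_gt0 _ rho0_mass
  M N l force a b h F).
Qed.

Lemma global_jac (a b h : R -> R) (rho u : R -> R -> R) (x t : R) :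
  fund (mass rho0) a b h -> global_solution delta rho0 u0 rho u -> 0 <= t ->
  0 < a t + b t * derive1 u0 x + h t * (2 * rho0 x).
Proof.
move=> F gs t0; have [X flow] := global_flow _ _ _ _ _ F gs.
have [_ [rc _] _ _ _] := gs.
exact: (jac_gt0 _ _ _ _ _ _ _ _ _ F rho0_c rho0_gt0 u0_d rc flow x t t0).
Qed.

Lemma global_unique rho u rho' u' : global_solution delta rho0 u0 rho u ->
  global_solution delta rho0 u0 rho' u' ->
  forall x t : R, 0 <= t -> rho' x t = rho x t /\ u' x t = u x t.
Proof.
move=> g g' x t; have [a [b [h F]]] := fund_exists (mass rho0).
have [X fl] := global_flow _ _ _ _ _ F g; have [X' fl'] := global_flow _ _ _ _ _ F g'.
have [_ [rc uc] sys init _] := g; have [_ [rc' uc'] sys' init' _] := g'.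
rewrite le_eqVlt => /predU1P[<-|t0].
  by have [-> ->] := init x; have [-> ->] := init' x.
exact: (flow_unique _ _ _ _ _ _ _ _ _ _ _ _ F rho0_c rho0_gt0 u0_d rc rc' uc uc' sys sys'
  (fun x => (init x).2) (fun x => (init' x).2) fl fl').
Qed.

(** Both the existence of the solution and the membership in the region amount to
    positivity of the Jacobian at all times. *)
Lemma criterion_overdamped (Ra : R -> R) : mass rho0 <= 1 / 4 -> is_Ra (mass rho0) Ra ->
  unique_global_solution delta rho0 u0 <->
  forall x : R, region_above Ra (rho0 x, derive1 u0 x).
Proof.
move=> M4 hR; have [a [b [h F]]] := fund_exists (mass rho0); split.
- move=> [rho [u [gs _]]] x; apply/(region_aboveP _ _ _ _ F M4 Ra _ _ hR (rho0_gt0 x)).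
  by move=> t t0; exact: (global_jac a b h rho u).
- move=> reg; have [B hB] := bounded_fun_le _ du0_bounded; have [C0 hC] := rho0_power.
  have jac_pos x t : 0 <= t -> 0 < flow_jac rho0 u0 a b h x t.
    by move=> t0; apply: (region_aboveP _ _ _ _ F M4 Ra _ _ hR (rho0_gt0 x)).2.
  have [rho [u gs]] := solution_exists rho0 u0 delta (mass rho0) B C0 a b h rho0_C1 u0_C1 du0_C1
    rho0_gt0 delta_gt0 hB hC rho0_mass mass_gt0 M4 F jac_pos.
  by exists rho, u; split => // rho' u' gs'; exact: global_unique.
Qed.

(** Above the critical mass the regions of low density always collapse: there
    the Jacobian follows the free oscillation, which changes sign. *)
Lemma no_solution_underdamped : mass rho0 > 1 / 4 ->
  ~ unique_global_solution delta rho0 u0.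
Proof.
move=> M4 [rho [u [gs _]]]; have [a [b [h F]]] := fund_exists (mass rho0).
have [t [t0 bt at0]] := half_period _ _ _ _ F M4.
have h0 : 0 < 2 * (`|h t| + 1) by have := normr_ge0 (h t); lra.
have [x hx] := rho0_small (- a t / (2 * (`|h t| + 1))) ltac:(by rewrite divr_gt0 // oppr_gt0).
have := global_jac _ _ _ _ _ x t F gs (ltW t0); rewrite bt mul0r addr0.
rewrite ltr_pdivlMr // in hx.
have r0 := ltW (rho0_gt0 x).
have := ler_wpM2r r0 (ler_norm (h t)).
by lra.
Qed.

(** The region requires [rho > 1 / gamma], but [rho0] vanishes at infinity. *)
Lemma region_between_empty (R1 R2 : R -> R) :
  ~ forall x : R, region_between (mass rho0) R1 R2 (rho0 x, derive1 u0 x).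
Proof.
have M0 := mass_gt0.
have g0 : 0 < gamma (mass rho0).
  rewrite /gamma mulr_gt0 ?divr_gt0 // addr_gt0 //; exact: expR_gt0.
have [x hx] := rho0_small (1 / gamma (mass rho0)) ltac:(by rewrite divr_gt0).
by move=> /(_ x)[_ /=]; rewrite ltNge (ltW hx).
Qed.
End Criterion.

Theorem theorem5p3 (R : realType) (delta M0 : R) (rho0 u0 : R -> R)
  (rho0_C1 : C1 rho0) (u0_C1 : C1 u0)
  (du0_C1 : C1 (derive1 u0))
  (rho0_gt0 : forall x : R, 0 < rho0 x)
  (delta_gt0 : 0 < delta)
  (du0_bounded : continuous (derive1 u0) /\ bounded_fun (derive1 u0))
  (rho0_decay :
     continuous (fun x : R => (1 + x ^+ 2) `^ ((2 + delta) / 2) * rho0 x) /\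
     bounded_fun (fun x : R => (1 + x ^+ 2) `^ ((2 + delta) / 2) * rho0 x))
  (M0E : M0 = mass rho0) :
  [/\ M0 < 1 / 4 ->
        (exists Ra, is_Ra M0 Ra) /\
        forall Ra, is_Ra M0 Ra ->
          (unique_global_solution delta rho0 u0 <->
           forall x : R, region_above Ra (rho0 x, derive1 u0 x)),
      M0 = 1 / 4 ->
        (exists Rb : R -> R, is_Rb Rb) /\
        forall Rb : R -> R, is_Rb Rb ->
          (unique_global_solution delta rho0 u0 <->
           forall x : R, region_above Rb (rho0 x, derive1 u0 x))
    & M0 > 1 / 4 ->
        (exists R1, is_R1 M0 R1) /\ (exists R2, is_R2 M0 R2) /\
        forall R1 R2, is_R1 M0 R1 -> is_R2 M0 R2 ->
          (unique_global_solution delta rho0 u0 <->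
           forall x : R, region_between M0 R1 R2 (rho0 x, derive1 u0 x))].
Proof.
have [_ db] := du0_bounded; have [_ rb] := rho0_decay.
have [a [b [h F]]] := fund_exists M0.
have crit (Ra : R -> R) : M0 <= 1 / 4 -> is_Ra M0 Ra ->
    (unique_global_solution delta rho0 u0 <->
     forall x : R, region_above Ra (rho0 x, derive1 u0 x)).
  by rewrite M0E; exact: criterion_overdamped.
split=> M4.
- split; first exact: (Ra_exists _ _ _ _ F (ltW M4)).
  by move=> Ra; apply: crit; exact: ltW.
- have M4' : M0 <= 1 / 4 by rewrite M4.
  split=> [|Rb /is_RbP hRb]; last by apply: crit => //; rewrite M4.
  have [Ra hRa] := Ra_exists _ _ _ _ F M4'.
  by exists Ra; apply/is_RbP; rewrite -M4.
- split; [exact: (R1_exists _ _ _ _ F M4)|split; first exact: (R2_exists _ _ _ _ F M4)].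
  move=> R1 R2 _ _; split.
    by move=> /(no_solution_underdamped _ _ _ rho0_C1 u0_C1 rho0_gt0 delta_gt0 rb)[]; rewrite -M0E.
  by rewrite M0E => /(region_between_empty _ _ _ rho0_C1 rho0_gt0 delta_gt0 rb).
Qed.
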